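(* Let $d\ge2$, and let $\Omega\subset\mathbb R^d$ be a bounded $C^{1,1}$ domain. There is a family $f_h\in C_c^\infty(\overline\Omega\times\mathbb R^d)$, indexed by small $h>0$, $h\downarrow0$, such that $$\sup_h\mathcal E^\gamma_\Omega(f_h)<\infty,$$ and, for every $1\le p<\infty$, $$\mathcal T^\gamma_{p,\Omega}(f_h)\asymp_{p,\Omega}h^{(p-2)/6},$$ i.e. the two sides are comparable up to positive constants depending on $p$ and $\Omega$ but not on $h$. Thus the weighted boundary functional $\mathcal T^\gamma_{p,\Omega}(f_h)$ diverges as $h\downarrow0$ for $p<2$; for $p=2$ it satisfies $0<c\le\mathcal T^\gamma_{2,\Omega}(f_h)\le C$ with constants independent of $h$; and it tends to zero for every $p>2$.
   Context: All functions are real-valued. $d\gamma_d(v)=(2\pi)^{-d/2}e^{-|v|^2/2}dv$ on $\mathbb R^d$. $H^1_\gamma$ is the space with norm $\|g\|_{H^1_\gamma}^2=\int_{\mathbb R^d}(|g|^2+|\nabla_vg|^2)\,d\gamma_d$, and $H^{-1}_\gamma$ is its dual, an $L^2(\gamma_d)$ function $q$ acting by $\langle q,\phi\rangle=\int q\phi\,d\gamma_d$. $C_c^\infty(\overline\Omega\times\mathbb R^d)$ denotes restrictions (in $x$) to $\overline\Omega$ of functions in $C_c^\infty(\mathbb R^d\times\mathbb R^d)$. Define $$\mathcal E^\gamma_\Omega(f)=\|f\|_{L^2(\Omega;H^1_\gamma)}^2+\|v\cdot\nabla_xf\|_{L^2(\Omega;H^{-1}_\gamma)}^2,$$ $$\mathcal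 T^\gamma_{p,\Omega}(f)=\int_{\partial\Omega}\int_{\mathbb R^d}|f(x,v)|^2\,\omega_p(|v\cdot n_\Omega(x)|)\,d\gamma_d(v)\,dS(x),\qquad \omega_p(s)=\min\{s,s^p\},$$ where $n_\Omega$ is the outward unit normal and $dS$ surface measure. *)

(* Defs.v *)
From HB Require Import structures.
From mathcomp Require Import all_boot all_order all_algebra.
From mathcomp Require Import ring lra.
From mathcomp Require Import all_classical all_reals all_analysis.

Set Implicit Arguments.
Unset Strict Implicit.
Unset Printing Implicit Defensive.

Import Order.TTheory GRing.Theory Num.Theory.
Import numFieldNormedType.Exports.

Local Open Scope classical_set_scope.
Local Open Scope ring_scope.

(* Borel sigma-algebra of R^n, generated by the coordinates. *)
Fact rV_display : measure_display.
Proof. exact: default_measure_display. Qed.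

Section rV_measurable.
Variables (R : realType) (n : nat).

Definition rV_coord (i : 'I_n) (x : 'rV[R]_n) : R := x ord0 i.

Let rV_set0 : g_sigma_preimage rV_coord set0.
Proof. exact: sigma_algebra0. Qed.

Let rV_setC A : g_sigma_preimage rV_coord A -> g_sigma_preimage rV_coord (~` A).
Proof. exact: sigma_algebraC. Qed.

Let rV_bigcup (F : (set 'rV[R]_n)^nat) :
  (forall i, g_sigma_preimage rV_coord (F i)) ->
  g_sigma_preimage rV_coord (\bigcup_i F i).
Proof. exact: sigma_algebra_bigcup. Qed.

HB.instance Definition _ := @isMeasurable.Build rV_display
  'rV[R]_n (g_sigma_preimage rV_coord) rV_set0 rV_setC rV_bigcup.

End rV_measurable.

Lemma measurable_rV_coord (R : realType) n (i : 'I_n) :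
  measurable_fun setT (@rV_coord R n i).
Proof.
move=> _ B mB; rewrite setTI; apply: sub_sigma_algebra.
rewrite -bigcup_seq/=; exists i => /=; first by rewrite mem_index_enum.
by exists B => //; rewrite setTI.
Qed.

Lemma measurable_fun_rV d (T : measurableType d) (R : realType) n
    (f : T -> 'rV[R]_n) :
  (forall i, measurable_fun setT (rV_coord i \o f)) -> measurable_fun setT f.
Proof.
move=> mf _ C mC; rewrite setTI.
have : preimage_set_system setT f (g_sigma_preimage (@rV_coord R n))
    (f @^-1` C) by exists C => //; rewrite setTI.
rewrite -g_sigma_preimage_comp.
apply: smallest_sub; first exact: sigma_algebra_measurable.
rewrite -bigcup_seq; apply: bigcup_sub => i _ _ [B mB <-]; exact: mf.
Qed.

Section rV_cons.
Variables (R : realType) (n : nat).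

Definition rV_cons (z : R * 'rV[R]_n) : 'rV[R]_n.+1 :=
  \row_(j < n.+1) if unlift ord0 j is Some i then z.2 ord0 i else z.1.

Definition rV_behead (x : 'rV[R]_n.+1) : 'rV[R]_n :=
  \row_(j < n) x ord0 (lift ord0 j).

Lemma measurable_rV_cons : measurable_fun setT rV_cons.
Proof.
apply: measurable_fun_rV => j; rewrite /comp /rV_coord /rV_cons.
under eq_fun do rewrite mxE; case: (unlift ord0 j) => [i|]; last exact: measurable_fst.
by apply: (@measurableT_comp _ _ _ _ _ _ (@rV_coord R n i) _ snd);
  [exact: measurable_rV_coord|exact: measurable_snd].
Qed.

Variable m : {sigma_finite_measure set 'rV[R]_n -> \bar R}.

Definition cons_measure : set 'rV[R]_n.+1 -> \bar R :=
  pushforward (product_measure1 (@lebesgue_measure R) m) rV_cons.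

Let cm0 : cons_measure set0 = 0%E.
Proof. by rewrite /cons_measure /pushforward preimage_set0 measure0. Qed.

Let cm_ge0 A : (0 <= cons_measure A)%E.
Proof. by rewrite /cons_measure /pushforward; exact: measure_ge0. Qed.

Let cm_sigma_additive : semi_sigma_additive cons_measure.
Proof.
have mc := measurable_rV_cons.
exact: (@measure_semi_sigma_additive _ _ _
  (pushforward (product_measure1 (@lebesgue_measure R) m) rV_cons)).
Qed.

HB.instance Definition _ := isMeasure.Build _ _ _ cons_measure
  cm0 cm_ge0 cm_sigma_additive.

Let cm_sigma_finite : sigma_finite setT cons_measure.
Proof.
have /sigma_finiteP[F [TF ndF Foo]] := sigma_finiteT (@lebesgue_measure R).
have /sigma_finiteP[G [TG ndG Goo]] := sigma_finiteT m.
pose u (x : 'rV[R]_n.+1) := (x ord0 ord0, rV_behead x).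
have mu : measurable_fun setT u.
  apply/measurable_fun_pairP; split; first exact: measurable_rV_coord.
  apply: measurable_fun_rV => i; rewrite /comp /rV_coord /rV_behead/=.
  under eq_fun do rewrite mxE; exact: measurable_rV_coord.
have uK : cancel rV_cons u.
  move=> [a x]; rewrite /u /rV_cons mxE unlift_none/=; congr pair.
  by apply/rowP => i; rewrite !mxE liftK.
exists (fun k => u @^-1` (F k `*` G k)) => [|k].
  rewrite -preimage_bigcup (_ : \bigcup_k _ = setT) ?preimage_setT//.
  rewrite -setXTT TF TG predeqE => -[x y]; split.
    by move=> [k _ []/= ? ?]; split; exists k.
  move=> [/= [k _ Fkx] [l _ Gly]]; exists (maxn k l) => //; split.
  - by move: x Fkx; exact/subsetPset/ndF/leq_maxl.
  - by move: y Gly; exact/subsetPset/ndG/leq_maxr.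
have [mFk Fk] := Foo k; have [mGk Gk] := Goo k; split.
  by rewrite -[X in measurable X]setTI; apply: mu => //; exact: measurableX.
rewrite /cons_measure /pushforward -comp_preimage.
rewrite (_ : u \o rV_cons = id); last by apply/funext => z; exact: uK.
by rewrite preimage_id product_measure1E// lte_mul_pinfty// ge0_fin_numE.
Qed.

HB.instance Definition _ := Measure_isSigmaFinite.Build _ _ _ cons_measure
  cm_sigma_finite.

End rV_cons.

(* Lebesgue measure on R^n, as an iterated product measure. *)
Fixpoint leb (R : realType) (n : nat) :
    {sigma_finite_measure set 'rV[R]_n -> \bar R} :=
  match n with
  | 0%N => dirac (0 : 'rV[R]_0)
  | n'.+1 => cons_measure (leb R n')
  end.

(* The norm of the library on 'rV[R]_n is the sup norm; enorm is Euclidean. *)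
Definition dotp (R : realType) n (u v : 'rV[R]_n) : R :=
  \sum_(i < n) u ord0 i * v ord0 i.

Definition enorm (R : realType) n (u : 'rV[R]_n) : R := Num.sqrt (dotp u u).

Lemma coord_le_enorm (R : realType) n (u : 'rV[R]_n) i :
  `|u ord0 i| <= enorm u.
Proof.
rewrite -sqrtr_sqr /enorm ler_wsqrtr// /dotp (bigD1 i)//= expr2 lerDl.
by apply: sumr_ge0 => j _; rewrite -expr2 sqr_ge0.
Qed.

(* s-dimensional Hausdorff measure on R^n, normalized to agree with Lebesgue   *)
(* measure when s = n; for s = n - 1 it is the surface measure of C^1          *)
(* hypersurfaces. mu_ext takes the infimum over countable covers by Borel      *)
(* sets, which is no restriction: a set and its closure have the same diameter.*)
Section hausdorff.
Local Open Scope ereal_scope.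
Variables (R : realType) (n s : nat).
Implicit Types (A B X : set 'rV[R]_n) (e : R).

Definition ediam A : \bar R :=
  ereal_sup [set z | z = 0 \/
    exists x y, [/\ A x, A y & z = (enorm (x - y))%:E]].

Definition unit_ball_volume : \bar R := leb R s [set x | (enorm x <= 1)%R].

Definition hausdorff_gauge e A : \bar R :=
  if A == set0 then 0
  else if ediam A <= e%:E then unit_ball_volume * (2^-1%:E * ediam A) ^+ s
  else +oo.

Definition hausdorff_pre e : set 'rV[R]_n -> \bar R :=
  mu_ext (hausdorff_gauge e).

Definition hausdorff A : \bar R :=
  ereal_sup [set hausdorff_pre e A | e in [set e | (0 < e)%R]].

Lemma ediam_ge0 A : 0 <= ediam A.
Proof. by apply: ereal_sup_ubound; left. Qed.

Lemma enorm_le_ediam A x y : A x -> A y -> (enorm (x - y))%:E <= ediam A.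
Proof. by move=> Ax Ay; apply: ereal_sup_ubound; right; exists x, y. Qed.

Lemma hausdorff_gauge0 e : hausdorff_gauge e set0 = 0.
Proof. by rewrite /hausdorff_gauge eqxx. Qed.

Lemma hausdorff_gauge_ge0 e A : 0 <= hausdorff_gauge e A.
Proof.
rewrite /hausdorff_gauge; case: ifP => // _; case: ifP => // _.
rewrite mule_ge0 ?measure_ge0//.
by rewrite expe_ge0// mule_ge0 ?ediam_ge0// lee_fin invr_ge0.
Qed.

Lemma le_hausdorff_gauge e e' A : (e <= e')%R ->
  hausdorff_gauge e' A <= hausdorff_gauge e A.
Proof.
move=> ee'; rewrite /hausdorff_gauge; case: ifP => // _.
have [de|_] := boolP (ediam A <= e%:E); last by rewrite leey.
by rewrite (le_trans de) ?lee_fin.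
Qed.

Lemma hausdorff_pre_ge0 e A : 0 <= hausdorff_pre e A.
Proof. exact/mu_ext_ge0/hausdorff_gauge_ge0. Qed.

Lemma le_hausdorff_pre e e' A : (e <= e')%R ->
  hausdorff_pre e' A <= hausdorff_pre e A.
Proof.
move=> ee'; apply: le_ereal_inf_tmp => _ [F cF <-].
apply: (@le_trans _ _ (\sum_(k <oo) hausdorff_gauge e' (F k))).
  by apply: ereal_inf_lbound; exists F.
by apply: lee_nneseries => // k _ *; [exact: hausdorff_gauge_ge0|exact: le_hausdorff_gauge].
Qed.

Lemma hausdorff_pre_le e A : (0 < e)%R -> hausdorff_pre e A <= hausdorff A.
Proof. by move=> e0; apply: ereal_sup_ubound; exists e. Qed.

Let hausdorff0 : hausdorff set0 = 0.
Proof.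
apply/eqP; rewrite eq_le; apply/andP; split.
  apply: ge_ereal_sup => _ [e e0 <-].
  by rewrite /hausdorff_pre mu_ext0//; [exact: hausdorff_gauge0|
    exact: hausdorff_gauge_ge0].
exact: le_trans (hausdorff_pre_ge0 1 _) (hausdorff_pre_le _ ltr01).
Qed.

Let hausdorff_ge0 A : 0 <= hausdorff A.
Proof. exact: le_trans (hausdorff_pre_ge0 1 _) (hausdorff_pre_le _ ltr01). Qed.

Let le_hausdorff : {homo hausdorff : A B / A `<=` B >-> A <= B}.
Proof.
move=> A B AB; apply: ge_ereal_sup => _ [e e0 <-].
apply: le_trans (hausdorff_pre_le B e0).
exact: le_mu_ext.
Qed.

Let hausdorff_sigma_subadditive : sigma_subadditive hausdorff.
Proof.
move=> F; apply: ge_ereal_sup => _ [e e0 <-].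
apply: le_trans (mu_ext_sigma_subadditive (hausdorff_gauge_ge0 e) F) _.
by apply: lee_nneseries => [k _ _|k _]; [exact: hausdorff_pre_ge0|
  exact: hausdorff_pre_le].
Qed.

HB.instance Definition _ := isOuterMeasure.Build R _ hausdorff
  hausdorff0 hausdorff_ge0 le_hausdorff hausdorff_sigma_subadditive.

Let hausdorff_pre_sep i e d A B : (e < d)%R ->
  (forall x y, A x -> B y -> d <= `|x ord0 i - y ord0 i|)%R ->
  hausdorff_pre e A + hausdorff_pre e B <= hausdorff_pre e (A `|` B).
Proof.
move=> ed AB; apply: le_ereal_inf_tmp => _ [F [mF cF] <-].
have [Foo|Foo] := pselect (exists k, hausdorff_gauge e (F k) = +oo).
  case: Foo => k Fk; rewrite (eseries_pinfty _ _ Fk) ?leey// => l _.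
  by rewrite -ltNye (lt_le_trans _ (hausdorff_gauge_ge0 _ _)).
pose G C k := if F k `&` C == set0 then set0 else F k.
have cG C : C `<=` A `|` B -> measurable_cover C (G C).
  move=> CAB; split=> [k|x Cx]; first by rewrite /G; case: ifP.
  have [k _ Fkx] := cF _ (CAB _ Cx); exists k => //; rewrite /G.
  by case: ifPn => // /eqP FC0; have : set0 x by rewrite -FC0.
have pG C : C `<=` A `|` B ->
    hausdorff_pre e C <= \sum_(k <oo) hausdorff_gauge e (G C k).
  by move=> CAB; apply: ereal_inf_lbound; exists (G C) => //; exact: cG.
apply: le_trans (leeD (pG A (@subsetUl _ _ _)) (pG B (@subsetUr _ _ _))) _.
rewrite -nneseriesD; [|by move=> *; exact: hausdorff_gauge_ge0..].
apply: lee_nneseries => [k _ _|k _].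
  by rewrite adde_ge0//; exact: hausdorff_gauge_ge0.
rewrite /G; case: ifPn => [_|/set0P[x [Fx Ax]]].
  rewrite hausdorff_gauge0 add0e; case: ifPn => // _.
  by rewrite hausdorff_gauge0 hausdorff_gauge_ge0.
case: ifPn => [_|/set0P[y [Fy By]]]; first by rewrite hausdorff_gauge0 adde0.
suff dF : e%:E < ediam (F k).
  exfalso; apply: Foo; exists k; rewrite /hausdorff_gauge leNgt dF/=.
  by case: ifPn => // /eqP F0; move: Fx; rewrite F0.
apply: lt_le_trans (enorm_le_ediam Fx Fy); rewrite lte_fin (lt_le_trans ed)//.
rewrite (le_trans (AB _ _ Ax By))//.
by have := coord_le_enorm (x - y) i; rewrite !mxE.
Qed.

Lemma hausdorff_sep i d A B : (0 < d)%R ->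
  (forall x y, A x -> B y -> d <= `|x ord0 i - y ord0 i|)%R ->
  hausdorff A + hausdorff B <= hausdorff (A `|` B).
Proof.
move=> d0 AB.
have HA : hausdorff A <= hausdorff (A `|` B) by apply: le_hausdorff; left.
have HB : hausdorff B <= hausdorff (A `|` B) by apply: le_hausdorff; right.
have [->|Uoo] := eqVneq (hausdorff (A `|` B)) +oo; first by rewrite leey.
have {}Uoo : hausdorff (A `|` B) < +oo by rewrite ltey.
have fA : hausdorff A \is a fin_num by rewrite ge0_fin_numE// (le_lt_trans HA).
have fB : hausdorff B \is a fin_num by rewrite ge0_fin_numE// (le_lt_trans HB).
rewrite -leeBrDr//; apply: ge_ereal_sup => _ [e1 e10 <-].
have f1 : hausdorff_pre e1 A \is a fin_num.
  by rewrite ge0_fin_numE ?hausdorff_pre_ge0// (le_lt_trans (hausdorff_pre_le _ e10))// (le_lt_trans HA).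
rewrite leeBrDr// -leeBrDl//; apply: ge_ereal_sup => _ [e2 e20 <-].
rewrite leeBrDl//.
pose e := Num.min (Num.min e1 e2) (d / 2)%R.
have e0 : (0 < e)%R by rewrite !lt_min e10 e20/= divr_gt0.
apply: le_trans (hausdorff_pre_le _ e0).
apply: (@le_trans _ _ (hausdorff_pre e A + hausdorff_pre e B)).
  by apply: leeD; apply: le_hausdorff_pre; rewrite !ge_min lexx ?orbT.
apply: hausdorff_pre_sep AB.
by rewrite gt_min ltr_pdivrMr// ltr_pMr// ltr1n orbT.
Qed.

Section hausdorff_halfspace.
Variables (i : 'I_n) (a : R) (X : set 'rV[R]_n).
Hypothesis Xoo : hausdorff X < +oo.

Let U := [set x : 'rV[R]_n | (a < x ord0 i)%R].
Let V k := X `&` [set x | (a + k.+1%:R^-1 <= x ord0 i)%R].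
Let W k := X `&`
  [set x | (a + k.+2%:R^-1 <= x ord0 i)%R /\ (x ord0 i < a + k.+1%:R^-1)%R].

Let invS k : (k.+2%:R^-1 < k.+1%:R^-1 :> R)%R.
Proof. by rewrite ltf_pV2 ?posrE// ltr_nat. Qed.

Let W_sum b N :
  \sum_(0 <= k < N) hausdorff (W (k.*2 + b).+1) <= hausdorff (V (N.*2 + b)).
Proof.
elim: N => [|N ih]; first by rewrite big_nil hausdorff_ge0.
rewrite big_nat_recr//= (le_trans (leeD2r _ ih))//; set k := (N.*2 + b)%N.
apply: (@le_trans _ _ (hausdorff (V k `|` W k.+1))).
  apply: (@hausdorff_sep i (k.+1%:R^-1 - k.+2%:R^-1)%R).
    by rewrite subr_gt0 invS.
  move=> x y [_ /= Vx] [_ /= [_ Wy]]; rewrite ler_normr; apply/orP; left.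
  move: Vx Wy; move: (k.+1%:R^-1)%R (k.+2%:R^-1)%R => p q.
  by lra.
apply: le_hausdorff => x [|] [Xx /= xk]; split=> //=.
  rewrite (le_trans _ xk)// lerD2l lef_pV2 ?posrE// ler_nat.
  by rewrite doubleS addSn addSn -/k !ltnS leqW.
by case: xk => + _; rewrite doubleS addSn addSn -/k.
Qed.

Let W_series : \sum_(k <oo) hausdorff (W k.+1) < +oo.
Proof.
apply: (@le_lt_trans _ _ (hausdorff X + hausdorff X)); last first.
  by rewrite lte_add_pinfty.
have VX k : hausdorff (V k) <= hausdorff X by apply: le_hausdorff => x [].
apply: lime_le; first exact: is_cvg_nneseries.
near=> N; apply: (@le_trans _ _ (\sum_(0 <= k < N.*2) hausdorff (W k.+1))).
  by apply: lee_sum_nneg_natr => //; rewrite -addnn leq_addr.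
rewrite (_ : \sum_(0 <= k < N.*2) _ =
    \sum_(0 <= k < N) hausdorff (W (k.*2 + 0).+1) +
    \sum_(0 <= k < N) hausdorff (W (k.*2 + 1).+1)).
  by apply: leeD; apply: le_trans (W_sum _ _) (VX _).
elim: (N) => [|M ih]; first by rewrite !big_nil adde0.
rewrite doubleS !big_nat_recr//= ih addn0 addn1 -!addeA; congr (_ + _).
by rewrite addeCA.
Unshelve. all: by end_near. Qed.

Let U_cover N : X `&` U `<=` V N `|` \bigcup_k W (k + N).
Proof.
move=> x [Xx /= ax].
have [xN|xN] := leP (a + N.+1%:R^-1)%R (x ord0 i); [by left|right].
have := ltr_add_invr ax; move=> [m am].
have am' := ltW am.
pose P k := (a + k.+1%:R^-1 <= x ord0 i)%R.
have exP : exists k, P k by exists m.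
have Pk := ex_minnP exP; case: Pk => k Pk mink.
have Nk : (N < k)%N.
  have := le_lt_trans Pk xN.
  by rewrite ltrD2l ltf_pV2 ?posrE// ltr_nat.
exists (k.-1 - N)%N => //; case: k Pk mink Nk => // k Pk mink Nk.
rewrite /= subnK//; split=> //=; split=> //.
by rewrite ltNge; apply/negP => /mink; rewrite ltnn.
Qed.

Lemma hausdorff_halfspace_le :
  hausdorff (X `&` U) + hausdorff (X `&` ~` U) <= hausdorff X.
Proof.
have tail0 := nneseries_tail_cvg W_series (fun k _ => hausdorff_ge0 (W k.+1)).
pose t N := \sum_(N <= k <oo) hausdorff (W k.+1).
apply: (@cvge_ge _ \oo _ _ (fun N => hausdorff X + t N) (hausdorff X)).
  apply: nearW => N.
  have := le_hausdorff (@U_cover N.+1).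
  move=> /le_trans/(_ (outer_measureU2 _ _ _)) UV.
  have : hausdorff (\bigcup_k W (k + N.+1)) <= t N.
    apply: le_trans (outer_measure_sigma_subadditive _ _) _ => /=.
    rewrite /t -nneseries_addn//; apply: lee_nneseries => // k _.
    by rewrite addnS.
  move=> /(leeD2l (hausdorff (V N.+1)))/(le_trans UV) {}UV.
  apply: (le_trans (leeD2r _ UV)); rewrite addeAC leeD2r//.
  apply: (@le_trans _ _ (hausdorff (V N.+1 `|` (X `&` ~` U)))).
    apply: (@hausdorff_sep i (N.+2%:R^-1)%R).
      by rewrite invr_gt0.
    move=> x y [_ /= Vx] [_ /= /negP]; rewrite -leNgt => ya.
    rewrite ler_normr; apply/orP; left.
    by move: Vx ya; move: (N.+2%:R^-1)%R => p; lra.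
  by apply: le_hausdorff => x [] [].
rewrite -[X in _ --> X]adde0; apply: cvgeD => //.
  by rewrite ge0_adde_def ?inE.
exact: cvg_cst.
Qed.

End hausdorff_halfspace.

Lemma caratheodory_halfspace i a :
  hausdorff.-caratheodory [set x : 'rV[R]_n | (a < x ord0 i)%R].
Proof.
apply: le_caratheodory_measurable => X.
have [Xoo|Xoo] := eqVneq (hausdorff X) +oo; first by rewrite [leRHS]Xoo leey.
by apply: hausdorff_halfspace_le; rewrite ltey.
Qed.

Lemma measurable_caratheodory_hausdorff A :
  measurable A -> hausdorff.-caratheodory A.
Proof.
pose cT : measurableType _ := caratheodory_type hausdorff.
suff mcoord i : measurable_fun [set: cT] (@rV_coord R n i : cT -> R).
  move: A; apply: smallest_sub.
    exact: (@sigma_algebra_measurable _ cT).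
  rewrite -bigcup_seq; apply: bigcup_sub => i _ _ [B mB <-].
  by apply: (mcoord i) => //; exact: (@measurableT _ cT).
apply: (measurability _ (measurable_realfun.RGenOInfty.measurableE R)) => _ [_ [a ->] <-].
rewrite setTI (_ : _ @^-1` _ = [set x : 'rV[R]_n | (a < x ord0 i)%R]).
  exact: caratheodory_halfspace.
by apply/seteqP; split => x /=; rewrite in_itv/= andbT.
Qed.

Let hausdorff_sigma_additive : semi_sigma_additive hausdorff.
Proof.
move=> F mF tF mUF.
apply: (@caratheodory_measure_sigma_additive R 'rV[R]_n hausdorff) => // [k|].
  exact: measurable_caratheodory_hausdorff.
exact: measurable_caratheodory_hausdorff.
Qed.

HB.instance Definition _ := isMeasure.Build _ _ _ hausdorff
  hausdorff0 hausdorff_ge0 hausdorff_sigma_additive.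

End hausdorff.

Section smooth.
Variables (R : realType) (V : normedModType R).

Fixpoint of_class_C (k : nat) (F : V -> R) : Prop :=
  match k with
  | 0%N => continuous F
  | k'.+1 => (forall z, differentiable F z) /\
             (forall w, of_class_C k' ('D_w F))
  end.

Definition Cc_infty (F : V -> R) : Prop :=
  (forall k, of_class_C k F) /\ compact (closure [set z | F z != 0]).

End smooth.

Definition grad (R : realType) n (F : 'rV[R]_n -> R) (x : 'rV[R]_n) : 'rV[R]_n :=
  \row_(i < n) 'D_(delta_mx ord0 i) F x.

Section domain.
Variables (R : realType) (d : nat).
Implicit Types (Omega : set 'rV[R]_d) (x nu : 'rV[R]_d).

Definition C11 m (psi : 'rV[R]_m -> R) : Prop :=
  (forall y, differentiable psi y) /\
  exists L : R, forall y z,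
    enorm (grad psi y - grad psi z) <= L * enorm (y - z).

(* The columns of P together with e form an orthonormal basis of R^d: in the  *)
(* rotated coordinates (y', y_d) = (x *m P, dotp x e), the set Omega is, near *)
(* x0, the part of space strictly below the graph of psi.                     *)
Definition C11_chart Omega (x0 : 'rV[R]_d) (r : R) (P : 'M[R]_(d, d.-1))
    (e : 'rV[R]_d) (psi : 'rV[R]_(d.-1) -> R) : Prop :=
  [/\ 0 < r, P^T *m P = 1%:M /\ (e *m P = 0 /\ dotp e e = 1), C11 psi &
    forall x, enorm (x - x0) < r -> (Omega x <-> dotp x e < psi (x *m P))].

Definition boundary Omega : set 'rV[R]_d := closure Omega `\` interior Omega.

Definition bounded_C11_domain Omega : Prop :=
  [/\ Omega !=set0, open Omega, connected Omega, bounded_set Omega &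
    forall x0, boundary Omega x0 ->
      exists r P e psi, C11_chart Omega x0 r P e psi].

(* normalized gradient of x |-> dotp x e - psi (x *m P), which is negative in *)
(* Omega and vanishes on its boundary                                         *)
Definition is_outward_normal Omega x nu : Prop :=
  exists r P e psi, C11_chart Omega x r P e psi /\
    nu = (Num.sqrt (1 + dotp (grad psi (x *m P)) (grad psi (x *m P))))^-1 *:
         (e - grad psi (x *m P) *m P^T).

Definition outward_normal Omega x : 'rV[R]_d :=
  xget 0 [set nu | is_outward_normal Omega x nu].

End domain.

Section gaussian_sobolev.
Variables (R : realType) (d : nat).

Definition gauss_density (v : 'rV[R]_d) : R :=
  (2 * pi) `^ (- (d%:R / 2)) * expR (- (dotp v v / 2)).

Definition gauss_int (g : 'rV[R]_d -> R) : \bar R :=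
  (\int[leb R d]_v (g v * gauss_density v)%:E)%E.

Definition weak_grad (u : 'rV[R]_d -> R) (G : 'rV[R]_d -> 'rV[R]_d) : Prop :=
  forall (phi : 'rV[R]_d -> R) (i : 'I_d), Cc_infty phi ->
    \int[leb R d]_v (u v * grad phi v ord0 i) =
    - \int[leb R d]_v (G v ord0 i * phi v).

(* the square of the norm of H^1_gamma, for u with gradient G *)
Definition H1_sqnorm (u : 'rV[R]_d -> R) (G : 'rV[R]_d -> 'rV[R]_d) : \bar R :=
  gauss_int (fun v => u v ^+ 2 + dotp (G v) (G v)).

Definition in_H1 (u : 'rV[R]_d -> R) (G : 'rV[R]_d -> 'rV[R]_d) : Prop :=
  [/\ measurable_fun setT u, measurable_fun setT G, weak_grad u G &
      (H1_sqnorm u G < +oo)%E].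

(* dual norm of the functional phi |-> \int q phi dgamma on H^1_gamma *)
Definition Hm1_norm (q : 'rV[R]_d -> R) : \bar R :=
  ereal_sup [set z | exists phi G, [/\ in_H1 phi G, (H1_sqnorm phi G <= 1)%E &
    z = gauss_int (fun v => q v * phi v)]].

End gaussian_sobolev.

Section functionals.
Variables (R : realType) (d : nat).
Implicit Types (Omega : set 'rV[R]_d) (f : 'rV[R]_d -> 'rV[R]_d -> R).

Definition Cc_infty_closure Omega f : Prop :=
  exists F : 'rV[R]_d * 'rV[R]_d -> R, Cc_infty F /\
    forall x v, closure Omega x -> f x v = F (x, v).

Definition transport f (x v : 'rV[R]_d) : R := dotp v (grad (f ^~ v) x).

Definition energy Omega f : \bar R :=
  (\int[leb R d]_(x in Omega) H1_sqnorm (f x) (grad (f x)) +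
   \int[leb R d]_(x in Omega) (Hm1_norm (transport f x) ^+ 2))%E.

Definition omega_weight (p s : R) : R := Num.min s (s `^ p).

Definition trace_functional (p : R) Omega f : \bar R :=
  (\int[hausdorff d.-1]_(x in boundary Omega)
    gauss_int (fun v =>
      (f x v ^+ 2 * omega_weight p `|dotp v (outward_normal Omega x)|)%R))%E.

End functionals.

(* Main.v *)
(* Enclose Omega in a smallest ball centred at a given point, let it touch the
   boundary at x0 with outward normal nu, and let t be a unit vector orthogonal
   to nu. With s = h^(1/6), the function f_h depends only on v, which is within
   s/2 of s^-1 t + s nu, and on the angular momentum <x - x0, nu> <v, t> -
   <x - x0, t> <v, nu>, which is at most s^3; hence v . grad_x f_h = 0 on Omega,
   and no dual norm has to be estimated. As Omega lies in the ball, <x - x0, nu>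
   is at most - c |x - x0|^2, so that on the support of f_h the point x is in a
   slab of tangential size s^2 and thickness s^4 at x0. The amplitude^2 is
   s^(-3d) times the inverse Gaussian weight: since |grad_v f_h| is of order
   |f_h| / s, the energy is of order s^(-3d) s^(-2) s^d (s^2)^(d-1) s^4 = 1.
   The trace of f_h lives on a cap of area (s^2)^(d-1), where v . n is of order
   s because the normal is Lipschitz; hence T_p is of order
   s^(-3d) s^d (s^2)^(d-1) s^p = s^(p-2). *)
From HB Require Import structures.
Require Import Defs.
From mathcomp Require Import all_boot all_order all_algebra.
From mathcomp Require Import zify ring lra.
From mathcomp Require Import all_classical all_reals all_analysis.
Set Implicit Arguments.
Unset Strict Implicit.
Unset Printing Implicit Defensive.
Import Order.TTheory GRing.Theory Num.Theory.
Import numFieldNormedType.Exports.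
Local Open Scope classical_set_scope.
Local Open Scope ring_scope.

(** A function annihilated by v . grad_x is constant along lines, so a cutoff in x alone cannot
    localize it near x0; geometry has to. A line of direction [drift s] has slope s^2 against the
    tangent hyperplane at x0, and a chord of that slope in the enclosing ball near x0 has length of
    order s^2 and depth of order s^4: hence the two exponents. The momentum bound sees only the
    plane of nu and t; the other tangential directions are confined by the ball. The velocity radius
    s makes |v| times the radius bounded, so the Gaussian weight, exponentially small at speed 1/s,
    varies only by a bounded factor.

    The lower bound for the trace is the tight one: the turning of the normal changes <v, n> by
    (1/s) s^2, the same order as <v, nu> itself, so a cap with a small enough constant is used
    there.

    The ball is centred far out on the first coordinate axis so that nu has a positive first
    coordinate. The slab and the cap then lie over the remaining coordinates, the ones that [leb]
    splits off, and no measure has to be rotated. *)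

(** * Euclidean geometry of row vectors *)

Section euclidean.
Context {R : realType} {n : nat}.
Implicit Types (u v w : 'rV[R]_n) (a : R).

Lemma dotpC u v : dotp u v = dotp v u.
Proof. by apply: eq_bigr => i _; rewrite mulrC. Qed.

Lemma dotpDl u v w : dotp (u + v) w = dotp u w + dotp v w.
Proof. by rewrite /dotp -big_split; apply: eq_bigr => i _; rewrite mxE mulrDl. Qed.

Lemma dotpZl a u v : dotp (a *: u) v = a * dotp u v.
Proof. by rewrite /dotp mulr_sumr; apply: eq_bigr => i _; rewrite mxE mulrA. Qed.

Lemma dotpDr u v w : dotp w (u + v) = dotp w u + dotp w v.
Proof. by rewrite !(dotpC w) dotpDl. Qed.

Lemma dotpZr a u v : dotp u (a *: v) = a * dotp u v.
Proof. by rewrite !(dotpC u) dotpZl. Qed.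

Lemma dotpNl u v : dotp (- u) v = - dotp u v.
Proof. by rewrite -scaleN1r dotpZl mulN1r. Qed.

Lemma dotpNr u v : dotp u (- v) = - dotp u v.
Proof. by rewrite !(dotpC u) dotpNl. Qed.

Definition dotpE := (dotpDl, dotpDr, dotpNl, dotpNr, dotpZl, dotpZr).

Lemma dotpvv_ge0 u : 0 <= dotp u u.
Proof. by apply: sumr_ge0 => i _; rewrite -expr2 sqr_ge0. Qed.

Lemma enorm_ge0 u : 0 <= enorm u.
Proof. exact: sqrtr_ge0. Qed.

Lemma sqr_enorm u : enorm u ^+ 2 = dotp u u.
Proof. by rewrite /enorm sqr_sqrtr ?dotpvv_ge0. Qed.

Lemma enorm_eq0 u : enorm u = 0 -> u = 0.
Proof.
move=> u0; apply/rowP => i; apply/eqP; rewrite mxE -normr_le0 -u0.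
exact: coord_le_enorm.
Qed.

Lemma enorm0 : enorm (0 : 'rV[R]_n) = 0.
Proof. by rewrite /enorm -(scale0r 0) dotpZl mul0r sqrtr0. Qed.

Lemma dotpvv_gt0 u : u != 0 -> 0 < dotp u u.
Proof.
move=> u0; rewrite lt_def dotpvv_ge0 andbT -sqr_enorm expf_neq0//.
by apply: contra_neq u0; exact: enorm_eq0.
Qed.

Lemma enorm_gt0 u : u != 0 -> 0 < enorm u.
Proof. by move=> /dotpvv_gt0; rewrite /enorm sqrtr_gt0. Qed.

Lemma enormZ a u : enorm (a *: u) = `|a| * enorm u.
Proof.
by rewrite /enorm dotpZl dotpZr mulrA -expr2 sqrtrM ?sqr_ge0// sqrtr_sqr.
Qed.

Lemma enormN u : enorm (- u) = enorm u.
Proof. by rewrite -scaleN1r enormZ normrN1 mul1r. Qed.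

Lemma enormB u v : enorm (u - v) = enorm (v - u).
Proof. by rewrite -enormN opprB. Qed.

(** Cauchy-Schwarz, from the nonnegative square of |v| u - |u| v. *)
Lemma dotp_le u v : dotp u v <= enorm u * enorm v.
Proof.
have [->|u0] := eqVneq u 0.
  by rewrite enorm0 mul0r -(scale0r 0) dotpZl mul0r.
have [->|v0] := eqVneq v 0.
  by rewrite enorm0 mulr0 -(scale0r 0) dotpZr mul0r.
have := dotpvv_ge0 (enorm v *: u - enorm u *: v).
have := enorm_gt0 u0; have := enorm_gt0 v0.
rewrite !dotpE (dotpC v u) -!sqr_enorm.
move: (enorm u) (enorm v) (dotp u v) => x y z y0 x0 H.
have : 0 <= (x * y) * (x * y - z) by nra.
by rewrite pmulr_rge0 ?mulr_gt0// subr_ge0.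
Qed.

Lemma dotp_norm_le u v : `|dotp u v| <= enorm u * enorm v.
Proof.
by rewrite ler_norml dotp_le andbT -(enormN u) lerNl -dotpNl dotp_le.
Qed.

Lemma enormD u v : enorm (u + v) <= enorm u + enorm v.
Proof.
rewrite -(ler_pXn2r (ltn0Sn 1)) ?nnegrE ?addr_ge0 ?enorm_ge0//.
rewrite sqrrD !sqr_enorm !dotpE (dotpC v u).
have := dotp_le u v; move: (dotp u v) (_ * _) => x y; rewrite -mulr_natl; lra.
Qed.

Lemma enorm_ler u v : enorm u - enorm v <= enorm (u - v).
Proof. by have := enormD (u - v) v; rewrite subrK lerBlDr. Qed.

Lemma norm_le_enorm u : `|u| <= enorm u.
Proof.
rewrite [`|u|]mx_normrE; apply: bigmax_le; first exact: enorm_ge0.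
by move=> [i j] _ /=; rewrite ord1; exact: coord_le_enorm.
Qed.

Lemma coord_le_norm u i : `|u ord0 i| <= `|u|.
Proof.
by rewrite [`|u|]mx_normrE; exact: (le_bigmax _ (fun ij => `|u ij.1 ij.2|) (ord0, i)).
Qed.

Lemma enorm_le_sum a u : (forall i, `|u ord0 i| <= a) -> enorm u <= n%:R * a.
Proof.
have [n0 _|n0] := eqVneq n 0%N.
  suff -> : u = 0 by rewrite enorm0 n0 mul0r.
  by apply/rowP => i; have := ltn_ord i; rewrite {2}n0.
move=> ua; have a0 : 0 <= a.
  have n1 : (0 < n)%N by rewrite lt0n.
  exact: le_trans (ua (Ordinal n1)).
rewrite -(ler_pXn2r (ltn0Sn 1)) ?nnegrE ?enorm_ge0 ?mulr_ge0//.
rewrite sqr_enorm exprMn; apply: (@le_trans _ _ (n%:R * a ^+ 2)).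
  rewrite mulr_natl -[X in _ *+ X]card_ord -sumr_const.
  by apply: ler_sum => i _; rewrite -expr2 -real_normK ?num_real ?ler_pXn2r ?nnegrE.
by rewrite ler_wpM2r ?sqr_ge0// -natrX ler_nat expnS leq_pmulr// expn1 lt0n.
Qed.

Lemma enorm_le_norm u : enorm u <= n%:R * `|u|.
Proof. by apply: enorm_le_sum => i; exact: coord_le_norm. Qed.

(** Testing w = - u gives <u, v> >= 0; testing the part of v orthogonal to u, pushed slightly
    towards - u, gives 1 - <u, v>^2 <= 0. This is what makes the outward normal independent of the
    chart. *)
Lemma unit_normal_unique u v : dotp u u = 1 -> dotp v v = 1 ->
  (forall w, dotp u w < 0 -> dotp v w <= 0) -> u = v.
Proof.
move=> u1 v1 uv; have /eqP : dotp u v = 1.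
  have v0 : 0 <= dotp u v.
    have := uv (- u); rewrite !dotpE u1 (dotpC v) oppr_le0; apply; lra.
  have : 1 - dotp u v ^+ 2 <= 0.
    apply/ler_addgt0Pr => e e0.
    have := uv (v - dotp u v *: u - e / (1 + dotp u v) *: u).
    rewrite !dotpE u1 v1 (dotpC v u); move: (dotp u v) v0 => x x0.
    have x1 : 0 < 1 + x by lra.
    have ex : 0 < e / (1 + x) by rewrite divr_gt0.
    have exx : e / (1 + x) * x <= e.
      by rewrite mulrAC ler_pdivrMr// ler_pM2l//; lra.
    rewrite mulr1; move: (e / _) ex exx => y y0 yx H.
    have := H _; lra.
  have := dotp_le u v; rewrite /enorm u1 v1 sqrtr1 mulr1.
  move: (dotp u v) v0 => x; nra.
rewrite -subr_eq0 => /eqP uv1.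
apply/eqP; rewrite -subr_eq0; apply/eqP/enorm_eq0/eqP.
rewrite -sqrf_eq0 sqr_enorm !dotpE u1 v1 (dotpC v u); apply/eqP; lra.
Qed.

End euclidean.

Lemma mulmx_enorm_le {R : realType} {n m : nat} (A : 'M[R]_(n, m)) :
  exists2 C : R, 0 <= C & forall u : 'rV_n, enorm (u *m A) <= C * enorm u.
Proof.
exists (m%:R * \sum_i \sum_j `|A i j|) => [|u].
  by rewrite mulr_ge0// sumr_ge0// => i _; rewrite sumr_ge0.
rewrite -mulrA; apply: enorm_le_sum => j; rewrite mxE mulr_suml.
apply: le_trans (ler_norm_sum _ _ _) _; apply: ler_sum => i _.
rewrite normrM mulrC ler_pM ?coord_le_enorm//.
by rewrite (bigD1 j)//= lerDl sumr_ge0.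
Qed.

(** * Smooth functions and cutoffs *)

Section directional_derivative.
Context {R : realType} {V : normedModType R}.
Implicit Types (F : V -> R) (x w : V).

(** Transfers directional derivatives to the line through x, where the one-variable chain rule
    applies. *)
Lemma is_derive_line F x w (dF : R) :
  is_derive x w F dF <-> is_derive (0 : R) 1 (fun h : R => F (h *: w + x)) dF.
Proof.
have E : 'D_1 (fun h : R => F (h *: w + x)) (0 : R) = 'D_w F x.
  rewrite /derive; set g1 := fun h => h^-1 *: _; set g2 := fun h => h^-1 *: _.
  suff -> : g1 = g2 by [].
  by rewrite funeqE /g1 /g2 => h /=; rewrite addr0 scale0r add0r [_%:A]mulr1.
split=> -[dF1 dF2]; split.
- exact: (derivable1P F x w).1.
- by rewrite E.
- exact: (derivable1P F x w).2.
- by rewrite -E.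
Qed.

Lemma is_derive_comp_line F x w (phi : R -> R) (dF dphi : R) :
  is_derive x w F dF -> is_derive (F x) 1 phi dphi ->
  is_derive x w (phi \o F) (dphi * dF).
Proof.
move=> /(is_derive_line F x w _).1 dFx dp; apply: (is_derive_line _ _ _ _).2.
apply: (@is_derive1_comp _ phi (fun h : R => F (h *: w + x))) => //.
by rewrite scale0r add0r.
Qed.

End directional_derivative.

Section gradient.
Context {R : realType} {n : nat}.
Implicit Types (F : 'rV[R]_n -> R) (x w : 'rV[R]_n).

Lemma derive_grad F x w : differentiable F x -> 'D_w F x = dotp (grad F x) w.
Proof.
move=> dF; rewrite deriveE// {1}(row_sum_delta w) linear_sum.
by apply: eq_bigr => i _; rewrite linearZ/= mxE deriveE// mulrC.
Qed.

Let is_derive_segment F x w (s : R) : (forall z, differentiable F z) ->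
  is_derive s (1 : R) (fun s : R => F (x + s *: w)) (dotp (grad F (x + s *: w)) w).
Proof.
move=> dF; apply: (is_derive_line _ s 1 _).2.
rewrite (_ : (fun _ => _) = fun h : R => F (h *: w + (x + s *: w))).
  apply: (is_derive_line F _ w _).1; split; first exact/diff_derivable.
  exact/derive_grad.
by apply/funext => h /=; rewrite [h *: 1]mulr1 scalerDl addrCA.
Qed.

Lemma continuous_segment F x w : (forall z, differentiable F z) ->
  continuous (fun s : R => F (x + s *: w)).
Proof.
move=> dF s; apply/differentiable_continuous/derivable1_diffP.
by have [] := is_derive_segment x w s dF.
Qed.

Lemma mean_value_grad F x w : (forall z, differentiable F z) ->
  exists2 s : R, 0 < s < 1 & F (x + w) - F x = dotp (grad F (x + s *: w)) w.
Proof.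
move=> dF; have [|s] := MVT (@ltr01 R) (fun s _ => is_derive_segment x w s dF).
  exact/continuous_subspaceT/continuous_segment.
by rewrite in_itv/= => s01; rewrite scale1r scale0r addr0 subr0 mulr1; exists s.
Qed.

End gradient.

Section class_C.
Context {R : realType} {V : normedModType R}.
Implicit Types F G : V -> R.

Lemma of_class_C_le k F : of_class_C k.+1 F -> of_class_C k F.
Proof.
elim: k F => [F [dF _] x|k ih F [dF DF]]; first exact: differentiable_continuous.
by split=> // w; exact/ih/DF.
Qed.

Lemma of_class_C_cst k (c : R) : of_class_C k (cst c : V -> R).
Proof.
elim: k c => [c|k ih c]; first exact: cst_continuous.
split=> [z|w]; first exact: differentiable_cst.
rewrite (_ : 'D_w (cst c) = cst 0); first exact: ih.
by apply/funext => z; rewrite derive_cst.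
Qed.

Lemma of_class_CD k F G :
  of_class_C k F -> of_class_C k G -> of_class_C k (F + G).
Proof.
elim: k F G => [F G cF cG x|k ih F G [dF DF] [dG DG]].
  by apply: continuousD; [exact: cF|exact: cG].
split=> [z|w]; first exact: differentiableD.
rewrite (_ : 'D_w (F + G) = 'D_w F + 'D_w G).
  by apply: ih; [exact: DF|exact: DG].
by apply/funext => z; rewrite deriveD//; [exact/diff_derivable/dF|exact/diff_derivable/dG].
Qed.

Lemma of_class_CM k F G :
  of_class_C k F -> of_class_C k G -> of_class_C k (F * G).
Proof.
elim: k F G => [F G cF cG x|k ih F G CF CG].
  by apply: continuousM; [exact: cF|exact: cG].
have [[dF DF] [dG DG]] := (CF, CG).
split=> [z|w]; first exact: differentiableM.
rewrite (_ : 'D_w (F * G) = F * 'D_w G + G * 'D_w F).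
  by apply: of_class_CD; (apply: ih; first exact: of_class_C_le); [exact: DG|exact: DF].
apply/funext => z; rewrite deriveM//; [exact/diff_derivable/dF|exact/diff_derivable/dG].
Qed.

Lemma of_class_C_linear k (F : {linear V -> R}) :
  continuous F -> of_class_C k (F : V -> R).
Proof.
case: k => // k cF; split=> [z|w]; first exact: linear_differentiable.
rewrite (_ : 'D_w F = cst (F w)); first exact: of_class_C_cst.
apply/funext => z; rewrite deriveE; last exact: linear_differentiable.
by rewrite diff_lin.
Qed.

(** All derivatives of the outer function are supplied at once as the sequence [phi]: the chain rule
    passes from [phi j] to [phi j.+1], so the induction on k has to hold for every j. *)
Lemma of_class_C_comp k (phi : nat -> R -> R) j F :
  (forall i (x : R), is_derive x 1 (phi i) (phi i.+1 x)) ->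
  of_class_C k F -> of_class_C k (phi j \o F).
Proof.
move=> dphi.
have dif i x : differentiable (phi i) x.
  by apply/derivable1_diffP; have [] := dphi i x.
elim: k j F => [j F cF x|k ih j F CF].
  by apply: continuous_comp; [exact: cF|exact: differentiable_continuous].
have [dF DF] := CF.
split=> [z|w]; first exact: differentiable_comp.
rewrite (_ : 'D_w (phi j \o F) = (phi j.+1 \o F) * 'D_w F).
  by apply: of_class_CM; [apply: ih; exact: of_class_C_le|exact: DF].
apply/funext => z; apply: derive_val; apply: is_derive_comp_line.
exact/derivableP/diff_derivable/dF.
Qed.

End class_C.

Section smooth_cutoff.
Context {R : realType}.
Implicit Types (u y : R) (P : {poly R}).

(** The functions P(1/u) exp(-1/u), extended by 0 to u <= 0, form a class stable under
    differentiation: the derivative replaces P by X^2 (P - P'). Smoothness becomes an iteration on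
    polynomials. *)
Let flat P u : R := if 0 < u then P.[u^-1] * expR (- u^-1) else 0.

Let horner_le P : exists2 M : R, 0 <= M &
  forall y, 1 <= y -> `|P.[y]| <= M * y ^+ size P.
Proof.
exists (\sum_(i < size P) `|P`_i|) => [|y y1]; first exact: sumr_ge0.
rewrite horner_coef mulr_suml; apply: le_trans (ler_norm_sum _ _ _) _.
apply: ler_sum => i _; rewrite normrM ler_wpM2l// ger0_norm ?exprn_ge0 ?(le_trans ler01)//.
by rewrite ler_weXn2l// ltnW.
Qed.

(** For 0 < u <= 1, |P(1/u)| is at most M u^(- size P), and the exponential series gives exp(-1/u)
    <= m! u^m with m = size P + 2. A quadratic bound forces the derivative 0 at the origin. *)
Let flat_le P : exists2 C : R, 0 <= C & forall u, u <= 1 -> `|flat P u| <= C * u ^+ 2.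
Proof.
have [M M0 PM] := horner_le P; pose m := (size P).+2.
exists (M * m`!%:R) => [|u u1]; first by rewrite mulr_ge0.
rewrite /flat; case: ifPn => [u0|_]; last first.
  by rewrite normr0; apply: mulr_ge0; [exact: mulr_ge0|exact: sqr_ge0].
have iu1 : 1 <= u^-1 by rewrite invf_ge1.
have eb : expR (- u^-1) <= m`!%:R * u ^+ m.
  have := expR_ge1Dxn (size P).+1 (le_trans ler01 iu1).
  rewrite -/m expRN => H.
  have : u^-1 ^+ m / m`!%:R <= expR u^-1 by apply: le_trans H; rewrite lerDr.
  rewrite ler_pdivrMr ?ltr0n ?fact_gt0// exprVn invf_ple ?posrE ?exprn_gt0//.
    by rewrite invfM ler_pdivrMr ?ltr0n ?fact_gt0// mulrC.
  by rewrite mulr_gt0 ?expR_gt0// ltr0n fact_gt0.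
rewrite normrM (ger0_norm (expR_ge0 _)).
apply: (@le_trans _ _ ((M * u^-1 ^+ size P) * (m`!%:R * u ^+ m))).
  by rewrite ler_pM ?PM ?expR_ge0.
rewrite mulrACA ler_wpM2l// ?mulr_ge0// /m -addn2 exprD mulrA -exprMn.
by rewrite mulVf ?gt_eqF// expr1n mul1r.
Qed.

Let is_derive_quadratic (g : R -> R) (C : R) : (forall u, u <= 1 -> `|g u| <= C * u ^+ 2) ->
  is_derive (0 : R) 1 g 0.
Proof.
move=> gC; have g0 : g 0 = 0.
  by apply/eqP; rewrite -normr_le0 (le_trans (gC _ ler01))// expr0n mulr0.
have C0 : 0 <= C by have := gC 1 (lexx _); rewrite expr1n mulr1; exact: le_trans.
have L : (fun h => h^-1 *: ((g \o shift 0) (h *: 1) - g 0)) @ 0^' --> (0 : R).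
  apply/cvgrPdist_lt => e e0; near=> h.
  have h0 : h != 0 by near: h; exact: nbhs_dnbhs_neq.
  rewrite sub0r normrN /= g0 subr0 addr0 [h *: 1]mulr1 normrM normfV.
  rewrite ltr_pdivrMl ?normr_gt0//.
  apply: (@le_lt_trans _ _ (C * h ^+ 2)).
    by apply: gC; apply: le_trans (ler_norm _) _; near: h; exact: dnbhs0_le.
  rewrite -(real_normK (num_real h)) expr2 mulrA mulrC ltr_pM2l ?normr_gt0//.
  apply: (@le_lt_trans _ _ ((C + 1) * `|h|)).
    by rewrite ler_wpM2r// lerDl.
  rewrite -ltr_pdivlMl ?ltr_wpDl// mulrC; near: h; apply: dnbhs0_lt.
  by rewrite divr_gt0// ltr_wpDl.
by split; [apply/cvg_ex; exists 0|exact/cvg_lim].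
Unshelve. all: by end_near. Qed.

Let flatP P u : is_derive u 1 (flat P) (flat ('X^2 * (P - P^`())) u).
Proof.
have [u0|u0|<-] := ltgtP 0 u.
- have D : is_derive u 1 (fun y => P.[y^-1] * expR (- y^-1))
     (flat ('X^2 * (P - P^`())) u).
    have un0 : u != 0 by rewrite gt_eqF.
    have dv : is_derive u 1 (fun y : R => y^-1) (- u ^- 2).
      by have := @is_deriveV R id u 1 1 un0; rewrite scaler1; apply.
    rewrite /flat u0.
    have dP : is_derive u 1 (fun y => P.[y^-1]) (P^`().[u^-1] * - u ^- 2).
      exact: (@is_derive_comp_line R R (fun y => y^-1) u 1 (horner P)).
    have dE : is_derive u 1 (fun y => expR (- y^-1)) (expR (- u^-1) * - - u ^- 2).
      by apply: (@is_derive_comp_line R R (fun y => - y^-1) u 1 expR).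
    apply: is_derive_eq; rewrite !hornerE /= -exprVn /GRing.scale/=; ring.
  apply: near_eq_is_derive D; near=> y.
  by rewrite /flat ifT//; near: y; exact: lt_nbhsr.
- rewrite [X in is_derive _ _ _ X]/flat ltNge (ltW u0)/=.
  apply: (@near_eq_is_derive _ _ _ (cst 0)); near=> y.
  rewrite /flat ifN// -leNgt ltW//; near: y; exact: lt_nbhsl.
- have [C C0 PC] := flat_le P.
  by rewrite [X in is_derive _ _ _ X]/flat ltxx; exact: is_derive_quadratic PC.
Unshelve. all: by end_near. Qed.

Let flat_seq k := flat (iter k (fun P => 'X^2 * (P - P^`())) 1).

Let flat_seqP k u : is_derive u 1 (flat_seq k) (flat_seq k.+1 u).
Proof. exact: flatP. Qed.

Let theta := flat_seq 0.
Let dtheta := flat_seq 1.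

Let thetaE u : theta u = if 0 < u then expR (- u^-1) else 0.
Proof. by rewrite /theta /flat_seq /flat /= hornerC mul1r. Qed.

Let dthetaE u : dtheta u = if 0 < u then u^-1 ^+ 2 * expR (- u^-1) else 0.
Proof. by rewrite /dtheta /flat_seq /flat /= derivC subr0 mulr1 hornerXn. Qed.

Let theta_ge0 u : 0 <= theta u.
Proof. by rewrite thetaE; case: ifP => // _; exact: expR_ge0. Qed.

Let theta_gt0 u : 0 < u -> 0 < theta u.
Proof. by rewrite thetaE => ->; exact: expR_gt0. Qed.

Let theta_le0 u : u <= 0 -> theta u = 0.
Proof. by rewrite thetaE ltNge => ->. Qed.

Let theta_homo u y : u <= y -> theta u <= theta y.
Proof.
move=> uy; have [u0|u0] := leP u 0; first by rewrite (theta_le0 u0).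
have y0 := lt_le_trans u0 uy.
by rewrite !thetaE u0 y0 ler_expR lerN2 lef_pV2.
Qed.

(** With y = 1/u this is y^2 <= 2 exp y, from the quadratic term of the series. *)
Let dtheta_le u : `|dtheta u| <= 2.
Proof.
rewrite dthetaE; case: ifP => u0; last by rewrite normr0.
have iu0 : 0 < u^-1 by rewrite invr_gt0.
rewrite normrM [`|expR _|]ger0_norm ?expR_ge0// [`|_ ^+ 2|]ger0_norm ?sqr_ge0//.
rewrite expRN ler_pdivrMr ?expR_gt0//.
have := expR_ge1Dxn 1 (ltW iu0); rewrite (_ : 2`! = 2%N)//; lra.
Qed.

(* The composition replaces the usual quotient theta (1 - u) / (theta u +
   theta (1 - u)): no derivative of an inverse is needed. *)
Definition cutoff u := theta (theta 1 - theta u) / theta (theta 1).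
Definition dcutoff u := - dtheta (theta 1 - theta u) * dtheta u / theta (theta 1).

Let tt0 : 0 < theta (theta 1).
Proof. exact/theta_gt0/theta_gt0. Qed.

Lemma cutoff_le0 u : u <= 0 -> cutoff u = 1.
Proof. by move=> u0; rewrite /cutoff (theta_le0 u0) subr0 divff// gt_eqF. Qed.

Lemma cutoff_ge1 u : 1 <= u -> cutoff u = 0.
Proof.
by move=> u1; rewrite /cutoff [theta (_ - _)]theta_le0 ?mul0r// subr_le0 theta_homo.
Qed.

Lemma cutoff_ge0 u : 0 <= cutoff u.
Proof. by rewrite /cutoff divr_ge0. Qed.

Lemma cutoff_le1 u : cutoff u <= 1.
Proof. by rewrite ler_pdivrMr// mul1r theta_homo// lerBlDr lerDl. Qed.

Lemma dcutoff_ge1 u : 1 <= u -> dcutoff u = 0.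
Proof.
move=> u1; rewrite /dcutoff [dtheta (_ - _)]dthetaE ifN ?oppr0 ?mul0r//.
by rewrite -leNgt subr_le0 theta_homo.
Qed.

Lemma is_derive_cutoff u : is_derive u 1 cutoff (dcutoff u).
Proof.
have d1 : is_derive u 1 (fun y => theta 1 - theta y) (- dtheta u).
  have := @is_deriveB _ _ _ (cst (theta 1)) theta u 1 0 (dtheta u) _ (flat_seqP 0 u).
  by rewrite sub0r; exact.
have d2 := is_derive_comp_line d1 (flat_seqP 0 (theta 1 - theta u)).
have -> : cutoff = (theta (theta 1))^-1 \*: (theta \o (fun y => theta 1 - theta y)).
  by apply/funext => y; rewrite /cutoff mulrC.
apply: (is_derive_eq (is_deriveZ (theta (theta 1))^-1 d2)).
by rewrite /dcutoff [LHS]mulrC !mulNr mulrN mulNr.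
Qed.

Lemma dcutoff_le : exists C : R, forall u, `|dcutoff u| <= C.
Proof.
exists (2 * 2 / theta (theta 1)) => u.
rewrite /dcutoff normrM normfV (gtr0_norm tt0) ler_pM2r ?invr_gt0//.
by rewrite normrM normrN; exact: ler_pM.
Qed.

Lemma of_class_C_cutoff {V : normedModType R} k (F : V -> R) :
  of_class_C k F -> of_class_C k (cutoff \o F).
Proof.
move=> CF; have C1 := of_class_C_comp 0 flat_seqP CF.
have C2 := of_class_CD (of_class_C_cst k (theta 1))
  (of_class_CM (of_class_C_cst k (-1)) C1).
have := of_class_CM (of_class_C_comp 0 flat_seqP C2)
  (of_class_C_cst k (theta (theta 1))^-1).
congr of_class_C; apply/funext => x.
change (theta (theta 1 + (-1) * theta (F x)) * (theta (theta 1))^-1 =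
  theta (theta 1 - theta (F x)) / theta (theta 1)).
by rewrite mulN1r.
Qed.

End smooth_cutoff.

(** * Lebesgue and Hausdorff measures *)

Section integral_bounds.
Local Open Scope ereal_scope.
Context d (T : measurableType d) (R : realType).
Variable mu : {measure set T -> \bar R}.
Implicit Types (D E : set T) (f : T -> \bar R).

Import HBNNSimple.

Let sintegral_step (c : R) (c0 : (0 <= c)%R) E (mE : measurable E) :
  sintegral mu (scale_nnsfun (indic_nnsfun R mE) c0) = c%:E * mu E.
Proof.
rewrite -(sintegral_indic mu E); exact: (sintegralrM mu c (indic_nnsfun R mE)).
Qed.

Let stepE (c : R) (c0 : (0 <= c)%R) E (mE : measurable E) x :
  scale_nnsfun (indic_nnsfun R mE) c0 x = (c * (x \in E)%:R)%R.
Proof. by rewrite -[LHS]/(c * \1_E x)%R indicE. Qed.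

(** The step function c 1_E competes in the supremum over simple functions that defines the
    integral; in the next lemma it dominates every competitor. Both bounds thus apply directly to
    the inner integrals over v as functions of x, and to integrands containing [outward_normal]. *)
Lemma integral_ge_cst D E f (c : R) : (0 <= c)%R -> measurable E -> E `<=` D ->
  (forall x, D x -> 0 <= f x) -> (forall x, E x -> c%:E <= f x) ->
  c%:E * mu E <= \int[mu]_(x in D) f x.
Proof.
move=> c0 mE ED f0 cf; rewrite ge0_integralE//; apply: ereal_sup_ubound.
exists (scale_nnsfun (indic_nnsfun R mE) c0); last exact: sintegral_step.
move=> x; rewrite stepE patchE.
have [xE|xE] := boolP (x \in E).
  by rewrite mem_set ?mulr1 ?cf//; [exact/set_mem|exact/ED/set_mem].
by rewrite mulr0; case: ifPn => // /set_mem; exact: f0.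
Qed.

Lemma integral_le_cst D E f (c : R) : (0 <= c)%R -> measurable E ->
  (forall x, D x -> 0 <= f x) -> (forall x, D x -> E x -> f x <= c%:E) ->
  (forall x, D x -> ~ E x -> f x = 0) ->
  \int[mu]_(x in D) f x <= c%:E * mu E.
Proof.
move=> c0 mE f0 fc fE; rewrite ge0_integralE//; apply: ge_ereal_sup => _ [h hf <-].
rewrite -(sintegral_step c0 mE); apply: le_sintegral => x.
rewrite -lee_fin; apply: le_trans (hf x) _; rewrite stepE patchE.
have [xD|xD] := boolP (x \in D); last by rewrite lee_fin mulr_ge0.
have [xE|xE] := boolP (x \in E).
  by rewrite mulr1 fc//; exact/set_mem.
rewrite mulr0 fE//; first exact/set_mem.
by move=> Ex; move: xE; rewrite mem_set.
Qed.

End integral_bounds.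

Section rV_topology.
Context {R : realType}.

Lemma continuous_enorm n (c : 'rV[R]_n) : continuous (fun x : 'rV[R]_n => enorm (x - c)).
Proof.
move=> x; apply/(@cvgrPdist_lt _ _ _ (nbhs x)) => e e0.
near=> y; apply: (@le_lt_trans _ _ (n%:R * `|x - y|)).
  have H (a b : 'rV[R]_n) : enorm (a - c) - enorm (b - c) <= enorm (a - b).
    by apply: le_trans (enorm_ler _ _) _; rewrite opprB addrA subrK.
  rewrite ler_norml lerNl opprB.
  by apply/andP; split; apply: le_trans (H _ _) _; [rewrite enormB|]; exact: enorm_le_norm.
apply: (@le_lt_trans _ _ (n.+1%:R * `|x - y|)); first by rewrite ler_wpM2r// ler_nat.
rewrite -ltr_pdivlMl//; near: y; apply: cvgr_dist_lt; last by rewrite mulr_gt0// invr_gt0.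
exact: cvg_id.
Unshelve. all: by end_near. Qed.

Lemma closed_enorm_ball n (c : 'rV[R]_n) (a : R) : closed [set x : 'rV[R]_n | enorm (x - c) <= a].
Proof.
apply: (@closed_comp _ _ (fun x : 'rV[R]_n => enorm (x - c)) [set t | t <= a]).
  by move=> x _; exact: continuous_enorm.
exact: closed_le.
Qed.

Lemma continuous_dotpl n (u : 'rV[R]_n) : continuous (dotp u).
Proof.
move=> x; apply/(@cvgrPdist_lt _ _ _ (nbhs x)) => e e0.
near=> y; rewrite -dotpNr -dotpDr; apply: le_lt_trans (dotp_norm_le _ _) _.
apply: (@le_lt_trans _ _ (enorm u * n%:R * `|x - y|)).
  by rewrite -mulrA ler_wpM2l ?enorm_ge0// enorm_le_norm.
apply: (@le_lt_trans _ _ ((enorm u * n%:R + 1) * `|x - y|)).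
  by rewrite ler_wpM2r// lerDl.
rewrite -ltr_pdivlMl ?ltr_wpDl ?mulr_ge0 ?enorm_ge0//; near: y.
apply: cvgr_dist_lt; first exact: cvg_id.
by rewrite mulr_gt0// invr_gt0 ltr_wpDl ?mulr_ge0 ?enorm_ge0.
Unshelve. all: by end_near. Qed.

Lemma measurable_rV_forall n (P : 'I_n -> set R) :
  (forall i, measurable (P i)) -> measurable [set x : 'rV[R]_n | forall i, P i (x ord0 i)].
Proof.
move=> mP.
rewrite (_ : [set x | _] = ~` \bigcup_i (@rV_coord R n i @^-1` (~` P i))).
  apply/measurableC/countable_bigcupT_measurable => [|i]; first exact: countableP.
  rewrite -[X in measurable X]setTI; apply: measurable_rV_coord => //.
  exact: measurableC.
apply/seteqP; split=> x /= Px; first by case=> i _; apply; exact: Px.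
by move=> i; apply: contrapT => nP; apply: Px; exists i.
Qed.

Definition cube n (c : 'rV[R]_n) (a : R) : set 'rV[R]_n :=
  [set x | forall i, `|x ord0 i - c ord0 i| <= a].

Let cube_itv (t a : R) : [set s | `|s - t| <= a] = `[t - a, t + a]%classic.
Proof. by apply/seteqP; split => s /=; rewrite in_itv/= ler_distl. Qed.

Lemma measurable_cube n (c : 'rV[R]_n) a : measurable (cube c a).
Proof.
apply: (@measurable_rV_forall n (fun i => [set s | `|s - c ord0 i| <= a])) => i.
by rewrite cube_itv.
Qed.

(** The sigma-algebra is generated by the coordinates, so an open set is written as the union of the
    countably many cubes with rational centre and half-side 1/(k + 1) that it contains. *)
Lemma open_measurable_rV n (U : set 'rV[R]_n) : open U -> measurable U.
Proof.
move=> oU.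
pose q (k : 'rV[rat]_n * nat) := cube (map_mx ratr k.1) k.2.+1%:R^-1.
pose F k := if `[<q k `<=` U>] then q k else set0.
have -> : U = \bigcup_k F k.
  apply/seteqP; split => [x Ux|x [k _]]; last first.
    by rewrite /F; case: ifPn => // /asboolP qU /qU.
  have : nbhs x U by exact: open_nbhs_nbhs.
  move=> /nbhs_ballP[e/= e0 xeU].
  have [N Ne] : exists N, 2 * N.+1%:R^-1 < e.
    have := ltr_add_invr (_ : 0 < e / 2); rewrite divr_gt0// => /(_ isT)[N].
    by rewrite add0r ltr_pdivlMr// mulrC => ?; exists N.
  have r i : {r : rat | `|ratr r - x ord0 i| < N.+1%:R^-1}.
    apply: cid; have [|r] := @rat_in_itvoo R (x ord0 i - N.+1%:R^-1) (x ord0 i + N.+1%:R^-1).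
      by rewrite ltrD2l gt0_cp// invr_gt0.
    by rewrite in_itv/= => rx; exists r; rewrite ltr_distl.
  have qx : q (\row_i sval (r i), N) x.
    by move=> i; rewrite !mxE distrC ltW//; exact: (svalP (r i)).
  exists (\row_i sval (r i), N) => //; rewrite /F ifT//; apply/asboolP => y qy.
  apply: xeU; rewrite -ball_normE /ball_/=.
  apply: le_lt_trans Ne; rewrite [`|x - y|]mx_normrE.
  apply: bigmax_le => [|[i j] _ /=]; first by rewrite mulr_ge0.
  rewrite ord1 !mxE; have := qx j; have := qy j; rewrite !mxE/=.
  move: (ratr _) => z zy zx.
  rewrite (_ : _ - _ = (x ord0 j - z) - (y ord0 j - z)); last by ring.
  by rewrite (le_trans (ler_normB _ _))// mulr_natl mulr2n lerD.
apply: countable_bigcupT_measurable => [|k]; first exact: countableP.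
by rewrite /F; case: ifP => // _; exact: measurable_cube.
Qed.

Lemma closed_measurable_rV n (A : set 'rV[R]_n) : closed A -> measurable A.
Proof. by move=> cA; rewrite -[A]setCK; apply: measurableC; apply: open_measurable_rV; exact: closed_openC. Qed.

End rV_topology.

Section lebesgue_rV.
Context {R : realType}.
Local Open Scope ereal_scope.

Let cube_itv (t a : R) : [set s | (`|s - t| <= a)%R] = `[(t - a)%R, (t + a)%R]%classic.
Proof. by apply/seteqP; split => s /=; rewrite in_itv/= ler_distl. Qed.

Let lebesgue_interval (t a : R) : (0 <= a)%R ->
  lebesgue_measure [set s | (`|s - t| <= a)%R] = (2 * a)%:E.
Proof.
move=> a0; rewrite cube_itv lebesgue_measure_itv/= lte_fin.
case: ltP => ta; first by congr EFin; ring.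
by congr EFin; lra.
Qed.

Lemma rV_behead_cons n (z : R * 'rV[R]_n) : rV_behead (rV_cons z) = z.2.
Proof. by apply/rowP => i; rewrite !mxE liftK. Qed.

Lemma rV_cons0 n (z : R * 'rV[R]_n) : rV_cons z ord0 ord0 = z.1.
Proof. by rewrite mxE unlift_none. Qed.

Lemma rV_consS n (z : R * 'rV[R]_n) i : rV_cons z ord0 (lift ord0 i) = z.2 ord0 i.
Proof. by rewrite mxE liftK. Qed.

Lemma measurable_rV_behead n : measurable_fun setT (@rV_behead R n).
Proof.
apply: measurable_fun_rV => i; rewrite /comp /rV_coord /rV_behead/=.
by under eq_fun do rewrite mxE; exact: measurable_rV_coord.
Qed.

Lemma leb_cube n (c : 'rV[R]_n) (a : R) : (0 <= a)%R ->
  leb R n (cube c a) = ((2 * a) ^+ n)%:E.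
Proof.
move=> a0; elim: n c => [|n ih] c.
  by rewrite /= diracE mem_set// => -[].
rewrite /= /cons_measure /pushforward.
rewrite (_ : _ @^-1` _ =
    [set s | (`|s - c ord0 ord0| <= a)%R] `*` cube (rV_behead c) a).
  rewrite product_measure1E//; last exact: measurable_cube.
    by rewrite [X in X * _](lebesgue_interval (c ord0 ord0) a0) [X in _ * X]ih -EFinM exprS.
  by rewrite cube_itv.
apply/seteqP; split=> [z /= H|z /= [H1 H2] i].
  split; first by have := H ord0; rewrite rV_cons0.
  by move=> i; have := H (lift ord0 i); rewrite rV_consS [rV_behead _ _ _]mxE.
have [j ->|->] := unliftP ord0 i; last by rewrite rV_cons0.
by have := H2 j; rewrite rV_consS [rV_behead _ _ _]mxE.
Qed.

(** Slicing at a fixed y = [rV_behead x]: each slice lies in an interval of length 2 b around g y,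
    and y ranges over a cube. *)
Lemma leb_slab_le n (E : set 'rV[R]_n.+1) (c : 'rV[R]_n) (g : 'rV[R]_n -> R) (a b : R) :
  (0 <= a)%R -> (0 <= b)%R -> measurable E ->
  (forall x, E x -> cube c a (rV_behead x) /\
    (`|x ord0 ord0 - g (rV_behead x)| <= b)%R) ->
  leb R n.+1 E <= (2 * b * (2 * a) ^+ n)%:E.
Proof.
move=> a0 b0 mE Eg; rewrite /= /cons_measure /pushforward.
have mcE : measurable (@rV_cons R n @^-1` E).
  by rewrite -[X in measurable X]setTI; exact: measurable_rV_cons.
(* [cons_measure] integrates over the first coordinate last; uniqueness of the product measure
   exchanges the order, so that the slices at fixed y appear. *)
rewrite (@product_measure_unique _ _ _ _ R lebesgue_measure (leb R n)
  (product_measure2 lebesgue_measure (leb R n)))//; last first.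
  by move=> A B mA mB; exact: product_measure2E.
rewrite EFinM -(leb_cube c a0); apply: integral_le_cst.
- by rewrite mulr_ge0.
- exact: measurable_cube.
- by move=> y _; exact: measure_ge0.
- move=> y _ cy; rewrite -(lebesgue_interval (g y) b0).
  apply: le_measure; rewrite ?inE.
  + exact: measurable_ysection.
  + by rewrite cube_itv.
  + move=> t; rewrite ysectionE/= => /Eg[_].
    by rewrite rV_cons0 rV_behead_cons.
- move=> y _ ncy /=; rewrite (_ : ysection _ y = set0) ?measure0//.
  apply/seteqP; split=> // t; rewrite ysectionE/= => /Eg[].
  by rewrite rV_behead_cons.
Qed.

(** The ball lies between the cubes of half-sides 1/(n + 1) and 1, where n + 1 also serves n = 0.
    Only positivity and finiteness of the Hausdorff normalization enter the estimates. *)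
Lemma unit_ball_volumeE n : exists2 u : R, (0 < u)%R & unit_ball_volume R n = u%:E.
Proof.
have mB : measurable [set x : 'rV[R]_n | (enorm x <= 1)%R].
  have := @closed_enorm_ball R n 0 1; under eq_set do rewrite subr0.
  exact: closed_measurable_rV.
have low : ((2 * n.+1%:R^-1) ^+ n)%:E <= unit_ball_volume R n.
  rewrite -(@leb_cube n 0) ?invr_ge0//; apply: le_measure; rewrite ?inE//.
    exact: measurable_cube.
  move=> x /= Hx; apply: (@le_trans _ _ (n%:R * n.+1%:R^-1)%R).
    by apply: enorm_le_sum => i; have := Hx i; rewrite mxE subr0.
  by rewrite ler_pdivrMr// mul1r ler_nat.
have upp : unit_ball_volume R n <= ((2 * 1) ^+ n)%:E.
  rewrite -(@leb_cube n 0)//; apply: le_measure; rewrite ?inE//.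
    exact: measurable_cube.
  by move=> x /= Hx i; rewrite mxE subr0 (le_trans (coord_le_enorm _ _)).
move: low upp; case: unit_ball_volume => [u|//|//]; rewrite !lee_fin => low _.
by exists u => //; apply: lt_le_trans low; rewrite exprn_gt0// mulr_gt0// invr_gt0.
Qed.

End lebesgue_rV.

Section hausdorff_bounds.
Context {R : realType} (n : nat).
Local Open Scope ereal_scope.
Implicit Types E F : set 'rV[R]_n.+1.

(** A set of diameter D <= 1 projects into a cube of half-side D, and u (D/2)^n = (u / 4^n) (2 D)^n.
    The cube stands in for the projection, which may fail to be Borel. For a larger diameter the
    gauge is infinite and B is the whole space. *)
Let projection_gauge_le : exists2 c : R, (0 < c)%R & forall F,
  exists2 B : set 'rV[R]_n, measurable B & @rV_behead R n @` F `<=` B /\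
    c%:E * leb R n B <= hausdorff_gauge n 1 F.
Proof.
have [u u0 uE] := @unit_ball_volumeE R n.
exists (u / 4 ^+ n)%R => [|F]; first by rewrite divr_gt0// exprn_gt0.
rewrite /hausdorff_gauge; have [->|/set0P[x Fx]] := eqVneq F set0.
  by exists set0 => //; split; [rewrite image_set0|rewrite measure0 mule0].
case: ifPn => [dF|_]; last by exists setT => //; split; [|rewrite leey].
have [D D0 DE] : exists2 D : R, (0 <= D)%R & ediam F = D%:E.
  move: dF (ediam_ge0 F); case: (ediam F) => [D||]//.
  by rewrite !lee_fin => _ D0; exists D.
exists (cube (rV_behead x) D); first exact: measurable_cube.
split=> [_ [y Fy <-] i|].
  rewrite !mxE; have := coord_le_enorm (y - x) (lift ord0 i); rewrite !mxE.
  by move/le_trans; apply; rewrite -lee_fin -DE; exact: enorm_le_ediam.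
rewrite leb_cube// uE DE -EFinM -EFin_expe -EFinM lee_fin.
rewrite !exprMn -mulrA ler_pM2l// mulrA ler_wpM2r ?exprn_ge0// -exprVn -exprMn.
by rewrite lerXn2r// ?nnegrE; lra.
Qed.

(** Projecting a cover of E gives a cover of B by measurable sets of comparable cost. Covers at
    scale 1 are enough, since each pre-measure is below the Hausdorff measure. *)
Lemma hausdorff_ge_projection : exists2 c : R, (0 < c)%R &
  forall E (B : set 'rV[R]_n), measurable B -> B `<=` @rV_behead R n @` E ->
    c%:E * leb R n B <= hausdorff n E.
Proof.
have [c c0 cF] := projection_gauge_le; exists c => // E B mB BE.
apply: le_trans (hausdorff_pre_le n E (@ltr01 R)).
apply: le_ereal_inf_tmp => _ [F [mF EF] <-].
pose G k := sval (cid2 (cF (F k))).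
have mG k : measurable (G k) by rewrite /G; case: cid2.
have FG k : @rV_behead R n @` F k `<=` G k by rewrite /G; case: cid2 => /= ? ? [].
have cG k : c%:E * leb R n (G k) <= hausdorff_gauge n 1 (F k).
  by rewrite /G; case: cid2 => /= ? ? [].
apply: (@le_trans _ _ (\sum_(k <oo) c%:E * leb R n (G k))); last first.
  by apply: lee_nneseries => // k _ _; rewrite mule_ge0// lee_fin ltW.
rewrite nneseriesZl// lee_pmul2l//.
apply: measure_sigma_subadditive => //.
move=> y /BE[x /EF[k _ Fx] <-]; exists k => //; apply: FG; exists x => //.
Qed.

Let hausdorff_pre_finite_le (e : R) E (m : nat) (F : nat -> set 'rV[R]_n.+1) (b : R) :
  (0 <= b)%R ->
  (forall k, measurable (F k)) -> (E `<=` \bigcup_(k < m) F k) ->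
  (forall k, hausdorff_gauge n e (F k) <= b%:E) ->
  hausdorff_pre n e E <= (m%:R * b)%:E.
Proof.
move=> b0 mF EF Fb; pose G k := if (k < m)%N then F k else set0.
apply: (@le_trans _ _ (\sum_(k <oo) hausdorff_gauge n e (G k))).
  apply: ereal_inf_lbound; exists G => //; split.
    by move=> k; rewrite /G; case: ifP.
  by move=> x /EF[k /= km Fx]; exists k => //; rewrite /G km.
rewrite (nneseries_split 0 m); last by move=> k _; exact: hausdorff_gauge_ge0.
rewrite add0n eseries0 ?adde0; last first.
  by move=> k mk _; rewrite /G ltnNge mk/= hausdorff_gauge0.
apply: (@le_trans _ _ (\sum_(0 <= k < m) b%:E)).
  rewrite big_nat [leRHS]big_nat; apply: lee_sum => k /andP[_ km].
  by rewrite /G km.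
by rewrite sumEFin lee_fin big_const_nat subn0 iter_addr_0 mulr_natl.
Qed.

(** Cut the cube into cells of side s = 2 a / N. The part of E over a cell has diameter at most L s,
    so the total cost is at most u ((N + 1) L s / 2)^n <= u (2 L a)^n, whatever the scale e. *)
Lemma hausdorff_lipschitz_graph_le (L : R) : (0 <= L)%R ->
  exists2 C : R, (0 < C)%R & forall E (c : 'rV[R]_n) (a : R), measurable E ->
    (0 < a)%R -> (forall x, E x -> cube c a (rV_behead x)) ->
    (forall x y, E x -> E y ->
      (enorm (x - y) <= L * `|rV_behead x - rV_behead y|)%R) ->
    hausdorff n E <= (C * a ^+ n)%:E.
Proof.
move=> L0; have [u u0 uE] := @unit_ball_volumeE R n.
(* The summand 1 keeps the constant positive when L = 0. *)
exists (u * (2 * L + 1) ^+ n)%R => [|E c a mE a0 Ec EL].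
  by rewrite mulr_gt0// exprn_gt0// ltr_wpDl// mulr_ge0.
apply: ge_ereal_sup => _ [e /= e0 <-].
(* So many cells that L s <= e, which makes the gauge finite on each piece. *)
have [N0 N0e] : exists N, (2 * L * a / e < N%:R)%R.
  by exists (Num.truncn (2 * L * a / e)).+1; exact: truncnS_gt.
pose N := N0.+1; pose s := (2 * a / N%:R)%R.
have N_gt0 : (0 < N%:R :> R)%R by rewrite ltr0n.
have s0 : (0 < s)%R by rewrite /s divr_gt0// mulr_gt0.
have Ls : (L * s <= e)%R.
  rewrite /s mulrA ler_pdivrMr//.
  rewrite -ler_pdivrMl// (le_trans (ltW (_ : _ < N0%:R)%R)) ?ler_nat ?leqnSn//.
  by apply: le_lt_trans N0e; rewrite mulrC (mulrCA L) mulrA.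
(* N + 1 cells per side instead of N: truncation sends the right endpoint of the cube to the index
   N. *)
pose lo (q : 'I_N.+1) (i : 'I_n) := (c ord0 i - a + q%:R * s)%R.
pose cell (q : {ffun 'I_n -> 'I_N.+1}) :=
  [set x : 'rV[R]_n | forall i, x ord0 i \in `[lo (q i) i, lo (q i) i + s]%R].
have mcell q : measurable (cell q).
  by apply: (@measurable_rV_forall R n
    (fun i => [set t | t \in `[lo (q i) i, lo (q i) i + s]%R])) => i.
pose m := #|{ffun 'I_n -> 'I_N.+1}|.
have m_gt0 : (0 < m)%N.
  by apply/card_gt0P; exists [ffun=> ord0].
pose F k := E `&` (@rV_behead R n @^-1`
  cell (enum_val (cast_ord (prednK m_gt0) (inord k : 'I_m.-1.+1)))).
have mF k : measurable (F k).
  apply: measurableI => //; rewrite -[X in measurable X]setTI.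
  exact: measurable_rV_behead.
have EF : E `<=` \bigcup_(k < m) F k.
  move=> x Ex; have cx := Ec _ Ex.
  pose q := [ffun i : 'I_n =>
    inord (Num.truncn ((rV_behead x ord0 i - (c ord0 i - a)) / s)) : 'I_N.+1].
  have qx : cell q (rV_behead x).
    move=> i; rewrite /lo ffunE; have := cx i; rewrite ler_distl.
    move: (rV_behead x ord0 i) (c ord0 i) => y z /andP[zy yz].
    have ys0 : (0 <= (y - (z - a)) / s)%R by rewrite divr_ge0 ?(ltW s0)// subr_ge0.
    rewrite inordK; last first.
      rewrite ltnS -(ler_nat R) (le_trans (_ : _ <= (y - (z - a)) / s)%R) ?truncn_le//.
      by rewrite ler_pdivrMr// /s mulrC divfK ?gt_eqF//; lra.
    have /andP[t1 t2] := truncn_itv ys0.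
    move: t1; rewrite ler_pdivlMr// => t1.
    move: t2; rewrite -natr1 ltr_pdivrMr// [X in (_ < X)%R]mulrDl mul1r => t2.
    by rewrite in_itv/=; apply/andP; split; lra.
  exists (enum_rank q) => /=; first exact: ltn_ord.
  split=> //=; rewrite /preimage/=.
  rewrite (_ : cast_ord _ _ = enum_rank q) ?enum_rankK//.
  by apply: val_inj => /=; rewrite inordK// prednK// ltn_ord.
have Fb k : hausdorff_gauge n e (F k) <= (u * (L * s / 2) ^+ n)%:E.
  have Ls0 : (0 <= L * s)%R by rewrite mulr_ge0// ltW.
  have dF : ediam (F k) <= (L * s)%:E.
    apply: ge_ereal_sup => _ [->|[x [y [[Ex xq] [Ey yq] ->]]]]; rewrite lee_fin//.
    apply: le_trans (EL _ _ Ex Ey) _; rewrite ler_wpM2l//.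
    rewrite [X in (X <= _)%R]mx_normrE; apply: bigmax_le => [|[j i] _ /=]; first exact: ltW.
    have := xq i; have := yq i; rewrite ord1 !mxE !in_itv/= => /andP[? ?] /andP[? ?].
    by rewrite ler_distl; apply/andP; split; lra.
  rewrite /hausdorff_gauge; case: ifPn => _.
    by rewrite lee_fin mulr_ge0 ?exprn_ge0 ?(ltW u0)// divr_ge0.
  rewrite (le_trans dF) ?lee_fin// uE EFinM lee_pmul2l// EFin_expe.
  case: (ediam (F k)) dF (ediam_ge0 (F k)) => [D||]//; rewrite !lee_fin => DL D0.
  by rewrite -EFinM -!EFin_expe lee_fin lerXn2r ?nnegrE//; lra.
apply: le_trans (hausdorff_pre_finite_le _ mF EF Fb) _.
  by rewrite mulr_ge0 ?exprn_ge0 ?(ltW u0)// divr_ge0// mulr_ge0// ltW.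
rewrite lee_fin /m card_ffun !card_ord mulrCA -[leRHS]mulrA ler_pM2l// natrX -!exprMn.
rewrite lerXn2r ?nnegrE//.
- by rewrite mulr_ge0// divr_ge0// mulr_ge0// ltW.
- by rewrite mulr_ge0// ?(ltW a0)// addr_ge0// mulr_ge0.
have NN : (N.+1%:R / N%:R <= 2 :> R)%R.
  by rewrite ler_pdivrMr// -natrM ler_nat mul2n -addnn /N; lia.
have -> : (N.+1%:R * (L * s / 2) = N.+1%:R / N%:R * (L * a))%R.
  by rewrite /s; field; rewrite gt_eqF.
apply: (@le_trans _ _ (2 * (L * a))%R); first by rewrite ler_wpM2r// mulr_ge0// ltW.
by lra.
Qed.

End hausdorff_bounds.

(** * Boundary charts *)

Section enorm_topology.
Context {R : realType} {d : nat}.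
Implicit Types (x y w : 'rV[R]_d) (A : set 'rV[R]_d).

(** Bridges the topology of the sup norm and the Euclidean balls of charts and enclosing ball. *)
Lemma nbhs_enormP x A : nbhs x A <->
  exists2 a : R, 0 < a & forall y, enorm (y - x) < a -> A y.
Proof.
split=> [/nbhs_ballP[a /= a0 aA]|[a a0 aA]].
  exists a => // y yx; apply: aA; rewrite -ball_normE /ball_/= distrC.
  exact: le_lt_trans (norm_le_enorm _) yx.
apply/nbhs_ballP; exists (a / d.+1%:R) => /=; first by rewrite divr_gt0.
move=> y; rewrite -ball_normE /ball_/= distrC ltr_pdivlMr// => yx; apply: aA.
apply: le_lt_trans (enorm_le_norm _) (le_lt_trans _ yx).
by rewrite mulrC ler_wpM2l// ler_nat.
Qed.

Lemma closure_enormP x A : closure A x <->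
  forall a : R, 0 < a -> exists2 y, A y & enorm (y - x) < a.
Proof.
split=> [cA a a0|cA B /nbhs_enormP[a a0 aB]].
  have [|y [Ay yx]] := cA [set y | enorm (y - x) < a]; last by exists y.
  by apply/nbhs_enormP; exists a.
by have [y Ay yx] := cA _ a0; exists y; split => //; exact: aB.
Qed.

End enorm_topology.

Section dotp_mulmx.
Context {R : realType}.

Lemma dotp_mulmx_tr d m (u : 'rV[R]_d) (A : 'M[R]_(d, m)) (w : 'rV[R]_m) :
  dotp u (w *m A^T) = dotp (u *m A) w.
Proof.
have dE k (a b : 'rV[R]_k) : dotp a b = (a *m b^T) ord0 ord0.
  by rewrite mxE; apply: eq_bigr => i _; rewrite mxE.
by rewrite !dE trmx_mul trmxK mulmxA.
Qed.

Lemma dotp_delta d (u : 'rV[R]_d) i : dotp u (delta_mx ord0 i) = u ord0 i.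
Proof.
rewrite /dotp (bigD1 i)//= mxE !eqxx mulr1 big1 ?addr0// => j ji.
by rewrite mxE (negbTE ji) andbF mulr0.
Qed.

End dotp_mulmx.

Section chart.
Context {R : realType} {d : nat}.
Variables (P : 'M[R]_(d, d.-1)) (e : 'rV[R]_d) (psi : 'rV[R]_(d.-1) -> R).
Implicit Types (x y w : 'rV[R]_d) (Omega : set 'rV[R]_d).

Definition chart_fun x : R := dotp x e - psi (x *m P).

(** The gradient of [chart_fun], left unnormalized: it is globally Lipschitz at once, and its
    component along e is 1, which keeps its length at least 1. *)
Definition chart_normal x : 'rV[R]_d := e - grad psi (x *m P) *m P^T.

Hypothesis Cpsi : C11 psi.

Let dpsi z : differentiable psi z. Proof. by case: Cpsi. Qed.

Lemma chart_fun_mean_value x w : exists2 s : R, 0 < s < 1 &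
  chart_fun (x + w) - chart_fun x = dotp (chart_normal (x + s *: w)) w.
Proof.
have [s s01 psiE] := mean_value_grad (x *m P) (w *m P) dpsi.
exists s => //; rewrite /chart_fun /chart_normal (dotpDl x w).
rewrite [in LHS]mulmxDl dotpDl dotpNl (dotpC (_ *m _)) dotp_mulmx_tr.
rewrite mulmxDl -scalemxAl (dotpC (w *m P)) -psiE (dotpC w); ring.
Qed.

Lemma continuous_chart_fun_segment x w :
  continuous (fun s : R => chart_fun (x + s *: w)).
Proof.
have c1 : continuous (fun s : R => dotp (x + s *: w) e).
  rewrite (_ : (fun s => _) = (fun s => dotp x e + s * dotp w e)).
    move=> s; apply: cvgD; first exact: cvg_cst.
    by apply: cvgM; [exact: cvg_id|exact: cvg_cst].
  by apply/funext => r; rewrite dotpDl dotpZl.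
have c2 : continuous (fun s : R => psi ((x + s *: w) *m P)).
  rewrite (_ : (fun s => _) = (fun s => psi (x *m P + s *: (w *m P)))).
    exact: continuous_segment.
  by apply/funext => r; rewrite mulmxDl -scalemxAl.
by move=> s; apply: cvgB; [exact: c1|exact: c2].
Qed.

Lemma chart_normal_lipschitz : exists2 L : R, 0 <= L &
  forall x y, enorm (chart_normal x - chart_normal y) <= L * enorm (x - y).
Proof.
have [_ [L gL]] := Cpsi; have [C C0 PC] := mulmx_enorm_le P.
have [C' C'0 PC'] := mulmx_enorm_le P^T.
exists (C' * (`|L| * C)) => [|x y]; first by rewrite !mulr_ge0.
have -> : chart_normal x - chart_normal y =
    (grad psi (y *m P) - grad psi (x *m P)) *m P^T.
  by rewrite /chart_normal mulmxBl opprB addrC addrA subrK.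
rewrite -!mulrA; apply: le_trans (PC' _) _; rewrite ler_wpM2l// enormB.
apply: le_trans (gL _ _) _; rewrite -mulmxBl.
apply: (@le_trans _ _ (`|L| * enorm ((x - y) *m P))).
  by rewrite ler_wpM2r ?enorm_ge0// ler_norm.
by rewrite ler_wpM2l.
Qed.

Hypotheses (PP : P^T *m P = 1%:M) (eP : e *m P = 0) (ee : dotp e e = 1).

Lemma dotp_chart_normal_e x : dotp e (chart_normal x) = 1.
Proof. by rewrite dotpDr dotpNr dotp_mulmx_tr eP ee -(scale0r 0) dotpZl mul0r subr0. Qed.

Lemma dotp_chart_normal x : dotp (chart_normal x) (chart_normal x) =
  1 + dotp (grad psi (x *m P)) (grad psi (x *m P)).
Proof.
rewrite {1}/chart_normal dotpDl dotp_chart_normal_e dotpNl /chart_normal dotpDr.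
rewrite dotpNr (dotpC _ e) !dotp_mulmx_tr eP -mulmxA PP mulmx1.
by rewrite -{1}(scale0r 0) dotpZl mul0r sub0r opprK.
Qed.

Lemma chart_normal_ge1 x : 1 <= enorm (chart_normal x).
Proof. by rewrite -[leLHS]sqrtr1 /enorm ler_wsqrtr// dotp_chart_normal lerDl dotpvv_ge0. Qed.

Lemma chart_fun_subZ x (a : R) : chart_fun (x - a *: e) = chart_fun x - a.
Proof.
rewrite /chart_fun dotpDl dotpNl dotpZl ee mulr1 mulmxBl -scalemxAl eP scaler0 subr0.
by rewrite addrAC.
Qed.

End chart.

Section chart_boundary.
Context {R : realType} {d : nat}.
Implicit Types (x y w : 'rV[R]_d) (Omega : set 'rV[R]_d).

Lemma C11_chart_recenter Omega x0 x r P e psi : C11_chart Omega x0 r P e psi ->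
  enorm (x - x0) < r -> exists2 r', 0 < r' & C11_chart Omega x r' P e psi.
Proof.
move=> [r0 H1 H2 H] xr; exists (r - enorm (x - x0)); first by rewrite subr_gt0.
split=> //; first by rewrite subr_gt0.
move=> y; rewrite ltrBrDr => yx; apply: H; apply: le_lt_trans yx.
by rewrite (_ : y - x0 = (y - x) + (x - x0)) ?enormD// addrA subrK.
Qed.

Section at_point.
Variables (Omega : set 'rV[R]_d) (x : 'rV[R]_d) (r : R) (P : 'M[R]_(d, d.-1))
  (e : 'rV[R]_d) (psi : 'rV[R]_(d.-1) -> R).
Hypothesis chart : C11_chart Omega x r P e psi.
Let r0 : 0 < r. Proof. by case: chart. Qed.
Let PP : P^T *m P = 1%:M. Proof. by case: chart => _ []. Qed.
Let eP : e *m P = 0. Proof. by case: chart => _ [_ []]. Qed.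
Let ee : dotp e e = 1. Proof. by case: chart => _ [_ []]. Qed.
Let Cpsi : C11 psi. Proof. by case: chart. Qed.
Local Notation G := (chart_fun P e psi).
Local Notation N := (chart_normal P e psi).

Let chartP y : enorm (y - x) < r -> (Omega y <-> G y < 0).
Proof. by case: chart => _ _ _ H /H; rewrite /chart_fun subr_lt0. Qed.

Let shiftK w : x + w - x = w. Proof. by rewrite addrAC subrr add0r. Qed.

Let chart_fun_near (b : R) : 0 < b -> exists2 a, 0 < a &
  forall y, enorm (y - x) < a -> `|G y - G x| < b.
Proof.
move=> b0; have [L L0 NL] := chart_normal_lipschitz P e Cpsi.
pose K := enorm (N x) + L + 1; have K0 : 0 < K.
  by rewrite ltr_wpDl// addr_ge0// enorm_ge0.
exists (Num.min 1 (b / K)) => [|y]; first by rewrite lt_min ltr01 divr_gt0.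
rewrite lt_min => /andP[y1 yb].
have [s /andP[s0 s1]] := chart_fun_mean_value P e Cpsi x (y - x).
rewrite [x + (y - x)]addrC subrK => ->; apply: le_lt_trans (dotp_norm_le _ _) _.
apply: (@le_lt_trans _ _ (K * enorm (y - x))).
  rewrite ler_wpM2r ?enorm_ge0// /K.
  have := enorm_ler (N (x + s *: (y - x))) (N x).
  have := NL (x + s *: (y - x)) x; rewrite shiftK enormZ gtr0_norm//.
  have : L * (s * enorm (y - x)) <= L.
    rewrite ler_piMr// mulr_ile1 ?enorm_ge0 ?(ltW s0) ?(ltW s1) ?(ltW y1)//.
  have aux (p q l m u : R) : m <= l -> u <= m -> p - q <= u -> p <= q + l + 1.
    move=> ml um; rewrite lerBlDl => /le_trans; apply; rewrite -addrA lerD2l.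
    by apply: le_trans um _; apply: le_trans ml _; rewrite lerDl.
  exact: aux.
by rewrite mulrC -ltr_pdivlMr.
Qed.

Lemma boundary_chart_fun : boundary Omega x -> G x = 0.
Proof.
move=> [cx nix]; apply/eqP; rewrite eq_le; apply/andP; split; rewrite leNgt; apply/negP.
  move=> Gx; have [a a0 aG] := chart_fun_near Gx.
  have := (closure_enormP x Omega).1 cx (Num.min a r); rewrite lt_min a0 r0.
  move=> /(_ isT)[y Oy]; rewrite lt_min => /andP[ya yr].
  have := (chartP yr).1 Oy; have := aG _ ya; rewrite ltr_norml; lra.
move=> Gx; apply: nix; apply/nbhs_enormP.
have [|a a0 aG] := @chart_fun_near (- G x); first by rewrite oppr_gt0.
exists (Num.min a r); first by rewrite lt_min a0 r0.
move=> y; rewrite lt_min => /andP[ya yr]; apply/(chartP yr).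
have := aG _ ya; rewrite ltr_norml; lra.
Qed.

(** Moving from x by - a e lowers [chart_fun] by exactly a, so points of Omega accumulate at x,
    while x itself is outside Omega. *)
Lemma chart_fun_boundary : G x = 0 -> boundary Omega x.
Proof.
move=> Gx; split.
  apply/closure_enormP => a a0; exists (x - (Num.min a r / 2) *: e).
    apply/chartP.
      rewrite shiftK enormN enormZ /enorm ee sqrtr1 mulr1.
      rewrite gtr0_norm ?divr_gt0 ?lt_min ?a0 ?r0//.
      by rewrite ltr_pdivrMr// gt_min; apply/orP; right; rewrite ltr_pMr// ltr1n.
    by rewrite chart_fun_subZ// Gx sub0r oppr_lt0 divr_gt0// lt_min a0.
  rewrite shiftK enormN enormZ /enorm ee sqrtr1 mulr1.
  rewrite gtr0_norm ?divr_gt0 ?lt_min ?a0 ?r0//.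
  by rewrite ltr_pdivrMr// gt_min; apply/orP; left; rewrite ltr_pMr// ltr1n.
move=> /interior_subset; have xr : enorm (x - x) < r by rewrite subrr enorm0.
by move=> /(chartP xr); rewrite Gx ltxx.
Qed.

Let mean_value0 w : G x = 0 ->
  exists2 s : R, 0 < s < 1 & G (x + w) = dotp (N (x + s *: w)) w.
Proof.
move=> Gx; have [s s01 E] := chart_fun_mean_value P e Cpsi x w; exists s => //.
exact: etrans (esym (subr0 _))
  (etrans (congr1 (fun z => G (x + w) - z) (esym Gx)) E).
Qed.

(** By the mean value theorem, G(x + s w) is s times a slope that differs from <N x, w> by at most L
    s |w|^2, hence is negative for small s. *)
Lemma chart_inward w : G x = 0 -> dotp (N x) w < 0 ->
  exists2 a : R, 0 < a & forall s, 0 < s < a -> Omega (x + s *: w).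
Proof.
move=> Gx Nw; have [L L0 NL] := chart_normal_lipschitz P e Cpsi.
(* Below a1 the error stays under the slope, below a2 the point stays in the chart; the summands 1
   protect the denominators. *)
pose a1 := - dotp (N x) w / (L * enorm w ^+ 2 + 1).
pose a2 := r / (enorm w + 1).
have D1 : 0 < L * enorm w ^+ 2 + 1 by rewrite ltr_wpDl// mulr_ge0// sqr_ge0.
have D2 : 0 < enorm w + 1 by rewrite ltr_wpDl// enorm_ge0.
exists (Num.min a1 a2) => [|s]; first by rewrite lt_min !divr_gt0// oppr_gt0.
rewrite lt_min => /and3P[s0]; rewrite /a1 /a2 !ltr_pdivlMr// => s1 s2.
have w0 := enorm_ge0 w.
apply/chartP.
  rewrite shiftK enormZ gtr0_norm//.
  by apply: le_lt_trans s2; rewrite ler_pM2l// lerDl.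
have [q /andP[q0 q1] ->] := mean_value0 (s *: w) Gx.
rewrite dotpZr (pmulr_rlt0 _ s0) -[N (x + _)](subrK (N x)) dotpDl.
have := dotp_le (N (x + q *: (s *: w)) - N x) w.
have := NL (x + q *: (s *: w)) x; rewrite shiftK !enormZ (gtr0_norm q0) (gtr0_norm s0).
move: (enorm (_ - _)) (dotp _ w) (dotp (N x) w) s1 => A B C' s1 H1 H2.
have : L * (q * (s * enorm w)) <= L * (s * enorm w).
  by rewrite ler_wpM2l// ler_piMl ?(ltW q1)// mulr_ge0// ltW.
move: (enorm w) w0 s1 H1 H2 => W W0 s1 H1 H2 H3.
have : A * W <= L * (s * W) * W by rewrite ler_wpM2r// (le_trans H1).
by lra.
Qed.

(** The open half-space of descending directions consists of inward ones, and nu is nonpositive on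
    all of these, so [unit_normal_unique] applies. It serves twice: with nu from another chart, and
    with nu the radial direction of the enclosing ball. *)
Lemma chart_normal_eq (nu : 'rV[R]_d) : G x = 0 -> dotp nu nu = 1 ->
  (forall w, (exists2 a : R, 0 < a & forall s, 0 < s < a -> Omega (x + s *: w)) ->
    dotp nu w <= 0) ->
  (enorm (N x))^-1 *: N x = nu.
Proof.
move=> Gx nu1 Onu; have N1 := chart_normal_ge1 psi PP eP ee x.
have N0 : 0 < enorm (N x) by rewrite (lt_le_trans ltr01).
apply: unit_normal_unique => // [|w].
  by rewrite dotpZl dotpZr -sqr_enorm expr2 mulKf ?mulVf ?gt_eqF.
rewrite dotpZl pmulr_rlt0 ?invr_gt0// => Nw; apply: Onu; exact: chart_inward.
Qed.

Lemma chart_inward_le0 w : G x = 0 ->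
  (exists2 a : R, 0 < a & forall s, 0 < s < a -> Omega (x + s *: w)) ->
  dotp (N x) w <= 0.
Proof.
move=> Gx [a a0 aO]; rewrite leNgt; apply/negP => Nw.
have [L L0 NL] := chart_normal_lipschitz P e Cpsi.
pose a1 := dotp (N x) w / (L * enorm w ^+ 2 + 1).
pose a2 := r / (enorm w + 1).
have D1 : 0 < L * enorm w ^+ 2 + 1 by rewrite ltr_wpDl// mulr_ge0// sqr_ge0.
have D2 : 0 < enorm w + 1 by rewrite ltr_wpDl// enorm_ge0.
pose s := Num.min a (Num.min a1 a2) / 2.
have m0 : 0 < Num.min a (Num.min a1 a2) by rewrite !lt_min a0 !divr_gt0.
have s0 : 0 < s by rewrite divr_gt0.
have : s < Num.min a (Num.min a1 a2) by rewrite ltr_pdivrMr// ltr_pMr// ltr1n.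
rewrite !lt_min => /and3P[sa]; rewrite /a1 /a2 !ltr_pdivlMr// => s1 s2.
have w0 := enorm_ge0 w.
have := aO s; rewrite s0 sa => /(_ isT)/chartP.
rewrite shiftK enormZ gtr0_norm//.
have -> : s * enorm w < r by apply: le_lt_trans s2; rewrite ler_pM2l// lerDl.
move=> /(_ isT); apply/negP; rewrite -leNgt.
have [q /andP[q0 q1] ->] := mean_value0 (s *: w) Gx.
rewrite dotpZr (pmulr_rge0 _ s0) -[N (x + _)](subrK (N x)) dotpDl.
have := dotp_norm_le (N (x + q *: (s *: w)) - N x) w; rewrite ler_norml => /andP[+ _].
have := NL (x + q *: (s *: w)) x; rewrite shiftK !enormZ (gtr0_norm q0) (gtr0_norm s0).
move: (enorm (_ - _)) (dotp _ w) (dotp (N x) w) s1 => A B C' s1 H1 H2.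
have : L * (q * (s * enorm w)) <= L * (s * enorm w).
  by rewrite ler_wpM2l// ler_piMl ?(ltW q1)// mulr_ge0// ltW.
move: (enorm w) w0 s1 H1 H2 => W W0 s1 H1 H2 H3.
have : A * W <= L * (s * W) * W by rewrite ler_wpM2r// (le_trans H1).
by lra.
Qed.

End at_point.

(** The inward directions at x do not depend on the chart, and they determine the unit normal; so
    the choice made by [xget] is the normal of any given chart. *)
Lemma outward_normalE Omega x r P e psi : C11_chart Omega x r P e psi ->
  boundary Omega x ->
  outward_normal Omega x =
    (enorm (chart_normal P e psi x))^-1 *: chart_normal P e psi x.
Proof.
move=> ch bx; have nE r' P' e' psi' : C11_chart Omega x r' P' e' psi' ->
    Num.sqrt (1 + dotp (grad psi' (x *m P')) (grad psi' (x *m P'))) =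
    enorm (chart_normal P' e' psi' x).
  by move=> [_ [PP [eP ee]] Cp _]; rewrite /enorm dotp_chart_normal.
apply: xget_unique; first by exists r, P, e, psi; rewrite (nE _ _ _ _ ch).
move=> _ [r' [P' [e' [psi' [ch' ->]]]]]; rewrite (nE _ _ _ _ ch') -/(chart_normal P' e' psi' x); apply/esym.
have [r0 [PP [eP ee]] Cp _] := ch; have [r'0 [PP' [eP' ee']] Cp' _] := ch'.
have N1 := chart_normal_ge1 psi' PP' eP' ee' x.
have N0 : 0 < enorm (chart_normal P' e' psi' x) by rewrite (lt_le_trans ltr01).
apply: (chart_normal_eq ch) => [||w aw].
- exact: (boundary_chart_fun ch).
- by rewrite dotpZl dotpZr -sqr_enorm expr2 mulKf ?mulVf ?gt_eqF.
- rewrite dotpZl pmulr_rle0 ?invr_gt0//.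
  by apply: (chart_inward_le0 ch') => //; exact: (boundary_chart_fun ch').
Qed.

End chart_boundary.

(** * An extreme boundary point *)

Section touching_ball.
Context {R : realType} {d : nat}.
Implicit Types (Omega : set 'rV[R]_d) (c x nu : 'rV[R]_d) (rho : R).

Definition touching_ball Omega c x nu rho : Prop :=
  [/\ 0 < rho, dotp nu nu = 1, x - c = rho *: nu, boundary Omega x &
    forall y, closure Omega y -> enorm (y - c) <= rho].

(** Expand |(y - x) + rho nu|^2 <= rho^2. This is the only convexity used; Omega itself may be
    non-convex. *)
Lemma touching_ball_dotp Omega c x nu rho y : touching_ball Omega c x nu rho ->
  closure Omega y -> dotp (y - x) nu <= - (enorm (y - x) ^+ 2 / (2 * rho)).
Proof.
move=> [rho0 nu1 xc _ ball] /ball yc.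
have : enorm (y - c) ^+ 2 <= rho ^+ 2.
  by rewrite lerXn2r ?nnegrE ?enorm_ge0 ?(ltW rho0).
rewrite (_ : y - c = (y - x) + rho *: nu); last by rewrite -xc addrA subrK.
move: (y - x) => z; rewrite !sqr_enorm !dotpE nu1 (dotpC nu) mulr1.
move: (dotp z nu) (dotp z z) => a b H.
by rewrite -lerN2 opprK ler_pdivrMr ?mulr_gt0//; lra.
Qed.

(** At an interior point one could move radially away from c inside Omega and increase the distance;
    so a farthest point is on the boundary. *)
Lemma farthest_point_touching Omega c x : closure Omega x -> 0 < enorm (x - c) ->
  (forall y, closure Omega y -> enorm (y - c) <= enorm (x - c)) ->
  touching_ball Omega c x ((enorm (x - c))^-1 *: (x - c)) (enorm (x - c)).
Proof.
move=> cx rho0 xmax; split => //.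
- by rewrite dotpZl dotpZr -sqr_enorm expr2 mulKf ?mulVf ?gt_eqF.
- by rewrite scalerA mulfV ?scale1r// gt_eqF.
split=> // /nbhs_enormP[a a0 aO].
pose k := a / 2 / enorm (x - c); have k0 : 0 < k by rewrite !divr_gt0.
have Oy : Omega (x + k *: (x - c)).
  apply: aO; rewrite [_ - x](_ : _ = k *: (x - c)); last by rewrite addrAC subrr add0r.
  by rewrite enormZ gtr0_norm// /k divfK ?gt_eqF// ltr_pdivrMr// ltr_pMr// ltr1n.
have := xmax _ (subset_closure Oy).
rewrite (_ : _ - c = (1 + k) *: (x - c)); last first.
  by rewrite scalerDl scale1r addrAC.
rewrite enormZ gtr0_norm ?addr_gt0//.
by apply/negP; rewrite -ltNge ltr_pMl// ltrDl.
Qed.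

End touching_ball.

(** On the closure the sup norm is at most B + 1, and the centre is - (B + 2) times the first basis
    vector; so the farthest point exceeds the centre in the first coordinate, and nu inherits the
    sign. *)
Lemma touching_ball_exists {R : realType} {n : nat} (Omega : set 'rV[R]_n.+1) :
  Omega !=set0 -> bounded_set Omega ->
  exists c x nu rho, touching_ball Omega c x nu rho /\ 0 < nu ord0 ord0.
Proof.
move=> [y0 Oy0] /pinfty_ex_gt0[B B0 OB].
have cB x : closure Omega x -> `|x| <= B + 1.
  move=> /closure_enormP/(_ _ ltr01)[y Oy yx].
  rewrite -[x](subrK y); apply: le_trans (ler_normD _ _) _; rewrite addrC lerD ?OB//.
  by rewrite distrC; apply: le_trans (norm_le_enorm _) (ltW yx).
have [x cx xmax] : exists2 x, closure Omega x & forall y, closure Omega y ->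
    enorm (y - - (B + 2) *: delta_mx ord0 ord0) <= enorm (x - - (B + 2) *: delta_mx ord0 ord0).
  have [|||x cx xmax] := @EVT_max_rV R _
      (fun y : 'rV[R]_n.+1 => enorm (y - - (B + 2) *: delta_mx ord0 ord0)) (closure Omega).
  - by exists y0; exact: subset_closure.
  - apply: bounded_closed_compact; last exact: closed_closure.
    exists (B + 1); split; first exact: num_real.
    by move=> M BM y /cB/le_trans; apply; exact: ltW.
  - exact/continuous_subspaceT/continuous_enorm.
  - exists x; first exact/set_mem.
    by move=> y cy; apply: xmax; exact/mem_set.
set c := - (B + 2) *: delta_mx ord0 ord0 in xmax.
have xc0 : 0 < (x - c) ord0 ord0.
  rewrite !mxE !eqxx /= mulr1 opprK.
  have := le_trans (coord_le_norm x ord0) (cB _ cx); rewrite ler_norml => /andP[].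
  lra.
have rho0 : 0 < enorm (x - c).
  by apply: lt_le_trans (coord_le_enorm _ ord0); rewrite normr_gt0 gt_eqF.
exists c, x, ((enorm (x - c))^-1 *: (x - c)), (enorm (x - c)).
by split; [exact: farthest_point_touching|rewrite mxE mulr_gt0// invr_gt0].
Qed.

Definition boundary_cap {R : realType} {d : nat} (Omega : set 'rV[R]_d) (x0 : 'rV[R]_d)
  (a : R) : set 'rV[R]_d := boundary Omega `&` [set x | enorm (x - x0) <= a].

Section cap.
Context {R : realType} {n : nat}.
Variables (Omega : set 'rV[R]_n.+2) (c x0 nu : 'rV[R]_n.+2) (rho : R).
Hypothesis touch : touching_ball Omega c x0 nu rho.
Variables (r : R) (P : 'M[R]_(n.+2, n.+1)) (e : 'rV[R]_n.+2)
  (psi : 'rV[R]_n.+1 -> R).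
Hypothesis chart : C11_chart Omega x0 r P e psi.
Implicit Types x y w : 'rV[R]_n.+2.

Let G := @chart_fun R n.+2 P e psi.
Let N := @chart_normal R n.+2 P e psi.
Let M := enorm (N x0).
Let r0 : 0 < r. Proof. by case: chart. Qed.
Let PP : P^T *m P = 1%:M. Proof. by case: chart => _ []. Qed.
Let eP : e *m P = 0. Proof. by case: chart => _ [_ []]. Qed.
Let ee : dotp e e = 1. Proof. by case: chart => _ [_ []]. Qed.
Let Cpsi : C11 psi. Proof. by case: chart. Qed.
Let nu1 : dotp nu nu = 1. Proof. by case: touch. Qed.

Let N_ge1 x : 1 <= enorm (N x). Proof. exact: (@chart_normal_ge1 R n.+2 P e psi PP eP ee x). Qed.

Let M0 : 0 < M. Proof. exact: lt_le_trans (N_ge1 x0). Qed.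

Let enu : enorm nu = 1. Proof. by rewrite /enorm nu1 sqrtr1. Qed.

Let G_boundary x : enorm (x - x0) < r -> boundary Omega x <-> G x = 0.
Proof.
move=> xr; have [r' r'0 ch] := C11_chart_recenter chart xr.
by split; [exact: boundary_chart_fun ch|exact: chart_fun_boundary ch].
Qed.

Let Gx0 : G x0 = 0.
Proof. by apply: (boundary_chart_fun chart); case: touch. Qed.

(** Inward directions at x0 lead into the enclosing ball, so nu is nonpositive on them: the boundary
    normal is the radial one. *)
Let Nx0 : N x0 = M *: nu.
Proof.
have -> : nu = M^-1 *: N x0.
  apply/esym/(chart_normal_eq chart) => // w [a a0 aO].
  have a20 : 0 < a / 2 by rewrite divr_gt0.
  have /aO/subset_closure/(touching_ball_dotp touch) : 0 < a / 2 < a.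
    by rewrite a20 ltr_pdivrMr// ltr_pMr// ltr1n.
  rewrite [x0 + _]addrC addrK dotpZl dotpC => H.
  rewrite -(pmulr_rle0 _ a20); apply: le_trans H _.
  rewrite oppr_le0 divr_ge0 ?sqr_ge0// mulr_ge0//.
  by case: touch => /ltW.
by rewrite scalerA mulfV ?scale1r// gt_eqF.
Qed.

(** One Lipschitz constant is fixed here for all estimates of the section. *)
Let L := sval (cid2 (@chart_normal_lipschitz R n.+2 P e psi Cpsi)).
Let L0 : 0 <= L. Proof. by rewrite /L; case: cid2. Qed.
Let NL x : enorm (N x - M *: nu) <= L * enorm (x - x0).
Proof. by rewrite -Nx0 /L; case: cid2 => /= ? ? H; exact: H. Qed.

Let N_segment x w (a s : R) : 0 < s < 1 -> enorm (x - x0) <= a ->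
  enorm (x + w - x0) <= a -> enorm (N (x + s *: w) - M *: nu) <= L * a.
Proof.
move=> /andP[s0 s1] xa xwa; apply: le_trans (NL _) _; rewrite ler_wpM2l//.
rewrite (_ : _ - x0 = (1 - s) *: (x - x0) + s *: (x + w - x0)); last first.
  apply/rowP => i; rewrite !mxE; ring.
apply: le_trans (enormD _ _) _; rewrite !enormZ !gtr0_norm ?subr_gt0//.
have : (1 - s) * enorm (x - x0) <= (1 - s) * a by rewrite ler_wpM2l// subr_ge0 ltW.
have : s * enorm (x + w - x0) <= s * a by rewrite ler_wpM2l// ltW.
by lra.
Qed.

Let G_mean_value x w (a : R) : enorm (x - x0) <= a -> enorm (x + w - x0) <= a ->
  `|G (x + w) - G x - M * dotp nu w| <= L * a * enorm w.
Proof.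
move=> xa xwa; have [s s01 ->] := @chart_fun_mean_value R n.+2 P e psi Cpsi x w.
rewrite -dotpZl -dotpNl -dotpDl; apply: le_trans (dotp_norm_le _ _) _.
by rewrite ler_wpM2r ?enorm_ge0//; exact: N_segment.
Qed.

Let G_mean_value0 w (a : R) : enorm w <= a ->
  `|G (x0 + w) - M * dotp nu w| <= L * a * enorm w.
Proof.
move=> wa; have := @G_mean_value x0 w a.
rewrite subrr enorm0 [x0 + w - x0]addrAC subrr add0r.
rewrite (_ : G (x0 + w) - G x0 = G (x0 + w)); last first.
  exact: etrans (congr1 (fun z => G (x0 + w) - z) Gx0) (subr0 _).
by apply => //; exact: le_trans (enorm_ge0 w) wa.
Qed.

(** Forgets the chart and keeps what the trace estimate uses. The quadratic bound comes from G = 0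
    at both x0 and x, the Lipschitz normal and M >= 1; it puts a boundary cap of radius s^2 within
    height s^4 of the tangent hyperplane. *)
Lemma boundary_tangent : exists M K r1 : R, exists N : 'rV[R]_n.+2 -> 'rV[R]_n.+2,
  [/\ 1 <= M, 0 <= K, 0 < r1 & forall x, boundary Omega x -> enorm (x - x0) < r1 ->
    [/\ outward_normal Omega x = (enorm (N x))^-1 *: N x, 1 <= enorm (N x),
      enorm (N x - M *: nu) <= K * enorm (x - x0) &
      `|dotp (x - x0) nu| <= K * enorm (x - x0) ^+ 2]].
Proof.
exists M, L, r, N; split; [exact: N_ge1|exact: L0|exact: r0|move=> x bx xr].
have [r' r'0 ch] := C11_chart_recenter chart xr.
split; [exact: (outward_normalE ch)|exact: N_ge1|exact: NL|].
have Gx : G x = 0 by apply/G_boundary.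
have := @G_mean_value0 (x - x0) (enorm (x - x0)) (lexx _).
rewrite [x0 + _]addrC subrK Gx sub0r normrN -mulrA -expr2 dotpC normrM (gtr0_norm M0).
by apply: le_trans; apply: ler_peMl; [exact: normr_ge0|exact: N_ge1].
Qed.

Hypothesis nu0 : 0 < nu ord0 ord0.
Let e0 : 'rV[R]_n.+2 := delta_mx ord0 ord0.
Let nu00 := nu ord0 ord0.

Let nu_le1 : nu00 <= 1.
Proof. by rewrite -enu; apply: le_trans (coord_le_enorm nu ord0); exact: ler_norm. Qed.

Let enorm_e0 : enorm e0 = 1.
Proof. by rewrite /enorm dotp_delta mxE !eqxx sqrtr1. Qed.

Let behead_enorm w : enorm (w - w ord0 ord0 *: e0) <= n.+2%:R * `|rV_behead w|.
Proof.
apply: enorm_le_sum => i; rewrite !mxE eqxx/=.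
have [j ->|->] := unliftP ord0 i; last by rewrite eqxx mulr1 subrr normr0.
rewrite eq_sym (negbTE (neq_lift _ _)) mulr0 subr0.
by have := coord_le_norm (rV_behead w) j; rewrite mxE.
Qed.

(** For two boundary points the difference w is almost tangent: |<nu, w>| <= nu00 |w| / 8. Splitting
    off the first coordinate b, nu00 |b| is at most |<nu, w>| plus the length of the rest, and |w|
    is absorbed. *)
Let graph_lipschitz (a : R) x y : L * a <= M * nu00 / 8 -> G x = 0 -> G y = 0 ->
  enorm (x - x0) <= a -> enorm (y - x0) <= a ->
  enorm (y - x) <= (2 / nu00 + 1) * n.+2%:R * `|rV_behead (y - x)|.
Proof.
move=> La Gx Gy xa ya; set w := y - x.
have := @G_mean_value x w a xa; rewrite /w [x + _]addrC subrK Gx Gy subrr sub0r normrN.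
move=> /(_ ya); rewrite -/w normrM (gtr0_norm M0) => H.
have {}H : `|dotp nu w| <= nu00 / 8 * enorm w.
  rewrite -(ler_pM2l M0); apply: le_trans H _; rewrite mulrA ler_wpM2r ?enorm_ge0//.
  by rewrite mulrA.
set w' := w - w ord0 ord0 *: e0; set b := w ord0 ord0.
have wE : w = w' + b *: e0 by rewrite /w' subrK.
have Hw : enorm w <= enorm w' + `|b|.
  by rewrite {1}wE; apply: le_trans (enormD _ _) _; rewrite enormZ enorm_e0 mulr1.
have Hn : `|nu00 * b| <= `|dotp nu w| + enorm w'.
  have := dotp_norm_le nu w'; rewrite enu mul1r.
  rewrite wE dotpDr dotpZr dotp_delta -/nu00 [b * _]mulrC.
  rewrite !ler_norml; move: (dotp nu w') (nu00 * b) => p q.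
  have : p + q <= `|p + q| by exact: ler_norm.
  have : - (p + q) <= `|p + q| by rewrite -normrN ler_norm.
  by move=> ? ? /andP[? ?]; apply/andP; split; lra.
rewrite normrM (gtr0_norm nu0) in Hn.
have w'0 := enorm_ge0 w'; have b0 := normr_ge0 b.
have Hb : `|b| <= 2 / nu00 * enorm w'.
  rewrite mulrAC ler_pdivlMr//.
  have : nu00 / 8 * enorm w <= nu00 / 8 * (enorm w' + `|b|).
    by rewrite ler_wpM2l// divr_ge0// ltW.
  have : nu00 * enorm w' <= enorm w' by rewrite ler_piMl.
  have : nu00 * `|b| <= `|dotp nu w| + enorm w' by exact: Hn.
  move: H w'0; move: nu00 `|b| (enorm w') (enorm w) `|dotp _ _| => p q s t u *; lra.
have Hw' := behead_enorm w.
rewrite -mulrA; apply: (@le_trans _ _ ((2 / nu00 + 1) * enorm w')); first by lra.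
by rewrite ler_wpM2l// addr_ge0// divr_ge0// ltW.
Qed.

(** Intermediate values along the first axis: at s = a/2 and s = - a/2 the main term M nu00 s has
    size M nu00 a / 2, whereas the nonlinear error and the contribution of w0 are each at most M
    nu00 a / 8. *)
Let graph_exists (a : R) (y : 'rV[R]_n.+1) : 0 < a -> L * a <= M * nu00 / 8 ->
  cube (rV_behead x0) (nu00 / 8 / n.+2%:R * a) y ->
  exists x, [/\ G x = 0, enorm (x - x0) <= a & rV_behead x = y].
Proof.
move=> a0 La cy; pose w0 := rV_cons (0, y - rV_behead x0).
have w0a : enorm w0 <= nu00 / 8 * a.
  rewrite (_ : _ * a = n.+2%:R * (nu00 / 8 / n.+2%:R * a)); last first.
    by rewrite mulrA [n.+2%:R * _]mulrC divfK ?pnatr_eq0.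
  apply: enorm_le_sum => i; have [j ->|->] := unliftP ord0 i.
    by rewrite rV_consS/= !mxE; have := cy j; rewrite mxE.
  by rewrite rV_cons0/= normr0 !mulr_ge0 ?invr_ge0 ?(ltW nu0) ?(ltW a0).
have nua : nu00 * a <= a by rewrite ler_piMl// ltW.
have w0a' : enorm w0 <= a / 8 by apply: le_trans w0a _; lra.
have wE (s : R) : x0 + (w0 + s *: e0) - x0 = w0 + s *: e0 by rewrite addrAC subrr add0r.
have wa (s : R) : `|s| <= a / 2 -> enorm (w0 + s *: e0) <= a.
  by move=> sa; apply: le_trans (enormD _ _) _; rewrite enormZ enorm_e0 mulr1; lra.
have Gs (s : R) : `|s| <= a / 2 -> `|G (x0 + (w0 + s *: e0)) - M * dotp nu w0 - M * nu00 * s|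
    <= M * nu00 / 8 * a.
  move=> sa; have := @G_mean_value0 (w0 + s *: e0) a (wa _ sa).
  rewrite dotpDr dotpZr dotp_delta -/nu00 mulrDr opprD addrA.
  rewrite [M * (s * _)]mulrCA [s * _]mulrC => /le_trans; apply.
  have := wa _ sa; move: (enorm _) (enorm_ge0 (w0 + s *: e0)) => p p0 pa.
  apply: le_trans (ler_wpM2r p0 La) _; rewrite ler_wpM2l// divr_ge0// mulr_ge0// ltW//.
have w0n : `|M * dotp nu w0| <= M * nu00 / 8 * a.
  rewrite normrM (gtr0_norm M0) -!mulrA ler_pM2l//.
  by apply: le_trans (dotp_norm_le _ _) _; rewrite enu mul1r mulrA.
pose g (s : R) := G (x0 + w0 + s *: e0).
have gE s : g s = G (x0 + (w0 + s *: e0)) by rewrite /g addrA.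
have Mna : 0 < M * nu00 * a by rewrite !mulr_gt0.
have a20 : 0 <= a / 2 by rewrite divr_ge0// ltW.
have gp : 0 <= g (a / 2).
  rewrite gE; have := Gs (a / 2); rewrite ger0_norm// lexx => /(_ isT).
  move: w0n; rewrite !ler_norml => /andP[? ?] /andP[? ?]; lra.
have gm : g (- (a / 2)) <= 0.
  rewrite gE; have := Gs (- (a / 2)); rewrite normrN ger0_norm// lexx => /(_ isT).
  move: w0n; rewrite !ler_norml => /andP[? ?] /andP[? ?]; lra.
have [| | |s] := @IVT R g (- (a / 2)) (a / 2) 0.
- by rewrite ge0_cp.
- exact/continuous_subspaceT/continuous_chart_fun_segment.
- by rewrite ge_min gm le_max gp orbT.
rewrite in_itv/= -ler_norml gE => sa Gxs; exists (x0 + (w0 + s *: e0)); split => //.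
  by rewrite wE; exact: wa.
apply/rowP => i; rewrite !mxE liftK eq_sym (negbTE (neq_lift _ _)) andbF mulr0 addr0 !mxE.
by rewrite addrC subrK.
Qed.

(** The upper bound sees the cap as a Lipschitz graph over a cube of half-side a; the lower one uses
    that its projection covers a cube of half-side k a. *)
Lemma hausdorff_cap : exists cl cu r1 : R, [/\ 0 < cl, 0 < cu, 0 < r1 &
  forall a, 0 < a < r1 ->
    [/\ measurable (boundary_cap Omega x0 a),
      ((cl * a ^+ n.+1)%:E <= hausdorff n.+1 (boundary_cap Omega x0 a))%E &
      (hausdorff n.+1 (boundary_cap Omega x0 a) <= (cu * a ^+ n.+1)%:E)%E]].
Proof.
pose Lip := (2 / nu00 + 1) * n.+2%:R.
have Lip0 : 0 <= Lip by rewrite mulr_ge0// addr_ge0// divr_ge0// ltW.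
have [cp cp0 projP] := @hausdorff_ge_projection R n.+1.
have [cu cu0 lipP] := @hausdorff_lipschitz_graph_le R n.+1 _ Lip0.
pose k := nu00 / 8 / n.+2%:R; have k0 : 0 < k by rewrite !divr_gt0.
have L1 : 0 < L + 1 by rewrite ltr_wpDl.
(* Small enough for the chart and for L a <= M nu00 / 8, with L + 1 in case L = 0. *)
pose r1 := Num.min r (M * nu00 / 8 / (L + 1)).
exists (cp * (2 * k) ^+ n.+1), cu, r1.
split=> // [||a /andP[a0]].
- by rewrite mulr_gt0// exprn_gt0// mulr_gt0.
- by rewrite lt_min r0/=; apply: divr_gt0 => //; rewrite divr_gt0// mulr_gt0.
rewrite lt_min (ltr_pdivlMr _ _ L1) => /andP[ar aL].
have {}aL : L * a <= M * nu00 / 8 by lra.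
set E := boundary_cap Omega x0 a.
have mE : measurable E.
  apply: measurableI.
    apply: measurableD; first by apply: closed_measurable_rV; exact: closed_closure.
    by apply: open_measurable_rV; exact: open_interior.
  by apply: closed_measurable_rV; exact: closed_enorm_ball.
have EG x : E x -> G x = 0.
  by move=> [bx xa]; apply/G_boundary => //; exact: le_lt_trans ar.
split => //.
  have ka : 0 <= k * a by rewrite mulr_ge0 ?(ltW a0) ?(ltW k0).
  have := projP E (cube (rV_behead x0) (k * a)) (measurable_cube _ _).
  rewrite (leb_cube _ ka) -EFinM.
  rewrite mulrA exprMn mulrA; apply=> y cy.
  have [x [Gx xa <-]] := graph_exists a0 aL cy.
  by exists x => //; split => //; apply/G_boundary => //; exact: le_lt_trans ar.
apply: (lipP E (rV_behead x0)) => // [x [_ xa] i|x y Ex Ey].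
  rewrite !mxE; have := coord_le_enorm (x - x0) (lift ord0 i); rewrite !mxE.
  by move/le_trans; apply.
have [[_ xa] [_ ya]] := (Ex, Ey).
have := graph_lipschitz aL (EG _ Ey) (EG _ Ex) ya xa.
by rewrite (_ : rV_behead (x - y) = rV_behead x - rV_behead y)//; apply/rowP => i; rewrite !mxE.
Qed.

End cap.

(** * The transport-invariant profile *)

Section class_C_vector.
Context {R : realType} {V : normedModType R} {d : nat}.
Implicit Types X U : V -> 'rV[R]_d.

Definition of_class_C_rV k X := forall i, of_class_C k (fun z => X z ord0 i).

Lemma of_class_C_rV_linear k X : (forall (a : R) u v, X (a *: u + v) = a *: X u + X v) ->
  (forall i, continuous (fun z => X z ord0 i)) -> of_class_C_rV k X.
Proof.
move=> linX cX i; pose F z := X z ord0 i.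
have lin : linear_for *:%R (F : V -> R^o) by move=> a u v; rewrite /F linX !mxE.
pose FL : {linear V -> R} := HB.pack F (GRing.isLinear.Build R V R *:%R F lin).
by apply: (@of_class_C_linear R V k FL); exact: cX.
Qed.

Lemma of_class_C_rV_cst k (x : 'rV[R]_d) : of_class_C_rV k (fun=> x).
Proof. by move=> i; exact: of_class_C_cst. Qed.

Lemma of_class_C_rVB k X (x : 'rV[R]_d) :
  of_class_C_rV k X -> of_class_C_rV k (fun z => X z - x).
Proof.
move=> CX i; have := of_class_CD (CX i) (of_class_C_cst k (- x ord0 i)).
by congr of_class_C; apply/funext => z; rewrite !mxE.
Qed.

Lemma of_class_C_dotp k X U : of_class_C_rV k X -> of_class_C_rV k U ->
  of_class_C k (fun z => dotp (X z) (U z)).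
Proof.
move=> CX CU; rewrite (_ : (fun z => _) =
    \sum_(i < d) ((fun z => X z ord0 i) * (fun z => U z ord0 i))); last first.
  by apply/funext => z; rewrite fct_sumE.
by elim/big_ind: _ => [|F G|i _]; [exact: of_class_C_cst|exact: of_class_CD|
  exact: of_class_CM].
Qed.

End class_C_vector.

Section profile.
Context {R : realType} {d : nat}.
Variables (c x0 nu t : 'rV[R]_d) (rho : R).
Implicit Types (x v w : 'rV[R]_d) (s : R).

(** A fast grazing velocity: tangential speed 1/s, outward normal speed s. *)
Definition drift s : 'rV[R]_d := s^-1 *: t + s *: nu.

Lemma dotp_drift s w : dotp (drift s) w = s^-1 * dotp t w + s * dotp nu w.
Proof. by rewrite dotpDl !dotpZl. Qed.

(* The component of the angular momentum of (x - x0, v) in the plane of nu and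
   t, rescaled: like v, it is invariant under x |-> x + h v. *)
Definition shear s x v : R :=
  s ^- 3 * (dotp (x - x0) nu * dotp v t - dotp (x - x0) t * dotp v nu).

(** Nonpositive on the enclosing ball, so this cutoff is 1 on the closure of Omega; it only supplies
    compact support in x. *)
Definition space_arg x : R := dotp (x - c) (x - c) - rho ^+ 2.

(** Squares keep both arguments polynomial. The cutoffs equal 1 where [shear]^2 <= 1/2, respectively
    |v - drift s| <= s / sqrt 8, and vanish from |[shear]| = 1, respectively |v - drift s| = s / 2,
    on. *)
Definition shear_arg s x v : R := 2 * shear s x v ^+ 2 - 1.

Definition velocity_arg s v : R := 8 * dotp (v - drift s) (v - drift s) / s ^+ 2 - 1.

(* The exponential compensates the Gaussian weight at v = drift s. *)
Definition amplitude s : R :=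
  Num.sqrt (s ^- (3 * d) * expR (dotp (drift s) (drift s) / 2)).

Definition profile s x v : R := amplitude s * cutoff (space_arg x) *
  (cutoff (shear_arg s x v) * cutoff (velocity_arg s v)).

(** Stated along arbitrary smooth maps X and U: the two projections give joint smoothness, the
    identity and a constant give smoothness in x for frozen v. *)
Lemma of_class_C_profile {V : normedModType R} k s (X U : V -> 'rV[R]_d) :
  of_class_C_rV k X -> of_class_C_rV k U ->
  of_class_C k (fun z => profile s (X z) (U z)).
Proof.
move=> CX CU.
have CC (a : R) : of_class_C k (fun _ : V => a) by exact: of_class_C_cst.
have CM F H : of_class_C k F -> of_class_C k H -> of_class_C k (fun z : V => F z * H z).
  exact: of_class_CM.
have CB F H : of_class_C k F -> of_class_C k H -> of_class_C k (fun z : V => F z - H z).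
  move=> CF CH; have := of_class_CD CF (of_class_CM (of_class_C_cst k (-1)) CH).
  by congr of_class_C; apply/funext => z; rewrite -[H z]mul1r -mulNr.
have CT F : of_class_C k F -> of_class_C k (fun z : V => cutoff (F z)).
  exact: of_class_C_cutoff.
have CS : of_class_C k (fun z => shear s (X z) (U z)).
  rewrite /shear; apply: (CM _ _ (CC _)); apply: (CB _ _); apply: (CM _ _); apply: of_class_C_dotp => //;
    solve [exact: of_class_C_rVB|exact: of_class_C_rV_cst].
rewrite /profile; apply: (CM _ _).
  apply: (CM _ _ (CC _)); rewrite /space_arg; apply: (CT _); apply: (CB _ _ _ (CC _)).
  by apply: of_class_C_dotp; exact: of_class_C_rVB.
rewrite /shear_arg /velocity_arg; apply: (CM _ _); apply: (CT _); apply: (CB _ _ _ (CC _)).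
  by apply: (CM _ _ (CC _)); exact: (CM _ _ CS CS).
apply: (CM _ _ _ (CC _)); apply: (CM _ _ (CC _)).
by apply: of_class_C_dotp; exact: of_class_C_rVB.
Qed.

Lemma of_class_C_rV_fst k : of_class_C_rV k (fst : 'rV[R]_d * 'rV[R]_d -> _).
Proof.
apply: of_class_C_rV_linear => // i z.
apply: (@continuous_comp _ _ _ fst (fun x : 'rV[R]_d => x ord0 i)); first exact: cvg_fst.
exact: coord_continuous.
Qed.

Lemma of_class_C_rV_snd k : of_class_C_rV k (snd : 'rV[R]_d * 'rV[R]_d -> _).
Proof.
apply: of_class_C_rV_linear => // i z.
apply: (@continuous_comp _ _ _ snd (fun x : 'rV[R]_d => x ord0 i)); first exact: cvg_snd.
exact: coord_continuous.
Qed.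

Lemma of_class_C_rV_id k : of_class_C_rV k (id : 'rV[R]_d -> _).
Proof. by apply: of_class_C_rV_linear => // i; exact: coord_continuous. Qed.

Lemma compact_enorm_ball (x : 'rV[R]_d) (a : R) : compact [set y : 'rV[R]_d | enorm (y - x) <= a].
Proof.
apply: bounded_closed_compact; last exact: closed_enorm_ball.
exists (a + enorm x); split; first exact: num_real.
move=> M aM y /= yx; apply: le_trans (norm_le_enorm _) (le_trans _ (ltW aM)).
by rewrite -lerBlDr; apply: le_trans (enorm_ler _ _) yx.
Qed.

Lemma cutoff_neq0 (u : R) : cutoff u != 0 -> u < 1.
Proof. by move=> u0; rewrite ltNge; apply: contraNN u0 => /cutoff_ge1 ->. Qed.

Lemma velocity_arg_lt1 s v : 0 < s -> (velocity_arg s v < 1) = (enorm (v - drift s) < s / 2).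
Proof.
move=> s0; rewrite /velocity_arg ltrBlDr ltr_pdivrMr ?exprn_gt0//.
rewrite -[RHS](ltr_pXn2r (ltn0Sn 1)) ?nnegrE ?enorm_ge0 ?divr_ge0 ?(ltW s0)//.
rewrite sqr_enorm; move: (dotp _ _) => a; rewrite exprMn exprVn.
by apply/idP/idP; lra.
Qed.

Lemma space_arg_lt1 x : space_arg x < 1 -> enorm (x - c) <= `|rho| + 1.
Proof.
rewrite /space_arg -sqr_enorm => H.
rewrite -(ler_pXn2r (ltn0Sn 1)) ?nnegrE ?enorm_ge0 ?addr_ge0//.
have := normr_ge0 rho; rewrite sqrrD real_normK ?num_real// => r0.
by rewrite expr1n; lra.
Qed.

Lemma profile_neq0 s x v : profile s x v != 0 ->
  [/\ space_arg x < 1, shear_arg s x v < 1 & velocity_arg s v < 1].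
Proof.
have F (a b e f : R) : a * b * (e * f) != 0 -> [/\ b != 0, e != 0 & f != 0].
  by rewrite !mulf_eq0 !negb_or => /andP[/andP[_ ->] /andP[-> ->]].
by move=> /F[/cutoff_neq0 ? /cutoff_neq0 ? /cutoff_neq0 ?].
Qed.

Lemma Cc_infty_profile s : 0 < s -> Cc_infty (fun z : 'rV[R]_d * 'rV[R]_d => profile s z.1 z.2).
Proof.
move=> s0; split=> [k|].
  by apply: of_class_C_profile; [exact: of_class_C_rV_fst|exact: of_class_C_rV_snd].
pose K := [set x : 'rV[R]_d | enorm (x - c) <= `|rho| + 1] `*`
          [set v : 'rV[R]_d | enorm (v - drift s) <= s].
have cK : compact K by apply: compact_setX; exact: compact_enorm_ball.
apply: (subclosed_compact (@closed_closure _ _) cK).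
have clK : closed K by apply: compact_closed => //; exact: norm_hausdorff.
rewrite ((closure_id _).1 clK); apply: closureS => -[x v] /=.
move=> /profile_neq0[xc _].
rewrite velocity_arg_lt1// => vs; split => /=; first exact: space_arg_lt1.
by apply: le_trans (ltW vs) _; rewrite ler_pdivrMr// ler_peMr ?ltW// ltr1n.
Qed.

Lemma profile_space x v s : enorm (x - c) <= rho -> profile s x v =
  amplitude s * (cutoff (shear_arg s x v) * cutoff (velocity_arg s v)).
Proof.
move=> xc; rewrite /profile [cutoff (space_arg x)]cutoff_le0 ?mulr1//.
rewrite subr_le0 -sqr_enorm.
by rewrite lerXn2r ?nnegrE ?enorm_ge0 ?(le_trans (enorm_ge0 _) xc).
Qed.

Section transport.
Variables (Omega : set 'rV[R]_d).
Hypothesis oOmega : open Omega.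
Hypothesis ball : forall x, Omega x -> enorm (x - c) <= rho.

(** A short segment from x in direction v stays in the ball, where the spatial cutoff is 1, and
    [shear] does not change along it because its increment is a multiple of <v, nu> <v, t> - <v, t>
    <v, nu>. *)
Lemma transport_profile s x v : Omega x -> transport (profile s) x v = 0.
Proof.
move=> Ox; have df : differentiable (fun y => profile s y v) x.
  have [] := @of_class_C_profile _ 1 s id (fun=> v) (of_class_C_rV_id 1) (of_class_C_rV_cst 1 v).
  by [].
rewrite /transport dotpC -derive_grad//.
suff D : is_derive x v (fun y => profile s y v) 0 by exact: (@derive_val _ _ _ _ _ _ _ D).
apply/(is_derive_line (fun y => profile s y v)).
apply: (@near_eq_is_derive _ _ _ (cst (profile s x v))).
have [a a0 aO] : exists2 a : R, 0 < a & forall y, enorm (y - x) < a -> Omega y.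
  by apply/nbhs_enormP; exact: open_nbhs_nbhs.
near=> h.
have Oy : Omega (h *: v + x).
  apply: aO; rewrite addrK enormZ; apply: (@le_lt_trans _ _ (`|h| * (enorm v + 1))).
    by rewrite ler_wpM2l// lerDl.
  rewrite -ltr_pdivlMr ?ltr_wpDl ?enorm_ge0//; near: h; apply/nbhs_ballP.
  exists (a / (enorm v + 1)) => /=; first by rewrite divr_gt0// ltr_wpDl// enorm_ge0.
  by move=> y; rewrite -ball_normE /ball_/= sub0r normrN.
have shearE : shear s (h *: v + x) v = shear s x v.
  by rewrite /shear -[h *: v + x - x0]addrA !dotpDl !dotpZl; ring.
apply: (etrans (@profile_space x v s (ball Ox))); apply/esym.
apply: (etrans (@profile_space (h *: v + x) v s (ball Oy))).
by rewrite /shear_arg shearE.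
Unshelve. all: by end_near. Qed.

End transport.

Section velocity_gradient.
Variables (s : R) (x : 'rV[R]_d).

Let is_derive_cutoff_quadratic (a b e : R) :
  is_derive (0 : R) (1 : R) (fun h => cutoff (e + b * h + a * h ^+ 2)) (dcutoff e * b).
Proof.
pose p : {poly R} := e%:P + b *: 'X + a *: 'X^2.
have pE : p^`().[0] = b by rewrite /p !poly.derivE !hornerE; ring.
have hE h : p.[h] = e + b * h + a * h ^+ 2 by rewrite /p !hornerE.
rewrite (_ : (fun h : R => _) = cutoff \o horner p).
  have -> : e = p.[0] by rewrite hE mulr0 expr0n mulr0 !addr0.
  rewrite -[in dcutoff _ * _]pE; apply: is_derive_comp_line.
  exact: is_derive_cutoff.
by apply/funext => h /=; rewrite hE.
Qed.

(** Along a line in v both cutoff arguments are quadratic polynomials: [shear] is linear in v, and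
    its increment in direction w is [shear s x w]. *)
Lemma derive_profile v w : 'D_w (profile s x) v = amplitude s * cutoff (space_arg x) *
  (dcutoff (shear_arg s x v) * (4 * shear s x v * shear s x w) * cutoff (velocity_arg s v) +
   cutoff (shear_arg s x v) *
     (dcutoff (velocity_arg s v) * (16 * dotp (v - drift s) w / s ^+ 2))).
Proof.
apply: derive_val; apply/(is_derive_line (profile s x)).
have D1 : is_derive (0 : R) (1 : R) (fun h : R => cutoff (shear_arg s x (h *: w + v)))
    (dcutoff (shear_arg s x v) * (4 * shear s x v * shear s x w)).
  rewrite (_ : (fun h : R => _) = fun h => cutoff (shear_arg s x v +
      4 * shear s x v * shear s x w * h + 2 * shear s x w ^+ 2 * h ^+ 2)).
    exact: is_derive_cutoff_quadratic.
  apply/funext => h; congr cutoff.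
  by rewrite /shear_arg /shear !dotpDl !dotpZl; ring.
have D2 : is_derive (0 : R) (1 : R) (fun h : R => cutoff (velocity_arg s (h *: w + v)))
    (dcutoff (velocity_arg s v) * (16 * dotp (v - drift s) w / s ^+ 2)).
  rewrite (_ : (fun h : R => _) = fun h => cutoff (velocity_arg s v +
      16 * dotp (v - drift s) w / s ^+ 2 * h + 8 * dotp w w / s ^+ 2 * h ^+ 2)).
    exact: is_derive_cutoff_quadratic.
  apply/funext => h; congr cutoff.
  rewrite /velocity_arg -[h *: w + v - _]addrA !(dotpDl (h *: w)) !(dotpDr (h *: w)).
  by rewrite !dotpZl !dotpZr (dotpC w (v - _)); ring.
have := is_deriveZ (amplitude s * cutoff (space_arg x)) (is_deriveM D1 D2).
move=> D; apply: (is_derive_eq D).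
rewrite scale0r add0r.
rewrite /GRing.scale/=; move: (amplitude s * _) => A.
move: (dcutoff _) (cutoff _) (dcutoff _) (cutoff _) (4 * _ * _) (16 * _ / _) => *.
ring.
Qed.

End velocity_gradient.

End profile.

Section profile_estimates.
Context {R : realType} {d : nat}.
Variables (Omega : set 'rV[R]_d) (c x0 nu t : 'rV[R]_d) (rho : R).
Hypothesis touch : touching_ball Omega c x0 nu rho.
Hypotheses (t1 : dotp t t = 1) (nut : dotp nu t = 0).
Implicit Types (x v w : 'rV[R]_d) (s : R).

Local Notation drift := (drift nu t).
Local Notation shear := (shear x0 nu t).
Local Notation shear_arg := (shear_arg x0 nu t).
Local Notation velocity_arg := (velocity_arg nu t).
Local Notation amplitude := (amplitude nu t).
Local Notation f := (profile c x0 nu t rho).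

Let rho0 : 0 < rho. Proof. by case: touch. Qed.
Let nu1 : dotp nu nu = 1. Proof. by case: touch. Qed.
Let enu : enorm nu = 1. Proof. by rewrite /enorm nu1 sqrtr1. Qed.
Let et : enorm t = 1. Proof. by rewrite /enorm t1 sqrtr1. Qed.

Lemma amplitude_sqr s : 0 < s ->
  amplitude s ^+ 2 = s ^- (3 * d) * expR (dotp (drift s) (drift s) / 2).
Proof. by move=> s0; rewrite sqr_sqrtr// mulr_ge0 ?expR_ge0// invr_ge0 exprn_ge0// ltW. Qed.

Lemma enorm_drift_le s : 0 < s <= 1 -> enorm (drift s) <= s^-1 + s.
Proof.
move=> /andP[s0 s1]; apply: le_trans (enormD _ _) _.
by rewrite !enormZ et enu !mulr1 !gtr0_norm ?invr_gt0.
Qed.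

Lemma near_drift s v : 0 < s <= 1 -> enorm (v - drift s) <= s / 2 ->
  [/\ s^-1 / 2 <= dotp v t, s / 2 <= dotp v nu <= 3 / 2 * s & enorm v <= 3 / s].
Proof.
move=> /andP[s0 s1] vs; have sV : s <= s^-1.
  by rewrite (le_trans s1)// invf_ge1.
have vE : v = drift s + (v - drift s) by rewrite addrC subrK.
have Ht := dotp_norm_le (v - drift s) t; have Hn := dotp_norm_le (v - drift s) nu.
rewrite et mulr1 in Ht; rewrite enu mulr1 in Hn.
move/(le_trans)/(_ vs): Ht; move/(le_trans)/(_ vs): Hn.
rewrite !ler_norml => /andP[n1 n2] /andP[r1 r2].
move: r1 r2 n1 n2; rewrite !(dotpDl v) !dotpNl !dotp_drift t1 nu1 nut (dotpC t) nut.
rewrite !mulr0 !mulr1 addr0 add0r => r1 r2 n1 n2.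
split; [lra|apply/andP; split; lra|].
rewrite {1}vE; apply: le_trans (enormD _ _) _.
have := @enorm_drift_le s; rewrite s0 s1 => /(_ isT).
by move: (enorm _) (enorm _) vs => p q *; lra.
Qed.

Definition gauss_cst : R := (2 * pi) `^ (- (d%:R / 2)).

Lemma gauss_cst_gt0 : 0 < gauss_cst.
Proof. by rewrite powR_gt0// mulr_gt0// pi_gt0. Qed.

Lemma gauss_density_ge0 v : 0 <= gauss_density v.
Proof. by rewrite mulr_ge0 ?expR_ge0 ?powR_ge0. Qed.

(** With z = v - drift s, the exponents differ by <drift s, z> + |z|^2 / 2. The first term is at
    most (1/s + s) s / 2 <= 1 and the second at most 1/2, so 2 is a safe bound. *)
Lemma gauss_amplitude s v : 0 < s <= 1 -> enorm (v - drift s) <= s / 2 ->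
  gauss_cst * expR (- 2) * s ^- (3 * d) <= amplitude s ^+ 2 * gauss_density v <=
  gauss_cst * expR 2 * s ^- (3 * d).
Proof.
move=> s01 vs; have /andP[s0 s1] := s01; rewrite amplitude_sqr// /gauss_density -/gauss_cst.
have vE : v = drift s + (v - drift s) by rewrite addrC subrK.
rewrite (_ : _ * _ * (_ * _) = gauss_cst * (expR (dotp (drift s) (drift s) / 2) *
  expR (- (dotp v v / 2))) * s ^- (3 * d)); last by ring.
rewrite -expRD !ler_pM2r ?invr_gt0 ?exprn_gt0// !ler_pM2l ?gauss_cst_gt0// !ler_expR.
rewrite [in - (dotp v v / 2)]vE; move: vs (enorm_drift_le s01).
move: (v - drift s) => z; move: (drift s) => y zs ys.
rewrite !dotpDl !dotpDr (dotpC z y) -!sqr_enorm.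
have := le_trans (dotp_norm_le y z) (ler_pM (enorm_ge0 _) (enorm_ge0 _) ys zs).
have -> : (s^-1 + s) * (s / 2) = (1 + s ^+ 2) / 2 by field; rewrite gt_eqF.
have : s ^+ 2 <= 1 by rewrite expr_le1// ltW.
have : enorm z ^+ 2 <= s ^+ 2.
  rewrite lerXn2r ?nnegrE ?enorm_ge0 ?(ltW s0)//; apply: le_trans zs _; lra.
have := sqr_ge0 (enorm z); move: (enorm z ^+ 2) (enorm y ^+ 2) (s ^+ 2) => a b e ? ? ?.
by rewrite ler_norml => /andP[? ?]; apply/andP; split; lra.
Qed.

(** With m = |x - x0| and X = <x - x0, nu>, the support conditions give - X <= 2 s^4 + 3 m s^2 and
    m^2 <= - 2 rho X, hence m^2 <= 4 rho s^4 + 6 rho m s^2. This fails for m > C1 s^2; inserting m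
    <= C1 s^2 into the first bound yields C2. *)
Let C1 := 6 * rho + 1.
Let C2 := 2 + 3 * C1.
Let C1_gt0 : 0 < C1. Proof. by rewrite addr_gt0// mulr_gt0. Qed.
Let C2_gt0 : 0 < C2. Proof. by rewrite addr_gt0// mulr_gt0. Qed.

Lemma shear_arg_lt1 s x v : shear_arg s x v < 1 -> `|shear s x v| <= 1.
Proof.
rewrite /shear_arg => H; rewrite -(ler_pXn2r (ltn0Sn 1)) ?nnegrE//.
by rewrite real_normK ?num_real// expr1n; lra.
Qed.

(* The support condition |shear| <= 1 cuts a cap off the enclosing ball, whose
   curvature bounds the tangential extent of the cap. *)
Lemma profile_support s x v : 0 < s <= 1 -> closure Omega x ->
  shear_arg s x v < 1 -> enorm (v - drift s) <= s / 2 ->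
  enorm (x - x0) <= C1 * s ^+ 2 /\ `|dotp (x - x0) nu| <= C2 * s ^+ 4.
Proof.
move=> s01 cx /shear_arg_lt1 sh vs; have /andP[s0 s1] := s01.
have [vt /andP[vn0 vn] _] := near_drift s01 vs.
have zn := touching_ball_dotp touch cx.
have := dotp_norm_le (x - x0) t; rewrite et mulr1.
move: sh; rewrite /shear -(ler_pM2l (exprn_gt0 3 s0)) -{1}(gtr0_norm (exprn_gt0 3 s0)).
rewrite -normrM mulrA mulfV ?gt_eqF ?exprn_gt0// mul1r mulr1.
have := enorm_ge0 (x - x0); move: zn.
move: (enorm (x - x0)) (dotp (x - x0) nu) (dotp (x - x0) t) => m X Y zn m0.
rewrite !ler_norml => /andP[H _] /andP[Y1 Y2].
have X0 : X <= 0.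
  by apply: le_trans zn _; rewrite oppr_le0 divr_ge0 ?sqr_ge0// mulr_ge0// ltW.
have m2 : m ^+ 2 <= 2 * rho * - X.
  move: zn; rewrite -lerN2 opprK ler_pdivrMr ?mulr_gt0//; lra.
have B1 : - X * (s^-1 / 2) <= - X * dotp v t by rewrite ler_wpM2l// oppr_ge0.
have B2 : - m * (3 / 2 * s) <= Y * dotp v nu.
  have vn00 : 0 <= dotp v nu by apply: le_trans vn0; rewrite divr_ge0// ltW.
  apply: (@le_trans _ _ (- m * dotp v nu)); last by rewrite ler_wpM2r.
  by rewrite !mulNr lerN2 ler_wpM2l.
(* The momentum bound reads - X <v, t> <= s^3 - Y <v, nu>, where <v, t> is at least 1/(2 s) and <v,
   nu> at most 3 s / 2. *)
have B3 : - X * (s^-1 / 2) <= s ^+ 3 + m * (3 / 2 * s) by lra.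
have B4 : - X <= 2 * s ^+ 4 + 3 * m * s ^+ 2.
  have : - X * (s^-1 / 2) * (2 * s) <= (s ^+ 3 + m * (3 / 2 * s)) * (2 * s).
    by rewrite ler_wpM2r// mulr_ge0// ltW.
  rewrite (_ : - X * (s^-1 / 2) * (2 * s) = - X); last by field; rewrite gt_eqF.
  by move/le_trans; apply; rewrite !exprS; lra.
have s20 : 0 < s ^+ 2 by rewrite exprn_gt0.
have mb : m <= C1 * s ^+ 2.
  rewrite leNgt; apply/negP => mC.
  have m2' : m ^+ 2 <= 4 * rho * s ^+ 4 + 6 * rho * (m * s ^+ 2).
    apply: le_trans m2 _.
    have : 2 * rho * - X <= 2 * rho * (2 * s ^+ 4 + 3 * m * s ^+ 2).
      by rewrite ler_wpM2l// mulr_ge0// ltW.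
    by move/le_trans; apply; lra.
  have E4 : s ^+ 4 = s ^+ 2 * s ^+ 2 by rewrite -exprD.
  have H1 : C1 * s ^+ 2 * m <= m ^+ 2 by rewrite expr2 ler_wpM2r// ltW.
  have H2 : C1 * s ^+ 2 * s ^+ 2 < m * s ^+ 2 by rewrite ltr_pM2r.
  have H3 : 0 < s ^+ 2 * s ^+ 2 by rewrite mulr_gt0.
  have H4 : 0 < rho * (s ^+ 2 * s ^+ 2) by rewrite mulr_gt0.
  by move: m2' H1 H2; rewrite E4 /C1; lra.
split => //; apply/andP; split; last first.
  by apply: le_trans X0 _; rewrite mulr_ge0 ?exprn_ge0 ?(ltW C2_gt0) ?(ltW s0).
rewrite lerNl; apply: le_trans B4 _.
have : m * s ^+ 2 <= C1 * s ^+ 2 * s ^+ 2 by rewrite ler_wpM2r// ltW.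
rewrite -mulrA -exprD => H'; rewrite /C2; lra.
Qed.

Lemma profile_sqr_le s x v : f s x v ^+ 2 <= amplitude s ^+ 2.
Proof.
rewrite /profile -mulrA exprMn ler_piMr ?sqr_ge0//.
have L (a : R) : 0 <= cutoff a <= 1 by rewrite cutoff_ge0 cutoff_le1.
have M (a b : R) : 0 <= a <= 1 -> 0 <= b <= 1 -> 0 <= a * b <= 1.
  by move=> /andP[? ?] /andP[? ?]; rewrite mulr_ge0// mulr_ile1.
have /andP[? ?] := M _ _ (L (space_arg c rho x)) (M _ _ (L (shear_arg s x v)) (L (velocity_arg s v))).
by rewrite expr_le1.
Qed.

Lemma grad_profile s x v i : grad (f s x) v ord0 i = 'D_(delta_mx ord0 i) (f s x) v.
Proof. by rewrite mxE. Qed.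

(** At and beyond its threshold a cutoff vanishes together with its derivative, so a single factor
    kills both the function and its gradient. *)
Lemma profile_outside s x v : 0 < s ->
  ~ (shear_arg s x v < 1 /\ enorm (v - drift s) <= s / 2) ->
  f s x v = 0 /\ grad (f s x) v = 0.
Proof.
move=> s0 out.
have H : cutoff (shear_arg s x v) = 0 /\ dcutoff (shear_arg s x v) = 0 \/
    cutoff (velocity_arg s v) = 0 /\ dcutoff (velocity_arg s v) = 0.
  have [sh|sh] := ltP (shear_arg s x v) 1; last by left; rewrite cutoff_ge1 ?dcutoff_ge1.
  right; suff V1 : 1 <= velocity_arg s v by rewrite cutoff_ge1 ?dcutoff_ge1.
  by rewrite leNgt velocity_arg_lt1//; apply/negP => /ltW vs; exact: out.
split; first by rewrite /profile; case: H => [[-> _]|[-> _]]; rewrite ?mul0r !mulr0.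
apply/rowP => i; rewrite grad_profile mxE derive_profile.
by case: H => [[-> ->]|[-> ->]]; rewrite !mul0r ?mulr0 ?mul0r addr0 mulr0.
Qed.

(** On the support a coordinate derivative of [shear] is at most s^-3 (C2 s^4 + C1 s^2) <= (C1 + C2)
    / s, and one of [velocity_arg] at most 16 (s/2) / s^2 = 8 / s: differentiation costs a factor
    1/s. *)
Lemma grad_profile_le : exists2 B : R, 0 <= B & forall s x v, 0 < s <= 1 ->
  closure Omega x -> shear_arg s x v < 1 -> enorm (v - drift s) <= s / 2 ->
  dotp (grad (f s x) v) (grad (f s x) v) <= amplitude s ^+ 2 * (B / s ^+ 2).
Proof.
have [D0 DD0] := @dcutoff_le R; pose D : R := `|D0|.
have DD u : `|dcutoff u| <= D by apply: le_trans (DD0 u) (ler_norm _).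
pose b : R := D * (4 * (C1 + C2) + 8).
have b0 : 0 <= b.
  rewrite /b; apply: mulr_ge0; first by rewrite /D normr_ge0.
  have := C1_gt0; have := C2_gt0; move: C1 C2 => p q *; lra.
exists (d%:R * b ^+ 2) => [|s x v s01 cx sh vs]; first by rewrite mulr_ge0// sqr_ge0.
have /andP[s0 s1] := s01.
have [z1 z2] := profile_support s01 cx sh vs.
have shear1 := shear_arg_lt1 sh.
have A0 : 0 <= amplitude s by exact: sqrtr_ge0.
have gi i : `|grad (f s x) v ord0 i| <= amplitude s * (b / s).
  rewrite grad_profile derive_profile normrM.
  have L (a : R) : `|cutoff a| <= 1 by rewrite ger0_norm ?cutoff_ge0// cutoff_le1.
  apply: ler_pM => //.
    by rewrite normrM ger0_norm// ler_piMr.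
  have di (u : 'rV[R]_d) : `|dotp u (delta_mx ord0 i)| <= enorm u.
    by rewrite dotp_delta coord_le_enorm.
  have S1 : `|shear s x (delta_mx ord0 i)| <= (C1 + C2) / s.
    rewrite /shear normrM ger0_norm ?invr_ge0 ?exprn_ge0 ?(ltW s0)//.
    rewrite ler_pdivrMl ?exprn_gt0//.
    rewrite (_ : s ^+ 3 * _ = (C1 + C2) * s ^+ 2); last by field; rewrite gt_eqF.
    apply: le_trans (ler_normB _ _) _; rewrite !normrM !(dotpC (delta_mx _ _)).
    have T1 : `|dotp (x - x0) nu| * `|dotp t (delta_mx ord0 i)| <= C2 * s ^+ 2.
      apply: (@le_trans _ _ (C2 * s ^+ 4 * 1)); first by rewrite ler_pM// -et.
      by rewrite mulr1 ler_pM2l// ler_wiXn2l// ltW.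
    have T2 : `|dotp (x - x0) t| * `|dotp nu (delta_mx ord0 i)| <= C1 * s ^+ 2.
      rewrite -[leRHS]mulr1 ler_pM// -?enu//.
      by apply: le_trans (dotp_norm_le _ _) _; rewrite et mulr1.
    by lra.
  have S2 : `|16 * dotp (v - drift s) (delta_mx ord0 i) / s ^+ 2| <= 8 / s.
    rewrite normrM normfV (ger0_norm (sqr_ge0 s)) normrM (ger0_norm (ler0n _ 16)).
    rewrite ler_pdivrMr ?exprn_gt0// (_ : 8 / s * s ^+ 2 = 16 * (s / 2)); last first.
      by field; rewrite gt_eqF.
    by rewrite ler_pM2l// (le_trans (di _)).
  have S3 : `|4 * shear s x v * shear s x (delta_mx ord0 i)| <= 4 * ((C1 + C2) / s).
    move: (shear s x v) (shear s x (delta_mx ord0 i)) shear1 S1 => p q p1 q1.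
    by rewrite !normrM (ger0_norm (ler0n _ 4)) -mulrA ler_pM2l// -[leRHS]mul1r ler_pM.
  have F (p q p' q' a b' m m' : R) : `|p| <= D -> `|a| <= m -> `|q| <= 1 -> `|q'| <= 1 ->
      `|p'| <= D -> `|b'| <= m' -> `|p * a * q + q' * (p' * b')| <= D * m * 1 + 1 * (D * m').
    move=> *; apply: le_trans (ler_normD _ _) _; rewrite !normrM.
    by rewrite lerD// !ler_pM// mulr_ge0.
  rewrite (_ : b / s = D * (4 * ((C1 + C2) / s)) * 1 + 1 * (D * (8 / s))); last first.
    by rewrite /b; field; rewrite gt_eqF.
  exact: F.
rewrite (_ : _ * (_ / _) = d%:R * (amplitude s * (b / s)) ^+ 2); last first.
  by field; rewrite gt_eqF.
rewrite /dotp mulr_natl -[X in _ *+ X]card_ord -sumr_const.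
apply: ler_sum => i _; rewrite -expr2 -real_normK ?num_real//.
by rewrite ler_pXn2r ?nnegrE// mulr_ge0// divr_ge0// ltW.
Qed.

End profile_estimates.

(** * Energy *)

Section negative_norm.
Context {R : realType} {d : nat}.

Lemma gauss_int0 (g : 'rV[R]_d -> R) : (forall v, g v = 0) -> gauss_int g = 0%E.
Proof. by move=> g0; apply: integral0_eq => v _; rewrite g0 mul0r. Qed.

(** The set under the supremum is exactly {0}: the zero test function shows that it is not empty,
    which excludes the value -oo. *)
Lemma Hm1_norm0 : Hm1_norm (fun _ : 'rV[R]_d => 0 : R) = 0%E.
Proof.
rewrite /Hm1_norm; set S := [set z | _].
have -> : S = [set 0%E].
  apply/seteqP; split => [_ [phi [G [_ _ ->]]]|_ ->].
    by rewrite /= gauss_int0// => v; rewrite mul0r.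
  have dot0 (u : 'rV[R]_d) : dotp 0 u = 0 by rewrite -(scale0r 0) dotpZl mul0r.
  have H0 : H1_sqnorm (fun _ : 'rV[R]_d => 0 : R) (fun=> 0) = 0%E.
    by apply: gauss_int0 => v; rewrite dot0 expr0n addr0.
  exists (fun=> 0), (fun=> 0); split.
  - split; [exact: measurable_cst|exact: measurable_cst| |by rewrite H0].
    move=> phi i _; rewrite /Rintegral !integral0_eq ?oppr0//=.
      by move=> v _; rewrite mxE mul0r.
    by move=> v _; rewrite mul0r.
  - by rewrite H0.
  - by rewrite gauss_int0// => v; rewrite mul0r.
exact: ereal_sup1.
Qed.

End negative_norm.

Section energy_estimate.
Context {R : realType} {n : nat}.
Variables (Omega : set 'rV[R]_n.+2) (c x0 nu t : 'rV[R]_n.+2) (rho : R).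
Hypothesis touch : touching_ball Omega c x0 nu rho.
Hypotheses (t1 : dotp t t = 1) (nut : dotp nu t = 0) (nu0 : 0 < nu ord0 ord0).
Implicit Types (x v w : 'rV[R]_n.+2) (s : R).

Local Notation drift := (drift nu t).
Local Notation shear_arg := (shear_arg x0 nu t).
Local Notation velocity_arg := (velocity_arg nu t).
Local Notation amplitude := (amplitude nu t).
Local Notation f := (profile c x0 nu t rho).
Local Notation d := n.+2.
Local Notation C1 := (6 * rho + 1).
Local Notation C2 := (2 + 3 * (6 * rho + 1)).

Let rho0 : 0 < rho. Proof. by case: touch. Qed.

Lemma leb_cube_drift s : 0 < s -> leb R d (cube (drift s) (s / 2)) = (s ^+ d)%:E.
Proof.
move=> s0; rewrite leb_cube; last by rewrite divr_ge0// ltW.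
by rewrite mulrCA mulfV ?mulr1.
Qed.

Lemma notin_cube s v : ~ cube (drift s) (s / 2) v -> ~ enorm (v - drift s) <= s / 2.
Proof.
move=> nc vs; apply: nc => i; have := coord_le_enorm (v - drift s) i.
by rewrite !mxE => /le_trans; apply.
Qed.

(** The velocity ball sits in a cube of volume s^d, and the gradient term contributes the factor
    s^-2. The second claim confines x to the slab for the outer integral. *)
Lemma H1_sqnorm_profile_le : exists2 B : R, 0 <= B & forall s x, 0 < s <= 1 ->
  closure Omega x ->
  (H1_sqnorm (f s x) (grad (f s x)) <= (B * (s ^- (3 * d) * s ^+ d / s ^+ 2))%:E)%E /\
  (~ (enorm (x - x0) <= C1 * s ^+ 2 /\ `|dotp (x - x0) nu| <= C2 * s ^+ 4) ->
    H1_sqnorm (f s x) (grad (f s x)) = 0%E).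
Proof.
have [b b0 bP] := grad_profile_le touch t1 nut.
pose k := @gauss_cst R d * expR 2.
have k0 : 0 < k by rewrite mulr_gt0 ?expR_gt0// gauss_cst_gt0.
exists ((1 + b) * k) => [|s x s01 cx]; first by rewrite mulr_ge0 ?addr_ge0// ltW.
have /andP[s0 s1] := s01.
have z v : ~ (shear_arg s x v < 1 /\ enorm (v - drift s) <= s / 2) ->
    (f s x v ^+ 2 + dotp (grad (f s x) v) (grad (f s x) v)) * gauss_density v = 0.
  move=> /(profile_outside c rho s0)[-> ->]; rewrite expr0n add0r.
  by rewrite -{1}(scale0r 0) dotpZl mul0r mul0r.
split; last first.
  move=> out; apply: integral0_eq => v _; congr EFin; apply: z => -[sh vs].
  by apply: out; exact: (profile_support touch t1 nut s01 cx sh vs).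
rewrite (_ : _ * (_ / _) = (1 + b) / s ^+ 2 * (k * s ^- (3 * d)) * s ^+ d); last first.
  by move: (s ^- (3 * d)) (s ^+ d) (s ^- 2) => p q r; ring.
rewrite EFinM -leb_cube_drift//.
have K0 : 0 <= (1 + b) / s ^+ 2 * (k * s ^- (3 * d)).
  apply: mulr_ge0; first by rewrite divr_ge0 ?addr_ge0 ?sqr_ge0.
  by apply: mulr_ge0; [exact: ltW|rewrite invr_ge0 exprn_ge0// ltW].
apply: integral_le_cst => //.
- exact: measurable_cube.
- by move=> v _; rewrite lee_fin mulr_ge0 ?gauss_density_ge0// addr_ge0 ?sqr_ge0 ?dotpvv_ge0.
- move=> v _ _; rewrite lee_fin.
  have [[sh vs]|out] := pselect (shear_arg s x v < 1 /\ enorm (v - drift s) <= s / 2);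
    last by rewrite z.
  have /andP[_ g2] := gauss_amplitude touch t1 s01 vs.
  have gb := bP _ _ _ s01 cx sh vs.
  have fa : f s x v ^+ 2 <= amplitude s ^+ 2 / s ^+ 2.
    apply: le_trans (profile_sqr_le _ _ _ _ _ _ _ _) _.
    by rewrite ler_peMr ?sqr_ge0// invf_ge1 ?exprn_gt0// expr_le1// ltW.
  apply: (@le_trans _ _ ((1 + b) / s ^+ 2 * (amplitude s ^+ 2 * gauss_density v))).
    rewrite mulrA ler_wpM2r ?gauss_density_ge0//.
    move: fa gb; set D := dotp _ _; move: (f s x v ^+ 2) => q.
    by move: (amplitude s ^+ 2) (s ^- 2) => A i *; lra.
  by rewrite ler_wpM2l// divr_ge0 ?addr_ge0 ?sqr_ge0.
- move=> v _ /notin_cube out; congr EFin; apply: z => -[_].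
  exact: out.
Qed.

Let slab s := [set x | cube (rV_behead x0) (C1 * s ^+ 2) (rV_behead x) /\
  `|dotp (x - x0) nu| <= C2 * s ^+ 4].

Let measurable_slab s : measurable (slab s).
Proof.
apply: measurableI.
  rewrite -[X in measurable X]setTI; apply: measurable_rV_behead => //.
  exact: measurable_cube.
apply: closed_measurable_rV.
rewrite [X in closed X](_ : _ = dotp nu @^-1` [set r | `|r - dotp nu x0| <= C2 * s ^+ 4]).
  apply: closed_comp; first by move=> x _; exact: continuous_dotpl.
  rewrite [X in closed X](_ : _ = `[dotp nu x0 - C2 * s ^+ 4, dotp nu x0 + C2 * s ^+ 4]%classic).
    exact: itv_closed.
  by apply/seteqP; split => r /=; rewrite in_itv/= ler_distl.
have E (x : 'rV[R]_d) : dotp (x - x0) nu = dotp nu x - dotp nu x0.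
  by rewrite dotpC dotpDr dotpNr.
by apply/seteqP; split => x; rewrite /= E.
Qed.

Let leb_slab s : 0 < s -> (leb R d (slab s) <=
  (2 * (C2 * s ^+ 4 / nu ord0 ord0) * (2 * (C1 * s ^+ 2)) ^+ n.+1)%:E)%E.
Proof.
move=> s0.
have C1_ge0 : 0 <= C1 by rewrite addr_ge0// mulr_ge0// ltW.
(* The first coordinate at which <x - x0, nu> vanishes over y; dividing by the first coordinate of
   nu turns the bound on <x - x0, nu> into one on the first coordinate of x. *)
pose g (y : 'rV[R]_n.+1) := - (dotp (rV_cons (0, y) - x0) nu / nu ord0 ord0).
apply: (@leb_slab_le R n.+1 (slab s) (rV_behead x0) g).
- by rewrite mulr_ge0// exprn_ge0// ltW.
- apply: divr_ge0; last exact: ltW.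
  by rewrite mulr_ge0 ?exprn_ge0 ?(ltW s0)// addr_ge0// mulr_ge0.
- exact: measurable_slab.
move=> x [cx nx]; split => //; rewrite ler_pdivlMr//.
rewrite -[X in _ * X](gtr0_norm nu0) -normrM; apply: le_trans nx.
rewrite (_ : (_ - _) * _ = dotp (x - x0) nu)//.
rewrite /g opprK mulrDl mulfVK ?gt_eqF//.
rewrite (_ : x - x0 = x ord0 ord0 *: delta_mx ord0 ord0 + (rV_cons (0, rV_behead x) - x0)).
  by rewrite [RHS]dotpDl dotpZl (dotpC (delta_mx _ _)) dotp_delta.
rewrite addrA; congr (_ - _); apply/rowP => i; rewrite !mxE eqxx/=.
have [j ->|->] := unliftP ord0 i.
  by rewrite eq_sym (negbTE (neq_lift _ _)) mulr0 add0r mxE.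
by rewrite eqxx mulr1 addr0.
Qed.

Lemma energy_profile_le : open Omega -> exists C : R, forall s, 0 < s <= 1 ->
  (energy Omega (f s) <= C%:E)%E.
Proof.
move=> oO; have [B B0 BP] := H1_sqnorm_profile_le.
exists (B * (2 * (C2 / nu ord0 ord0) * (2 * C1) ^+ n.+1)) => s s01.
have /andP[s0 s1] := s01.
have OO x : Omega x -> closure Omega x by move/subset_closure.
have -> : energy Omega (f s) = (\int[leb R d]_(x in Omega) H1_sqnorm (f s x) (grad (f s x)))%E.
  rewrite /energy [X in (_ + X)%E]integral0_eq ?adde0// => x Ox.
  rewrite (_ : transport (f s) x = fun=> 0); first by rewrite Hm1_norm0 expe2 mule0.
  apply/funext => v; apply: (@transport_profile R d c x0 nu t rho Omega) => //.
  by move=> y /OO cy; case: touch => _ _ _ _; exact.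
have B1 : 0 <= B * (s ^- (3 * d) * s ^+ d / s ^+ 2).
  apply: mulr_ge0 => //; apply: divr_ge0; last exact: sqr_ge0.
  by apply: mulr_ge0; rewrite ?invr_ge0 exprn_ge0// ltW.
apply: (@le_trans _ _ ((B * (s ^- (3 * d) * s ^+ d / s ^+ 2))%:E * leb R d (slab s))%E).
  apply: integral_le_cst.
  - exact: B1.
  - exact: measurable_slab.
  - move=> x _; apply: integral_ge0 => v _.
    by rewrite lee_fin mulr_ge0 ?gauss_density_ge0// addr_ge0 ?sqr_ge0 ?dotpvv_ge0.
  - by move=> x /OO cx _; have [] := BP s x s01 cx.
  - move=> x /OO cx nS; have [_ ->//] := BP s x s01 cx.
    move=> [z1 z2]; apply: nS; split => // i; rewrite !mxE.
    by have := coord_le_enorm (x - x0) (lift ord0 i); rewrite !mxE => /le_trans; apply.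
apply: le_trans (lee_pmul _ _ (le_refl _) (leb_slab s0)) _ => //.
rewrite -EFinM lee_fin le_eqVlt; apply/orP; left; apply/eqP.
(* 3 d = d + 2 + 2 (d - 1): velocity volume, one factor s^2 and tangential extent. The other s^2 of
   the thickness s^4 pays for the gradient. *)
have E : s ^+ (3 * d) = s ^+ d * s ^+ 2 * (s ^+ 2) ^+ n.+1.
  by rewrite -exprM -!exprD; congr (_ ^+ _); lia.
rewrite E [(2 * (_ * _)) ^+ _](_ : _ = (2 * C1) ^+ n.+1 * (s ^+ 2) ^+ n.+1); last first.
  by rewrite mulrA exprMn.
have X0 : (s ^+ 2) ^+ n.+1 != 0 by rewrite !expf_neq0// gt_eqF.
have Y0 : s ^+ d != 0 by rewrite expf_neq0// gt_eqF.
move: ((s ^+ 2) ^+ n.+1) (s ^+ d) ((2 * C1) ^+ n.+1) X0 Y0 => X Y Z X0 Y0.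
by field; rewrite X0 Y0 !gt_eqF.
Qed.

End energy_estimate.

(** * Trace *)

Section omega_weight.
Context {R : realType}.
Implicit Types p s m : R.

Lemma omega_weight_ge0 p s : 0 <= s -> 0 <= omega_weight p s.
Proof. by move=> s0; rewrite le_min s0 powR_ge0. Qed.

Lemma omega_weight_le p s m : 1 <= p -> 0 <= s -> s <= m -> omega_weight p s <= m `^ p.
Proof.
move=> p1 s0 sm; rewrite /omega_weight ge_min; apply/orP; right.
by apply: ge0_ler_powR; rewrite ?nnegrE ?(le_trans ler01 p1)// (le_trans s0 sm).
Qed.

(** For m <= 1 and p >= 1 one has m^p <= m, so m^p lies below both terms of the minimum. *)
Lemma omega_weight_ge p s m : 1 <= p -> 0 < m <= 1 -> m <= s -> m `^ p <= omega_weight p s.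
Proof.
move=> p1 m01 ms; have /andP[m0 m1] := m01; rewrite le_min; apply/andP; split.
  by apply: le_trans ms; exact: ge1r_powR.
by apply: ge0_ler_powR; rewrite ?nnegrE ?(le_trans ler01 p1)// ?(ltW m0)// (le_trans (ltW m0) ms).
Qed.

Lemma powR_split p s : 0 < s -> s `^ p = s ^+ 2 * s `^ (p - 2).
Proof.
move=> s0; rewrite -powR_mulrn ?ltW// -powRD; first by congr (_ `^ _); lra.
by rewrite (gt_eqF s0) implybT.
Qed.

(* The squared amplitude, the squared normal velocity, the volume of the
   velocity ball and the area of the boundary cap balance. *)
Lemma scaling_identity (n : nat) s : s != 0 ->
  s ^- (3 * n.+2) * s ^+ 2 * s ^+ n.+2 * (s ^+ 2) ^+ n.+1 = 1.
Proof.
move=> s0; rewrite {1}(_ : 3 * n.+2 = 2 + (n.+2 + 2 * n.+1))%N; last by lia.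
rewrite (exprD s 2) (exprD s n.+2) (exprM s 2).
move: (expf_neq0 2 s0) (expf_neq0 n.+2 s0) (expf_neq0 n.+1 (expf_neq0 2 s0)).
move: (s ^+ 2) (s ^+ n.+2) ((s ^+ 2) ^+ n.+1) => X Y Z X0 Y0 Z0.
by field; rewrite X0 Y0 Z0.
Qed.

Lemma powR_small p m : 0 < p -> 0 < m ->
  exists2 a : R, 0 < a & forall s, 0 < s < a -> s `^ p < m.
Proof.
move=> p0 m0; exists (m `^ p^-1) => [|s /andP[s0 sa]]; first exact: powR_gt0.
rewrite -[ltRHS](powRr1 (ltW m0)) -(@mulVf _ p) ?gt_eqF// powRrM.
by apply: gt0_ltr_powR => //; rewrite nnegrE ?powR_ge0// ltW.
Qed.

End omega_weight.

Section trace_estimate.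
Context {R : realType} {n : nat}.
Variables (Omega : set 'rV[R]_n.+2) (c x0 nu t : 'rV[R]_n.+2) (rho : R).
Hypothesis touch : touching_ball Omega c x0 nu rho.
Hypotheses (t1 : dotp t t = 1) (nut : dotp nu t = 0).
Implicit Types (x v w : 'rV[R]_n.+2) (s p : R).

Local Notation d := n.+2.
Local Notation drift := (drift nu t).
Local Notation shear := (shear x0 nu t).
Local Notation shear_arg := (shear_arg x0 nu t).
Local Notation velocity_arg := (velocity_arg nu t).
Local Notation amplitude := (amplitude nu t).
Local Notation f := (profile c x0 nu t rho).
Local Notation C1 := (6 * rho + 1).

Variables (M K r1 : R) (N : 'rV[R]_n.+2 -> 'rV[R]_n.+2).
Hypotheses (M1 : 1 <= M) (K0 : 0 <= K) (r1_gt0 : 0 < r1).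
Hypothesis normalP : forall x, boundary Omega x -> enorm (x - x0) < r1 ->
  [/\ outward_normal Omega x = (enorm (N x))^-1 *: N x, 1 <= enorm (N x),
      enorm (N x - M *: nu) <= K * enorm (x - x0) &
      `|dotp (x - x0) nu| <= K * enorm (x - x0) ^+ 2].

Let rho0 : 0 < rho. Proof. by case: touch. Qed.
Let M0 : 0 < M. Proof. exact: lt_le_trans M1. Qed.

Let trace_density p s x v : R :=
  f s x v ^+ 2 * omega_weight p `|dotp v (outward_normal Omega x)|.

Let trace_density_ge0 p s x v : 0 <= trace_density p s x v * gauss_density v.
Proof.
apply: mulr_ge0; last exact: gauss_density_ge0.
by apply: mulr_ge0; [exact: sqr_ge0|exact: omega_weight_ge0].
Qed.

(** |v| <= 3/s against |N x - M nu| <= K a s^2: the error is of order s, like M <v, nu>, and only a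
    small a makes it harmless in the lower bound. *)
Let normal_dev s x v a : 0 < s <= 1 -> boundary Omega x -> enorm (x - x0) < r1 ->
  enorm (x - x0) <= a * s ^+ 2 -> enorm (v - drift s) <= s / 2 ->
  `|dotp v (N x) - M * dotp v nu| <= 3 * K * a * s.
Proof.
move=> s01 bx xr xa vs; have /andP[s0 s1] := s01.
have [_ _ v3] := near_drift touch t1 nut s01 vs.
have [_ _ NM _] := normalP bx xr.
rewrite -dotpZr -dotpNr -dotpDr; apply: le_trans (dotp_norm_le _ _) _.
rewrite (_ : 3 * K * a * s = 3 / s * (K * (a * s ^+ 2))); last by field; rewrite gt_eqF.
apply: ler_pM; rewrite ?enorm_ge0//; apply: le_trans NM _.
by rewrite ler_wpM2l.
Qed.

Lemma gauss_trace_le p s x : 1 <= p -> 0 < s <= 1 -> boundary Omega x ->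
  (enorm (x - x0) <= C1 * s ^+ 2 -> enorm (x - x0) < r1 ->
   (gauss_int (trace_density p s x) <=
     (gauss_cst (R := R) (d := d) * expR 2 * s ^- (3 * d) *
      ((3 / 2 * M + 3 * K * C1) * s) `^ p * s ^+ d)%:E)%E) /\
  (~ enorm (x - x0) <= C1 * s ^+ 2 -> gauss_int (trace_density p s x) = 0%E).
Proof.
move=> p1 s01 bx; have /andP[s0 s1] := s01; have cx := bx.1.
have z v : ~ (shear_arg s x v < 1 /\ enorm (v - drift s) <= s / 2) ->
    trace_density p s x v * gauss_density v = 0.
  by move=> /(profile_outside c rho s0)[fz _]; rewrite /trace_density fz expr0n !mul0r.
split=> [xC xr|out]; last first.
  apply: integral0_eq => v _; congr EFin; apply: z => -[sh vs].
  by apply: out; have [] := profile_support touch t1 nut s01 cx sh vs.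
rewrite [X in (_ <= X)%E]EFinM -(leb_cube_drift nu t s0).
set k := _ * _ * _; have k0 : 0 <= k.
  apply: mulr_ge0; last exact: powR_ge0.
  apply: mulr_ge0; last by rewrite invr_ge0 exprn_ge0// ltW.
  by apply: mulr_ge0; [exact/ltW/gauss_cst_gt0|exact: expR_ge0].
apply: integral_le_cst.
- exact: k0.
- exact: measurable_cube.
- by move=> v _; rewrite lee_fin.
- move=> v _ _; rewrite lee_fin.
  have [[sh vs]|out] := pselect (shear_arg s x v < 1 /\ enorm (v - drift s) <= s / 2);
    last by rewrite z.
  have /andP[_ g2] := gauss_amplitude touch t1 s01 vs.
  have [_ /andP[vn0 vn] _] := near_drift touch t1 nut s01 vs.
  have nd := normal_dev s01 bx xr xC vs.
  have [nE N1 _ _] := normalP bx xr.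
  rewrite /trace_density mulrAC /k; apply: ler_pM.
  + by rewrite mulr_ge0 ?sqr_ge0 ?gauss_density_ge0.
  + exact: omega_weight_ge0.
  + apply: le_trans g2; rewrite ler_wpM2r ?gauss_density_ge0//.
    exact: profile_sqr_le.
  + apply: omega_weight_le => //; rewrite nE dotpZr normrM ger0_norm ?invr_ge0 ?enorm_ge0//.
    apply: (@le_trans _ _ `|dotp v (N x)|).
      by rewrite ler_piMl// invf_le1// (lt_le_trans ltr01).
    move: nd; rewrite !ler_norml => /andP[n1 n2].
    have : M * dotp v nu <= M * (3 / 2 * s) by rewrite ler_pM2l.
    have : M * (s / 2) <= M * dotp v nu by rewrite ler_pM2l.
    have : 0 <= M * s by rewrite mulr_ge0// ltW.
    move: (dotp v (N x)) (M * dotp v nu) n1 n2 => p' q *; apply/andP; split; lra.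
- move=> v _ /notin_cube out; congr EFin; apply: z => -[_].
  exact: out.
Qed.

(** On this smaller cap, with v within s / 8 of [drift s], both velocity-dependent cutoffs equal 1,
    so the profile is the full amplitude, and the normal velocity is at least s / 8. *)
Lemma gauss_trace_ge p s x : 1 <= p -> 0 < s <= 1 -> boundary Omega x ->
  enorm (x - x0) <= (12 * (K + 1))^-1 * s ^+ 2 -> enorm (x - x0) < r1 ->
  ((gauss_cst (R := R) (d := d) * expR (- 2) * s ^- (3 * d) * (s / 8) `^ p *
    (s / (4 * d%:R)) ^+ d)%:E <= gauss_int (trace_density p s x))%E.
Proof.
move=> p1 s01 bx xa xr; have /andP[s0 s1] := s01; have cx := bx.1.
(* Then K a + a = 1/12, which gives |[shear]| <= 1/2 and a normal error 3 K a s <= M s / 4, half of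
   the lower bound M s / 2 for M <v, nu>. *)
set a := (12 * (K + 1))^-1 in xa.
have K10 : 0 < K + 1 by rewrite ltr_wpDl.
have a0 : 0 < a by rewrite invr_gt0 mulr_gt0.
have aK : K * a + a = 12^-1 by rewrite /a; field; rewrite gt_eqF.
have Ka0 : 0 <= K * a by rewrite mulr_ge0// ltW.
have [nE N1 NM zn] := normalP bx xr.
have d0 : 0 < d%:R :> R by rewrite ltr0n.
have h0 : 0 <= s / (8 * d%:R) by rewrite divr_ge0 ?mulr_ge0// ltW.
rewrite (_ : s / (4 * d%:R) = 2 * (s / (8 * d%:R))); last by field; rewrite gt_eqF.
rewrite EFinM -(leb_cube (drift s) h0).
set k := _ * _ * _; have k0 : 0 <= k.
  apply: mulr_ge0; last exact: powR_ge0.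
  apply: mulr_ge0; last by rewrite invr_ge0 exprn_ge0// ltW.
  by apply: mulr_ge0; [exact/ltW/gauss_cst_gt0|exact: expR_ge0].
apply: integral_ge_cst => //.
- exact: measurable_cube.
- by move=> v _; rewrite lee_fin.
move=> v cv; rewrite lee_fin.
have v8 : enorm (v - drift s) <= s / 8.
  rewrite (_ : s / 8 = d%:R * (s / (8 * d%:R))); last by field; rewrite gt_eqF.
  by apply: enorm_le_sum => i; have := cv i; rewrite !mxE.
have vs : enorm (v - drift s) <= s / 2 by apply: le_trans v8 _; lra.
have /andP[g1 _] := gauss_amplitude touch t1 s01 vs.
have [vt /andP[vn0 vn] v3] := near_drift touch t1 nut s01 vs.
have nd := normal_dev s01 bx xr xa vs.
have s20 : 0 <= s ^+ 2 by exact: sqr_ge0.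
have sh : shear_arg s x v <= 0.
  have : `|shear s x v| <= 2^-1.
    rewrite /shear normrM ger0_norm ?invr_ge0 ?exprn_ge0 ?(ltW s0)//.
    rewrite ler_pdivrMl ?exprn_gt0//.
    apply: le_trans (ler_normB _ _) _; rewrite !normrM.
    have B1 : `|dotp (x - x0) nu| * `|dotp v t| <= K * (a * s ^+ 2) ^+ 2 * (3 / s).
      apply: ler_pM => //.
        have as0 : 0 <= a * s ^+ 2 by rewrite mulr_ge0// ltW.
        by apply: le_trans zn _; apply: ler_wpM2l => //; rewrite ler_pXn2r ?nnegrE ?enorm_ge0.
      by apply: le_trans (dotp_norm_le _ _) _; rewrite [enorm t]/enorm t1 sqrtr1 mulr1.
    have B2 : `|dotp (x - x0) t| * `|dotp v nu| <= a * s ^+ 2 * (3 / 2 * s).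
      apply: ler_pM => //.
        by apply: le_trans (dotp_norm_le _ _) _; rewrite [enorm t]/enorm t1 sqrtr1 mulr1.
      by rewrite ger0_norm// (le_trans _ vn0)// divr_ge0// ltW.
    apply: le_trans (lerD B1 B2) _.
    rewrite (_ : K * (a * s ^+ 2) ^+ 2 * (3 / s) + a * s ^+ 2 * (3 / 2 * s) =
      s ^+ 3 * (3 * (K * a) * a + 3 / 2 * a)); last by field; rewrite gt_eqF.
    rewrite ler_pM2l ?exprn_gt0//.
    have a1 : a <= 1 by lra.
    have : 3 * (K * a) * a <= 3 * (K * a) by rewrite ler_piMr// mulr_ge0.
    by move: aK Ka0 a0; move: (K * a) => q *; lra.
  rewrite /shear_arg ler_norml; move: (shear s x v) => q /andP[q1 q2].
  have : 0 <= (2^-1 - q) * (2^-1 + q) by rewrite mulr_ge0//; lra.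
  by lra.
have vv : velocity_arg s v <= 0.
  rewrite /velocity_arg subr_le0 ler_pdivrMr ?exprn_gt0// mul1r -sqr_enorm.
  have : enorm (v - drift s) ^+ 2 <= (s / 8) ^+ 2.
    by rewrite lerXn2r ?nnegrE ?enorm_ge0// divr_ge0// ltW.
  by rewrite exprMn; lra.
have fE : f s x v = amplitude s.
  rewrite profile_space; last by case: touch => _ _ _ _; apply.
  by rewrite !cutoff_le0// !mulr1.
rewrite /trace_density fE mulrAC /k; apply: ler_pM; [|exact: powR_ge0|exact: g1|].
  apply: mulr_ge0; last by rewrite invr_ge0 exprn_ge0// ltW.
  by apply: mulr_ge0; [exact/ltW/gauss_cst_gt0|exact: expR_ge0].
apply: omega_weight_ge => //; first by rewrite divr_gt0//=; lra.
have N0 : 0 < enorm (N x) by rewrite (lt_le_trans ltr01).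
rewrite nE dotpZr normrM ger0_norm ?invr_ge0 ?(ltW N0)// ler_pdivlMl//.
have NM2 : enorm (N x) <= 2 * M.
  have := le_trans (enorm_ler (N x) (M *: nu)) NM.
  have -> : enorm (M *: nu) = M.
    rewrite enormZ gtr0_norm// /enorm; case: touch => _ -> _ _ _.
    by rewrite sqrtr1 mulr1.
  have : K * enorm (x - x0) <= K * (a * s ^+ 2) by rewrite ler_wpM2l.
  have : K * a * s ^+ 2 <= K * a by rewrite ler_piMr// expr_le1// ltW.
  move=> h1 h2 h3; have h4 : K * a <= 1 by lra.
  apply: (@le_trans _ _ (M + 1)); last by have := M1; lra.
  rewrite -lerBlDl; apply: le_trans h3 (le_trans h2 _).
  by rewrite mulrA; exact: le_trans h1 h4.
have NB : enorm (N x) * (s / 8) <= 2 * M * (s / 8) by rewrite ler_wpM2r// divr_ge0// ltW.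
apply: le_trans NB _; apply: le_trans (ler_norm _).
move: nd; rewrite ler_norml => /andP[n1 _].
have : M * (s / 2) <= M * dotp v nu by rewrite ler_pM2l.
have : 3 * K * a * s <= M * s / 4.
  have : s <= M * s by rewrite ler_peMl// ltW.
  have : K * a * s <= 12^-1 * s by rewrite ler_wpM2r ?(ltW s0)//; lra.
  by rewrite -!mulrA; lra.
by lra.
Qed.

Variables (cl cu r2 : R).
Hypotheses (cl0 : 0 < cl) (cu0 : 0 < cu) (r2_gt0 : 0 < r2).
Hypothesis capP : forall a, 0 < a < r2 ->
  [/\ measurable (boundary_cap Omega x0 a),
      ((cl * a ^+ n.+1)%:E <= hausdorff n.+1 (boundary_cap Omega x0 a))%E &
      (hausdorff n.+1 (boundary_cap Omega x0 a) <= (cu * a ^+ n.+1)%:E)%E].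

Lemma trace_profile : exists2 s0 : R, 0 < s0 <= 1 & forall p, 1 <= p ->
  exists b B : R, [/\ 0 < b, 0 < B & forall s, 0 < s < s0 ->
    ((b * s `^ (p - 2))%:E <= trace_functional p Omega (f s))%E /\
    (trace_functional p Omega (f s) <= (B * s `^ (p - 2))%:E)%E].
Proof.
have C10 : 0 < C1 by rewrite addr_gt0// mulr_gt0.
pose a := (12 * (K + 1))^-1.
have K10 : 0 < K + 1 by rewrite ltr_wpDl.
have a0 : 0 < a by rewrite invr_gt0 mulr_gt0.
have a1 : a <= C1.
  rewrite /a invf_ple ?posrE ?mulr_gt0//; apply: (@le_trans _ _ 1).
    by rewrite invf_le1//; have := rho0; lra.
  by have := K0; lra.
(* For s < s0, C1 s^2 <= C1 s is below both radii, so both caps are in the range of the normal and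
   area estimates. The threshold does not depend on p. *)
pose s0 := Num.min 1 (Num.min r1 r2 / C1).
have d0 : 0 < d%:R :> R by rewrite ltr0n.
exists s0 => [|p p1].
  by rewrite /s0 lt_min ltr01 divr_gt0 ?lt_min ?r1_gt0 ?r2_gt0//= ge_min lexx.
pose g1 := @gauss_cst R d * expR (- 2); pose g2 := @gauss_cst R d * expR 2.
have g10 : 0 < g1 by rewrite mulr_gt0 ?expR_gt0 ?gauss_cst_gt0.
have g20 : 0 < g2 by rewrite mulr_gt0 ?expR_gt0 ?gauss_cst_gt0.
pose C4 := 3 / 2 * M + 3 * K * C1.
have C40 : 0 < C4.
  by rewrite ltr_pwDl ?mulr_gt0 ?divr_gt0// !mulr_ge0// ltW.
exists (g1 * 8^-1 `^ p * (4 * d%:R)^-1 ^+ d * (cl * a ^+ n.+1)),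
  (g2 * C4 `^ p * (cu * C1 ^+ n.+1)).
split.
- apply: mulr_gt0; last by rewrite mulr_gt0// exprn_gt0.
  apply: mulr_gt0; last by rewrite exprn_gt0// invr_gt0 mulr_gt0.
  by rewrite mulr_gt0// powR_gt0// invr_gt0.
- apply: mulr_gt0; last by rewrite mulr_gt0// exprn_gt0.
  by rewrite mulr_gt0// powR_gt0.
move=> s /andP[s_gt0]; rewrite lt_min => /andP[s1]; rewrite ltr_pdivlMr// lt_min => /andP[sr1 sr2].
have s01 : 0 < s <= 1 by rewrite s_gt0 ltW.
have small m : m <= C1 -> m * s ^+ 2 < r1 /\ m * s ^+ 2 < r2.
  move=> mC; have H : m * s ^+ 2 <= s * C1.
    apply: (@le_trans _ _ (C1 * s ^+ 2)); first by rewrite ler_wpM2r// sqr_ge0.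
    by rewrite mulrC ler_pM2r// expr2 ler_piMr// ltW.
  by split; exact: le_lt_trans H _.
have E := scaling_identity n (lt0r_neq0 s_gt0).
have s2 m : 0 < m -> 0 < m * s ^+ 2 by move=> m0; rewrite mulr_gt0// exprn_gt0.
have D0 x : boundary Omega x -> (0 <= gauss_int (trace_density p s x))%E.
  by move=> _; apply: integral_ge0 => v _; rewrite lee_fin.
have k10 : 0 <= g1 * s ^- (3 * d) * (s / 8) `^ p * (s / (4 * d%:R)) ^+ d.
  apply: mulr_ge0; last by rewrite exprn_ge0// divr_ge0 ?mulr_ge0// ltW.
  by apply: mulr_ge0; [rewrite divr_ge0 ?exprn_ge0 ?(ltW g10) ?(ltW s_gt0)|exact: powR_ge0].
have k20 : 0 <= g2 * s ^- (3 * d) * (C4 * s) `^ p * s ^+ d.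
  apply: mulr_ge0; last by rewrite exprn_ge0// ltW.
  by apply: mulr_ge0; [rewrite divr_ge0 ?exprn_ge0 ?(ltW g20) ?(ltW s_gt0)|exact: powR_ge0].
split.
  have [as1 as2] := small _ a1; have [|mE HE _] := capP (a := a * s ^+ 2).
    by rewrite s2.
  apply: (@le_trans _ _ ((g1 * s ^- (3 * d) * (s / 8) `^ p * (s / (4 * d%:R)) ^+ d)%:E *
      hausdorff n.+1 (boundary_cap Omega x0 (a * s ^+ 2)))%E).
    apply: le_trans (lee_wpmul2l _ HE); last by rewrite lee_fin.
    rewrite -EFinM lee_fin le_eqVlt; apply/orP; left; apply/eqP.
    rewrite (powRM _ (ltW s_gt0)) ?invr_ge0// (powR_split p s_gt0) (exprMn d s) (exprMn n.+1 a).
    move: E; move: (s ^- (3 * d)) (s ^+ 2) (s ^+ d) ((s ^+ 2) ^+ n.+1) => X Y Z W E.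
    by move: (_ `^ _) (_ `^ _) (a ^+ _) (_^-1 ^+ _) => A B C' D; ring: E.
  apply: integral_ge_cst => //; first by move=> x [].
  move=> x [bx xa]; apply: gauss_trace_ge => //; exact: le_lt_trans xa as1.
have [Cs1 Cs2] := small _ (lexx _); have [|mE _ HE] := capP (a := C1 * s ^+ 2).
  by rewrite s2.
apply: (@le_trans _ _ ((g2 * s ^- (3 * d) * (C4 * s) `^ p * s ^+ d)%:E *
    hausdorff n.+1 (boundary_cap Omega x0 (C1 * s ^+ 2)))%E).
  apply: integral_le_cst => //.
  - move=> x bx [_ xC]; have [H _] := gauss_trace_le p1 s01 bx.
    by apply: H => //; exact: le_lt_trans xC Cs1.
  - move=> x bx out; have [_ H] := gauss_trace_le p1 s01 bx.
    by apply: H => xC; exact: out.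
apply: le_trans (lee_wpmul2l _ HE) _; first by rewrite lee_fin.
rewrite -EFinM lee_fin le_eqVlt; apply/orP; left; apply/eqP.
rewrite (powRM _ (ltW C40) (ltW s_gt0)) (powR_split p s_gt0) (exprMn n.+1 C1).
move: E; move: (s ^- (3 * d)) (s ^+ 2) (s ^+ d) ((s ^+ 2) ^+ n.+1) => X Y Z W E.
by move: (_ `^ _) (_ `^ _) (C1 ^+ _) => A B C'; ring: E.
Qed.

End trace_estimate.

(** * The tangential direction, limits of powers, and the family indexed by h *)

(** A quarter turn of the first two coordinates of nu, which is nonzero because nu has a positive
    first coordinate. This is where d >= 2 enters. *)
Lemma orthogonal_unit_vector {R : realType} {n : nat} (nu : 'rV[R]_n.+2) :
  0 < nu ord0 ord0 -> exists2 t : 'rV[R]_n.+2, dotp t t = 1 & dotp nu t = 0.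
Proof.
move=> nu0; pose i1 : 'I_n.+2 := lift ord0 ord0.
pose u : 'rV[R]_n.+2 := nu ord0 ord0 *: delta_mx ord0 i1 - nu ord0 i1 *: delta_mx ord0 ord0.
have nuu : dotp nu u = 0 by rewrite dotpDr dotpNr !dotpZr !dotp_delta mulrC subrr.
have u0 : 0 < enorm u.
  apply: lt_le_trans (coord_le_enorm u i1); rewrite normr_gt0 !mxE !eqxx/=.
  by rewrite mulr1 mulr0 subr0 gt_eqF.
exists ((enorm u)^-1 *: u); last by rewrite dotpZr nuu mulr0.
by rewrite dotpZl dotpZr -sqr_enorm expr2 mulKf ?mulVf ?gt_eqF.
Qed.

Section limits.
Context {R : realType}.
Local Open Scope ereal_scope.
Variables (T : R -> \bar R) (b B h0 q : R).
Hypotheses (b0 : (0 < b)%R) (B0 : (0 < B)%R) (h0_gt0 : (0 < h0)%R).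

Lemma cvg_right_powR_pinfty : (0 < q)%R ->
  (forall h, (0 < h < h0)%R -> (b * h `^ (- q))%:E <= T h) ->
  T h @[h --> 0%R^'+] --> +oo.
Proof.
move=> q0 Tb; apply/cvgeyPge => A.
have m0 : (0 < b / (`|A| + 1))%R by rewrite divr_gt0// ltr_wpDl.
have [a a0 aP] := powR_small q0 m0.
near=> h; apply: le_trans (Tb h _); last first.
  by apply/andP; split; near: h; [exact: nbhs_right_gt|exact: nbhs_right_lt].
have h_gt0 : (0 < h)%R by near: h; exact: nbhs_right_gt.
have ha : (0 < h < a)%R by rewrite h_gt0/=; near: h; exact: nbhs_right_lt.
rewrite lee_fin powRN; apply: le_trans (ler_norm A) _.
have hq : (0 < h `^ q)%R by exact: powR_gt0.
rewrite ler_pdivlMr//; apply: ltW; apply: le_lt_trans (_ : (`|A| + 1) * h `^ q < b)%R.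
  by rewrite ler_wpM2r ?powR_ge0// lerDl.
by rewrite mulrC -ltr_pdivlMr ?ltr_wpDl//; exact: aP.
Unshelve. all: by end_near. Qed.

Lemma cvg_right_powR_zero : (0 < q)%R ->
  (forall h, (0 < h < h0)%R -> 0 <= T h) ->
  (forall h, (0 < h < h0)%R -> T h <= (B * h `^ q)%:E) ->
  T h @[h --> 0%R^'+] --> 0.
Proof.
move=> q0 T0 TB; apply: (@squeeze_cvge _ _ _ _ (cst 0) T (fun h => (B * h `^ q)%:E)).
- near=> h; have hh : (0 < h < h0)%R.
    by apply/andP; split; near: h; [exact: nbhs_right_gt|exact: nbhs_right_lt].
  by rewrite T0// TB.
- exact: cvg_cst.
apply: cvg_EFin; first exact: nearW.
apply/cvgrPdist_lt => e e0.
have [a a0 aP] := powR_small q0 (divr_gt0 e0 B0).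
near=> h; have h_gt0 : (0 < h)%R by near: h; exact: nbhs_right_gt.
have ha : (0 < h < a)%R by rewrite h_gt0/=; near: h; exact: nbhs_right_lt.
rewrite /= sub0r normrN ger0_norm ?mulr_ge0 ?powR_ge0 ?(ltW B0)//.
by rewrite mulrC -ltr_pdivlMr//; exact: aP.
Unshelve. all: by end_near. Qed.

End limits.

Theorem theorem4p2 (R : realType) (d : nat) (Omega : set 'rV[R]_d)
    (d_ge2 : (2 <= d)%N) (hOmega : bounded_C11_domain Omega) :
  exists (h0 : R) (f : R -> 'rV[R]_d -> 'rV[R]_d -> R),
    0 < h0 /\
    (forall h : R, 0 < h < h0 -> Cc_infty_closure Omega (f h)) /\
    (ereal_sup [set energy Omega (f h) | h in [set h : R | (0 < h < h0)%R]]
       < +oo)%E /\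
    (forall p : R, 1 <= p ->
       exists c C : R, [/\ 0 < c, 0 < C &
         forall h : R, 0 < h < h0 ->
           ((c * h `^ ((p - 2) / 6))%:E <= trace_functional p Omega (f h))%E /\
           (trace_functional p Omega (f h) <= (C * h `^ ((p - 2) / 6))%:E)%E]) /\
    (forall p : R, 1 <= p < 2 ->
       trace_functional p Omega (f h) @[h --> 0^'+] --> +oo%E) /\
    (exists c C : R, 0 < c /\
       forall h : R, 0 < h < h0 ->
         (c%:E <= trace_functional 2 Omega (f h))%E /\
         (trace_functional 2 Omega (f h) <= C%:E)%E) /\
    (forall p : R, 2 < p ->
       trace_functional p Omega (f h) @[h --> 0^'+] --> 0%E).
Proof.
case: d Omega d_ge2 hOmega => [|[|n]] // Omega _ hOmega.
have [neOmega oOmega _ bOmega charts] := hOmega.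
have [c [x0 [nu [rho [touch nu0]]]]] := touching_ball_exists neOmega bOmega.
have [t t1 nut] := orthogonal_unit_vector nu0.
have bx0 : boundary Omega x0 by case: touch.
have [r [P [e [psi chart]]]] := charts _ bx0.
have [M [K [r1 [N [M1 K0 r1_gt0 normalP]]]]] := boundary_tangent touch chart.
have [cl [cu [r2 [cl0 cu0 r2_gt0 capP]]]] := hausdorff_cap touch chart nu0.
have [s0 /andP[s0_gt0 s0_le1] traceP] :=
  trace_profile touch t1 nut M1 K0 r1_gt0 normalP cl0 cu0 r2_gt0 capP.
have [E energyP] := energy_profile_le touch t1 nut nu0 oOmega.
(* The sixth root turns s^(p - 2) into h^((p - 2) / 6), and h < s0^6 is what s < s0 requires. *)
pose s (h : R) := h `^ 6^-1; pose h0 := s0 ^+ 6.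
have sP h : 0 < h < h0 -> 0 < s h < s0.
  move=> /andP[h_gt0 hh0]; rewrite powR_gt0//=.
  rewrite -[ltRHS](powRr1 (ltW s0_gt0)) -(@mulfV _ 6)// powRrM powR_mulrn ?(ltW s0_gt0)//.
  by apply: gt0_ltr_powR; rewrite ?nnegrE ?exprn_ge0 ?invr_gt0 ?(ltW s0_gt0)// ltW.
have sE h p : s h `^ (p - 2) = h `^ ((p - 2) / 6) by rewrite -powRrM mulrC.
pose f h := profile c x0 nu t rho (s h).
have bounds (p : R) : 1 <= p -> exists c C : R, [/\ 0 < c, 0 < C &
    forall h : R, 0 < h < h0 ->
      ((c * h `^ ((p - 2) / 6))%:E <= trace_functional p Omega (f h))%E /\
      (trace_functional p Omega (f h) <= (C * h `^ ((p - 2) / 6))%:E)%E].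
  move=> /traceP[b [B [b0 B0 H]]]; exists b, B; split=> // h /sP hh.
  by rewrite -sE; exact: H.
have h0_gt0 : 0 < h0 by rewrite exprn_gt0.
exists h0, f; split=> //; split.
  move=> h /sP/andP[s_gt0 _]; exists (fun z => profile c x0 nu t rho (s h) z.1 z.2).
  by split=> //; exact: Cc_infty_profile.
split.
  apply: (@le_lt_trans _ _ E%:E); last exact: ltry.
  apply: ge_ereal_sup => _ [h /sP/andP[s_gt0 ss0] <-]; apply: energyP.
  by rewrite s_gt0 ltW// (lt_le_trans ss0).
split; first exact: bounds.
split.
  move=> p /andP[p1 p2]; have [b [B [b0 B0 H]]] := bounds p p1.
  apply: (cvg_right_powR_pinfty b0 h0_gt0 (q := (2 - p) / 6)) => [|h hh].
    by rewrite divr_gt0// subr_gt0.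
  by rewrite -mulNr opprB; have [] := H h hh.
split.
  have [b [B [b0 B0 H]]] := bounds 2 (ler1n _ 2); exists b, B; split=> // h /H.
  by rewrite subrr mul0r powRr0 !mulr1.
move=> p p2; have [|b [B [b0 B0 H]]] := bounds p.
  by apply: le_trans (ltW p2); rewrite ler1n.
apply: (cvg_right_powR_zero B0 h0_gt0 (q := (p - 2) / 6)) => [|h hh|h hh].
- by rewrite divr_gt0// subr_gt0.
- by have [/(le_trans _)->//] := H h hh; rewrite lee_fin mulr_ge0 ?powR_ge0// ltW.
- by have [] := H h hh.
Qed.
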